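(* Let $\alpha>0$, let $(\epsilon_N)_N$ be a sequence in $(0,\infty)$ with $\epsilon_N\sim t_N^{-1}$ as $N\to\infty$, where $t_N=\frac{2}{\pi}N^2\log^2N$, and let $u_N=u_N(\alpha)$ be a sequence of positive numbers with $u_N(\alpha)\sim\frac2\pi\alpha\log^2N$ as $N\to\infty$. Then the law of $\mathcal{I}$ (i.e. of $(1\{x\in\mathcal{I}\})_{x\in\mathbb{Z}^2}$ on $\{0,1\}^{\mathbb{Z}^2}$) under $\mathbb{P}_{\epsilon_N,u_N}[\,\cdot\,|\,0\notin\mathcal{I}]$ converges in distribution, in the sense of finite-dimensional marginals, to $Q^\alpha$ as $N\to\infty$.
   Context: $P_x$ is the law of the continuous-time simple random walk $(X_t)_{t\ge0}$ on $\mathbb{Z}^2$ with exponential holding times of parameter $1$ started at $x$; it also carries an exponential variable $\xi(\epsilon)$ of parameter $\epsilon>0$ independent of $X$. Let $x_*\notin\mathbb{Z}^2$ be a cemetery point. $P_{\epsilon,x}$ is the law under $P_x$ of the killed walk $Y_t=X_t$ for $t<\xi(\epsilon)$, $Y_t=x_*$ for $t\ge\xi(\epsilon)$. For a process, $\widetilde H_A$ denotes the first time, at or after its first jump, at which it is in $A$ ($\inf\emptyset=\infty$). For finite $A\subset\mathbb{Z}^2$, $e_{\epsilon,A}(x)=P_{\epsilon,x}[\widetilde H_A=\infty]$, $x\in A$. $W$ is the set of right-continuous piecewise constant $w:\mathbb{R}\to\mathbb{Z}^2\cup\{x_*\}$, with nearest-neighbour jumps inside $\mathbb{Z}^2$,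 such that the forward part ($t\to+\infty$) and the backward part ($t\to-\infty$) each either reach $x_*$ after finitely many jumps and stay there forever, or stay in $\mathbb{Z}^2$ and leave every finite set in finite time. $W$ carries the $\sigma$-algebra generated by the coordinates; $W^*$ is the quotient of $W$ by time-shifts, with projection $\pi^*$ and induced $\sigma$-algebra; $W_A^*$ is the image under $\pi^*$ of the trajectories visiting $A$. For finite $A$, $Q_{\epsilon,A}$ is the measure on $W$ under which $w(0)=x\in A$ has mass $e_{\epsilon,A}(x)$; given $w(0)=x$, $(w(t))_{t\ge0}$ has law $P_{\epsilon,x}$; and, independently, $w(s)=\lim_{r\uparrow -s}Y_{\sigma+r}$ for $s<0$, with $Y$ sampled from $P_{\epsilon,x}[\,\cdot\,|\widetilde H_A=\infty]$ and $\sigma$ the first time at which $Y$ leaves its initial state. $\nu_\epsilon^*$ is the unique $\sigma$-finite measure on $W^*$, concentrated on $\bigcup_AW_A^*$, with $1_{W_A^*}\nu^*_\epsilon=\pi^*\circ Q_{\epsilon,A}$ for all finite $A$. $\mathbb{P}_{\epsilon,u}$ is the law of a Poisson point measure on $W^*$ with intensity $u\,\nu_\epsilon^*$, and $\mathcal{I}\subset\mathbb{Z}^2$ is the set of sites visited by at least one trajectory in its support. $p_k(x)$ is the probability that the discrete-time simple random walk from $0$ is at $x$ at time $k$; $a(x)=\lim_n\sum_{k=0}^n(p_k(0)-p_k(x))$; $\mathrm{hm}_A(x)=\lim_{|y|\to\infty}P_y[X_{\widetilde H_A}=x]$; for finite $A\ni0$, $\mathrm{cap}(A)=\sum_{x\in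 A}a(x)\mathrm{hm}_A(x)$. $Q^\alpha$ is the probability measure on $\{0,1\}^{\mathbb{Z}^2}$ (product $\sigma$-algebra, coordinates $\widetilde Y_x$) characterized by $Q^\alpha(\widetilde Y_x=0,\ x\in A)=e^{-\frac\pi2\alpha\,\mathrm{cap}(A)}$ for all finite $A\ni0$. $f\sim g$ means that the ratio tends to $1$. *)

(* Defs.v *)
From HB Require Import structures.
From mathcomp Require Import all_boot all_order all_algebra finmap.
From mathcomp Require Import generic_quotient.
From mathcomp Require Import all_classical all_reals all_analysis.

Set Implicit Arguments.
Unset Strict Implicit.
Unset Printing Implicit Defensive.
Import Order.TTheory GRing.Theory Num.Theory.
Import numFieldNormedType.Exports.
Local Open Scope classical_set_scope.
Local Open Scope ring_scope.
Local Open Scope quotient_scope.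

Notation Z2 := (int * int)%type.

Definition nn (x y : Z2) : bool := `|x.1 - y.1| + `|x.2 - y.2| == 1.

(* The filter "|y| -> oo" on Z^2, given by the sets {|y|^2 >= n} for the
   Euclidean norm. *)
Definition infty_Z2 : set_system Z2 :=
  filter_from [set: nat]
    (fun n => [set y : Z2 | n%:Z <= y.1 ^+ 2 + y.2 ^+ 2]).

Definition asymp_equiv (R : realType) (f g : nat -> R) : Prop :=
  (fun N => f N / g N) @ \oo --> (1 : R).

Definition condp d (T : measurableType d) (R : realType)
    (P : probability T R) (E F : set T) : R :=
  fine (P (E `&` F)) / fine (P E).

(* Functionals of a path [f : R -> E], of which only the restriction to
   [0, +oo[ is used. *)
Section path_functionals.
Variables (R : realType) (E : Type).
Implicit Types (f : R -> E) (A : set E).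
Local Open Scope ereal_scope.

Definition first_jump f : \bar R :=
  ereal_inf [set t%:E | t in [set t : R | (0 <= t)%R /\ f t <> f 0%R]].

Definition Htilde A f : \bar R :=
  ereal_inf [set t%:E | t in
    [set t : R | [/\ (0 <= t)%R, first_jump f <= t%:E & A (f t)]]].

End path_functionals.

(* [None] is the cemetery point x_*. *)
Definition embed (A : set Z2) : set (option Z2) := [set Some x | x in A].

(* The walk, realized through its jump chain [Z n], its holding times [T n]
   and the killing times [xi eps].  A single measurable space carries all the
   laws P_x. *)
Section walk.
Variables (R : realType) (d : measure_display) (Omega : measurableType d).
Variables (P : Z2 -> probability Omega R).
Variables (Z : nat -> Omega -> Z2) (T : nat -> Omega -> R).
Variable (xi : R -> Omega -> R).

Definition jump_time (n : nat) (w : Omega) : R := \sum_(k < n) T k w.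

Definition walk (w : Omega) (t : R) : Z2 :=
  Z (get [set n | jump_time n w <= t < jump_time n.+1 w]) w.

(* The first seven conditions, required for every outcome, make every path of
   the walk a right-continuous nearest-neighbour path on [0, +oo[; given the
   last condition they only discard a null set.  The last condition says that,
   under P_x, Z is the discrete-time simple random walk from x, the T k are
   exponential of parameter 1, xi eps is exponential of parameter eps, and
   Z, T 0, T 1, ..., xi eps are independent. *)
Record is_srw : Prop := {
  srw_measurable_chain : forall n z, measurable [set w | Z n w = z];
  srw_measurable_holding : forall n, measurable_fun setT (T n);
  srw_measurable_killing : forall eps, 0 < eps -> measurable_fun setT (xi eps);
  srw_nn : forall n w, nn (Z n w) (Z n.+1 w);
  srw_holding_gt0 : forall n w, 0 < T n w;
  srw_no_explosion : forall w t, exists n, t < jump_time n w;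
  srw_killing_gt0 : forall eps w, 0 < eps -> 0 < xi eps w;
  srw_law : forall (x : Z2) (eps : R) (n : nat) (s : nat -> Z2)
      (B : nat -> set R) (C : set R),
    0 < eps -> (forall k, measurable (B k)) -> measurable C ->
    P x [set w | [/\ forall k, (k <= n)%N -> Z k w = s k,
                     forall k, (k <= n)%N -> B k (T k w) &
                     C (xi eps w)]] =
      (((s 0%N == x)%:R * \prod_(k < n) ((nn (s k) (s k.+1))%:R / 4))%:E *
      (\prod_(k < n.+1) exponential_prob 1 (B k)) * exponential_prob eps C)%E
}.

Definition killed_walk (eps : R) (w : Omega) (t : R) : option Z2 :=
  if t < xi eps w then Some (walk w t) else None.

Definition escape (eps : R) (A : set Z2) : set Omega :=
  [set w | Htilde (embed A) (killed_walk eps w) = +oo%E].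

Definition equilibrium_measure (eps : R) (A : set Z2) (x : Z2) : R :=
  fine (P x (escape eps A)).

Definition harmonic_measure (A : set Z2) (x : Z2) : R :=
  lim ((fun y => fine (P y [set w | exists2 t : R,
    Htilde A (walk w) = t%:E & walk w t = x])) @ infty_Z2).

End walk.

(* The four unit steps, and the law of the sum of k independent uniform ones. *)
Definition unit_step (i : 'I_4) : Z2 :=
  nth 0 [:: (1, 0); (-1, 0); (0, 1); (0, -1)] i.

Definition srw_prob (R : realType) (k : nat) (x : Z2) : R :=
  #|[pred s : {ffun 'I_k -> 'I_4} | \sum_(i < k) unit_step (s i) == x]|%:R
  / (4 ^ k)%:R.

Definition potential_kernel (R : realType) (x : Z2) : R :=
  lim ((fun n : nat => \sum_(k < n.+1) (srw_prob R k 0 - srw_prob R k x)) @ \oo).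

Definition capacity (R : realType) d (Omega : measurableType d)
    (P : Z2 -> probability Omega R) (Z : nat -> Omega -> Z2)
    (T : nat -> Omega -> R) (A : {fset Z2}) : R :=
  \sum_(x <- A) potential_kernel R x * harmonic_measure P Z T [set` A] x.

Section trajectories.
Variable R : realType.

(* Right-continuous with left limits, for the discrete topology of
   Z^2 u {x_*}: this is right-continuous and piecewise constant with finitely
   many jumps on compact intervals. *)
Definition step_path (w : R -> option Z2) : Prop :=
  forall t, (\forall r \near t^'+, w r = w t) /\
            (exists z, \forall r \near t^'-, w r = z).

Definition nn_jumps (w : R -> option Z2) : Prop :=
  forall t x y, (\forall r \near t^'-, w r = Some x) -> w t = Some y ->
    x = y \/ nn x y.

(* x_* is not visited between two visits of Z^2. *)
Definition convex_life (w : R -> option Z2) : Prop :=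
  forall r s t, r < s -> s < t -> w r <> None -> w t <> None -> w s <> None.

Definition dies_or_escapes (w : R -> option Z2) (F : set_system R) : Prop :=
  (\forall t \near F, w t = None) \/
  (forall K : {fset Z2}, \forall t \near F, exists2 x, w t = Some x & x \notin K).

Definition trajectory : set (R -> option Z2) :=
  [set w | [/\ step_path w, nn_jumps w, convex_life w,
               dies_or_escapes w +oo & dies_or_escapes w -oo]].

Definition trajW := set_type trajectory.

Lemma trajectory_dead : trajectory (fun=> None).
Proof.
split => //.
- by move=> t; split; [near=> r|exists None; near=> r].
- by left; near=> r.
- by left; near=> r.
Unshelve. all: by end_near.
Qed.

HB.instance Definition _ := Choice.on trajW.
HB.instance Definition _ := isPointed.Build trajW
  (SigSub (mem_set trajectory_dead)).

(* The sigma-algebra on paths generated by the coordinates in D. *)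
Definition coord_salgebra (D : set R) : set (set (R -> option Z2)) :=
  <<s [set C | exists t z, D t /\ C = [set f | f t = z]] >>.

Definition W := g_sigma_algebraType
  [set C : set trajW | exists t z, C = [set w | val w t = z]].
HB.instance Definition _ := Measurable.on W.

Definition shift_rel (w w' : trajW) : bool :=
  `[< exists h : R, forall t, val w' t = val w (t + h) >].

Lemma shift_rel_equiv : equiv_class_of shift_rel.
Proof.
split.
- by move=> w; apply/asboolP; exists 0 => t; rewrite addr0.
- move=> w w'; apply/idP/idP => /asboolP[h wE]; apply/asboolP;
  by exists (- h) => t; rewrite wE subrK.
- move=> w2 w1 w3 /asboolP[h1 E1] /asboolP[h2 E2]; apply/asboolP.
  by exists (h2 + h1) => t; rewrite E2 E1 addrA.
Qed.

Canonical shift_equiv := EquivRelPack shift_rel_equiv.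

Definition Wstar := {eq_quot shift_rel}.
HB.instance Definition _ := Choice.on Wstar.
HB.instance Definition _ := Quotient.on Wstar.

Definition piW (w : W) : Wstar := \pi_Wstar (w : trajW).

HB.instance Definition _ := isPointed.Build Wstar (piW point).

Definition measurable_Wstar : set (set Wstar) :=
  [set B | measurable (piW @^-1` B)].

Let measurable_Wstar0 : measurable_Wstar set0.
Proof. by rewrite /measurable_Wstar/= preimage_set0. Qed.

Let measurable_WstarC B : measurable_Wstar B -> measurable_Wstar (~` B).
Proof. by rewrite /measurable_Wstar/= preimage_setC; exact: measurableC. Qed.

Let measurable_WstarU (F : (set Wstar)^nat) :
  (forall i, measurable_Wstar (F i)) -> measurable_Wstar (\bigcup_i F i).
Proof.
by move=> mF; rewrite /measurable_Wstar/= preimage_bigcup;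
  exact: bigcupT_measurable.
Qed.

HB.instance Definition _ := @isMeasurable.Build default_measure_display
  Wstar measurable_Wstar measurable_Wstar0 measurable_WstarC measurable_WstarU.

Definition Wstar_visiting (A : set Z2) : set Wstar :=
  piW @` [set w : W | exists t x, A x /\ val w t = Some x].

(* For s < 0, the limit of f (sigma + r) as r increases to -s. *)
Definition backward (f : R -> option Z2) (s : R) : option Z2 :=
  get [set z | \forall r \near (- s)^'-, f (fine (first_jump f) + r) = z].

End trajectories.

Section interlacement_measure.
Variables (R : realType) (d : measure_display) (Omega : measurableType d).
Variables (P : Z2 -> probability Omega R).
Variables (Z : nat -> Omega -> Z2) (T : nat -> Omega -> R).
Variable (xi : R -> Omega -> R).

(* Q is Q_{eps,A}: the events F and B below depend on (w(t))_{t >= 0} and on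
   (w(t))_{t < 0} respectively. *)
Definition is_Q (eps : R) (A : {fset Z2})
    (Q : {measure set (W R) -> \bar R}) : Prop :=
  Q [set w : W R | ~ embed [set` A] (val w 0)] = 0%E /\
  forall (x : Z2) (F B : set (R -> option Z2)), x \in A ->
    coord_salgebra [set t | 0 <= t] F -> coord_salgebra [set t | t < 0] B ->
    Q [set w : W R | [/\ val w 0 = Some x, F (val w) & B (val w)]] =
      (equilibrium_measure P Z T xi eps [set` A] x *
       fine (P x [set w | F (killed_walk Z T xi eps w)]) *
       condp (P x) (escape Z T xi eps [set` A])
         [set w | B (backward (killed_walk Z T xi eps w))])%:E.

End interlacement_measure.

Definition is_nu (R : realType) (Q : {fset Z2} -> {measure set (W R) -> \bar R})
    (nu : {measure set (Wstar R) -> \bar R}) : Prop :=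
  [/\ sigma_finite setT nu,
      nu (~` \bigcup_(A in [set: {fset Z2}]) Wstar_visiting [set` A]) = 0%E &
      forall (A : {fset Z2}) (B : set (Wstar R)), measurable B ->
        nu (B `&` Wstar_visiting [set` A]) = Q A (@piW R @^-1` B)].

(* Point measures sum_i delta_(w_i) on W*, given by a (finite or infinite)
   enumeration of their atoms with multiplicities; [None] is "no atom".  The
   sigma-algebra only sees the point measure: it is generated by the numbers
   of points in measurable sets. *)
Section poisson.
Variable R : realType.
Local Open Scope ereal_scope.

Definition npoints (B : set (Wstar R)) (c : nat -> option (Wstar R)) : \bar R :=
  \esum_(i in [set i | exists2 w, c i = Some w & B w]) 1.

Definition point_config := g_sigma_algebraType
  [set C : set (nat -> option (Wstar R)) | exists B (k : nat),
     measurable B /\ C = [set c | npoints B c = k%:R%:E]].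
HB.instance Definition _ := Measurable.on point_config.

(* The second argument of [poisson_prob] is a dummy. *)
Definition is_poisson_pm (m : set (Wstar R) -> \bar R)
    (PP : probability point_config R) : Prop :=
  [/\ forall B, measurable B -> m B < +oo -> forall k : nat,
        PP [set c | npoints B c = k%:R%:E] =
          poisson_prob (fine (m B)) 0 [set k],
      forall B, measurable B -> m B = +oo -> PP [set c | npoints B c = +oo] = 1 &
      forall (n : nat) (B : nat -> set (Wstar R)) (k : nat -> \bar R),
        (forall i, measurable (B i)) -> trivIset setT B ->
        PP [set c | forall i, (i < n)%N -> npoints (B i) c = k i] =
          \prod_(i < n) PP [set c | npoints (B i) c = k i]].

Definition interlacement (c : point_config) : set Z2 :=
  [set x | exists i w, c i = Some w /\ Wstar_visiting [set x] w].

Definition occupation (c : point_config) (x : Z2) : bool :=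
  `[< interlacement c x >].

(* The law of (1{x \in I})_x under PP( . | 0 \notin I). *)
Definition vacant0_law (PP : probability point_config R)
    (E : set (Z2 -> bool)) : R :=
  condp PP [set c | ~ interlacement c 0%R] [set c | E (occupation c)].

End poisson.

Definition spins := g_sigma_algebraType
  [set C : set (Z2 -> bool) | exists x b, C = [set y | y x = b]].
HB.instance Definition _ := Measurable.on spins.

Definition is_Qalpha (R : realType) (alpha : R) (cap : {fset Z2} -> R)
    (Q : probability spins R) : Prop :=
  forall A : {fset Z2}, 0 \in A ->
    Q [set y | forall x, x \in A -> y x = false] =
      (expR (- (pi / 2 * alpha * cap A)))%:E.

(* Convergence of finite-dimensional marginals on {0,1}^(Z^2): as {0,1}^A is
   finite for finite A, it is convergence of the mass of each point. *)
Definition fdd_cvg (R : realType) (mu : nat -> set (Z2 -> bool) -> R)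
    (mu0 : set (Z2 -> bool) -> R) : Prop :=
  forall (A : {fset Z2}) (eta : Z2 -> bool),
    (fun N => mu N [set y | forall x, x \in A -> y x = eta x]) @ \oo -->
    mu0 [set y | forall x, x \in A -> y x = eta x].

(* Main.v *)
Require Import Defs.
From mathcomp Require Import all_boot all_order all_algebra finmap.
From mathcomp Require Import all_classical all_reals all_analysis.
From mathcomp Require Import measurable_realfun.
From mathcomp Require Import zify ring lra.
Set Implicit Arguments.
Unset Strict Implicit.
Unset Printing Implicit Defensive.
Import Order.TTheory GRing.Theory Num.Theory.
Import numFieldNormedType.Exports.
Local Open Scope classical_set_scope.
Local Open Scope ring_scope.

(* Write l = 1/(1 + eps) for the probability that a jump of the walk is not
   preceded by the killing, g for the Green function of the killed walk at 0
   and cap_eps(A) for the total mass of e_{eps,A}.  The Poisson structure gives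
   P[I misses A | 0 not in I] = exp(-u (cap_eps(A) - cap_eps({0}))), and
   inclusion-exclusion reduces the theorem to the convergence of these numbers.

   Inverting the first-passage decomposition of the Green function shows that
   m = g e_{eps,A} satisfies, for x in A,
     sum_y m(y) = 1 + (1/g) sum_y (G(0) - G(x - y)) m(y),
   and cap_eps({0}) = 1/g.  With x = 0 in A this yields
     g^2 (cap_eps(A) - cap_eps({0})) -> sum_y a(y) lim m(y).
   Subtracting the equation at 0 from that at x, one sees that m solves in the
   limit a linear system with matrix a(x - y) - a(y) + 1, which is invertible by
   the maximum principle.  The hitting distribution of A from a point tending to
   infinity solves the same system in the limit, so lim m = hm_A and the limit
   above is cap(A).  Finally g ~ (2/pi) log N, by the Wallis bounds on the return
   probabilities, so that u_N / g^2 -> (pi/2) alpha. *)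

(** * One-dimensional walk *)

(** The obstacle is that g diverges while cap_eps(A) - cap_eps({0}) is at most of order 1/g^2, so
    only the differences G(0) - G(x) can be followed to the limit. When x has odd parity, p_k(0) and
    p_k(x) are never both nonzero and the difference series converges only conditionally at l = 1.
    Comparing times k and k + 1 at neighbouring sites gives terms of order k^(-3/2), uniformly in l,
    to which dominated convergence applies. The bounds are explicit because rotation by 45 degrees
    turns the walk into two one-dimensional walks with binomial weights. No logarithmic asymptotics
    of a is used. Uniqueness for the limit system needs only a(x + z) - a(x) -> 0, and the inverse
    matrix turns approximate equations into convergence without subsequences; this also gives the
    existence of the limit that defines hm_A. The logarithm enters through g alone: 1 - l^2 is of
    order 1/(N log N)^2 and g ~ -log(1 - l^2)/pi. *)

Section walk1.
Variable R : realType.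

Fixpoint walk1_prob (k : nat) (m : int) : R :=
  if k is k'.+1 then (walk1_prob k' (m - 1) + walk1_prob k' (m + 1)) / 2
  else (m == 0)%R%:R.

Local Notation b := walk1_prob.

Lemma walk1_prob_ge0 k m : 0 <= b k m.
Proof.
by elim: k m => [|k IH] m /=; rewrite ?ler0n// divr_ge0 ?addr_ge0// ler0n.
Qed.

Lemma walk1_probN k m : b k (- m) = b k m.
Proof.
elim: k m => [|k IH] m /=; first by rewrite oppr_eq0.
by rewrite -(IH (m - 1)) -(IH (m + 1)) opprB opprD [_ + b k (- m + 1)]addrC [1 - m]addrC.
Qed.

Lemma walk1_prob_support k m : k%:Z < `|m| -> b k m = 0.
Proof.
elim: k m => [|k IH] m /= km; first by case: eqP => // m0; lia.
by rewrite !IH ?addr0 ?mul0r//; lia.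
Qed.

(** The shift is 2 because of parity, and -1 <= m means |m| <= |m + 2|. The induction passes to m -
    1 and m + 1, which fails only at m = -1, where symmetry gives equality. *)
Lemma walk1_prob_unimodal k m : -1 <= m -> b k (m + 2) <= b k m.
Proof.
elim: k m => [|k IH] m m1 /=.
  by case: eqP => [|_]; [lia|exact: ler0n].
rewrite ler_pM2r ?invr_gt0 ?ltr0n//.
have -> : m + 2 - 1 = (m - 1) + 2 by lia.
have -> : m + 2 + 1 = (m + 1) + 2 by lia.
case: (eqVneq m (-1)) => [->|mN1].
  have -> : -1 - 1 + 2 = 0 :> int by [].
  have -> : -1 + 1 + 2 = 2 :> int by [].
  by rewrite -(walk1_probN k 2) addrC.
by apply: lerD; apply: IH; lia.
Qed.

(** The quotient of consecutive binomial coefficients C(k, (k + m)/2), cleared of denominators so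
    that it also holds outside the support and for the wrong parity. *)
Lemma walk1_prob_ratio k m :
  b k (m + 2) * (k%:Z + m + 2)%:~R = b k m * (k%:Z - m)%:~R.
Proof.
elim: k m => [|k IH] m /=.
  case: eqP => [m2|_]; case: eqP => [m0|_]; rewrite ?mul0r ?mul1r//; try lia.
  - by rewrite (_ : 0%N%:Z + m + 2 = 0)//; lia.
  - by rewrite m0 subrr.
have -> : m + 2 - 1 = m + 1 by lia.
have -> : m + 2 + 1 = (m + 1) + 2 by lia.
have H1 := IH (m - 1); have H2 := IH (m + 1).
rewrite (_ : m - 1 + 2 = m + 1) in H1; last lia.
have k1 : k.+1%:~R = k%:~R + 1 :> R by rewrite -addn1 PoszD intrD.
move: H1 H2; rewrite !(intrD, intrB, mulrNz) k1.
by move: (k%:~R) (m%:~R) (b k (m - 1)) (b k (m + 1)) (b k _) => *; lra.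
Qed.

Lemma walk1_prob_mass k a n : \sum_(i < n) b k (a + 2 * i%:Z) <= 1.
Proof.
elim: k a => [|k IH] a /=; last first.
  rewrite -mulr_suml ler_pdivrMr ?ltr0n// big_split/=.
  have -> : \sum_(i < n) b k (a + 2 * i%:Z - 1) =
            \sum_(i < n) b k ((a - 1) + 2 * i%:Z).
    by apply: eq_bigr => i _; congr b; lia.
  have -> : \sum_(i < n) b k (a + 2 * i%:Z + 1) =
            \sum_(i < n) b k ((a + 1) + 2 * i%:Z).
    by apply: eq_bigr => i _; congr b; lia.
  by have := IH (a - 1); have := IH (a + 1); lra.
(* A term is nonzero only if 2i = -a; recording that this forces a <= 0 is what closes the induction
   on n. *)
suff: \sum_(i < n) (a + 2 * i%:Z == 0)%R%:R <= (a <= 0)%R%:R :> R.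
  by move=> /le_trans; apply; rewrite lern1 leq_b1.
elim: n a => [|n IHn] a; first by rewrite big_ord0 ler0n.
rewrite big_ord_recl/= mulr0 addr0.
have -> : \sum_(i < n) (a + 2 * (bump 0 i)%:Z == 0)%R%:R =
          \sum_(i < n) ((a + 2) + 2 * i%:Z == 0)%R%:R :> R.
  by apply: eq_bigr => i _; congr ((_ == _)%:R); rewrite /bump/=; lia.
apply: (le_trans (lerD (lexx _) (IHn _))); rewrite -natrD ler_nat.
by case: eqP; case: (leP (a + 2)); case: (leP a) => //; lia.
Qed.

(** By unimodality the value at m is the least of those at m, m - 2, m - 4, ... down to 0 or 1;
    there are [(m.+2)./2] of them, with sum at most 1. *)
Lemma walk1_prob_tail k (m : nat) : b k m%:Z * m.+1%:R <= 2.
Proof.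
have mono n i : (2 * i <= n.+1)%N -> b k n%:Z <= b k (n%:Z - 2 * i%:Z).
  elim: i => [|i IH] ni; first by rewrite mulr0 subr0.
  apply: le_trans (IH _) _; first lia.
  rewrite (_ : n%:Z - 2 * i%:Z = n%:Z - 2 * i.+1%:Z + 2); last lia.
  by apply: walk1_prob_unimodal; lia.
have [n nE] : exists n, n = (m.+2)./2 by exists (m.+2)./2.
have H : b k m%:Z * n%:R <= 1.
  rewrite -[n in n%:R]card_ord mulr_natr -sumr_const.
  apply: le_trans (walk1_prob_mass k (m%:Z - 2 * n.-1%:Z) n).
  rewrite [leRHS](reindex_inj rev_ord_inj)/=; apply: ler_sum => i _.
  have i_lt := ltn_ord i.
  rewrite (_ : _ + 2 * (n - i.+1)%N%:Z = m%:Z - 2 * i%:Z); last lia.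
  by apply: mono; lia.
have : m.+1%:R <= 2 * n%:R :> R by rewrite -natrM ler_nat; lia.
move=> /(ler_wpM2l (walk1_prob_ge0 k m%:Z)) /le_trans; apply; lra.
Qed.

(** By [walk1_prob_ratio] the difference times k + m + 2 is 2 (m + 1) [b k m], which
    [walk1_prob_tail] bounds by 4 for m >= 0; symmetry covers the other m. *)
Lemma walk1_prob_diff k m : `|b k m - b k (m + 2)| <= 4 / k.+1%:R.
Proof.
have nneg (n : nat) : `|b k n%:Z - b k (n%:Z + 2)| <= 4 / k.+1%:R.
  rewrite ger0_norm ?subr_ge0 ?walk1_prob_unimodal//.
  rewrite ler_pdivlMr ?ltr0n//.
  have := walk1_prob_ratio k n%:Z; have := walk1_prob_tail k n.
  have := walk1_prob_unimodal k (_ : -1 <= n%:Z) => /(_ isT).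
  rewrite !(intrD, intrB, mulrNz) -!pmulrn -(natr1 k) -(natr1 n).
  have := ler0n R n; have := ler0n R k.
  move: (k%:R) (n%:R) (b k n) (b k (n%:Z + 2)) => K N y x K0 N0 yx xn e.
  have : (y - x) * (K + 1) <= (y - x) * (K + N + 2).
    by rewrite ler_wpM2l ?subr_ge0//; lra.
  lra.
case: (leP 0 m) => [|m0]; first by case: m => // n _; exact: nneg.
case: (eqVneq m (-1)) => [->|mN1].
  by rewrite walk1_probN subrr normr0 divr_ge0// ler0n.
have [n nE] : exists n : nat, n%:Z = - m - 2 by exists `|- m - 2|%N; lia.
rewrite -walk1_probN -(walk1_probN _ (m + 2)) distrC.
rewrite (_ : - (m + 2) = n%:Z); last lia.
by rewrite (_ : - m = n%:Z + 2); [exact: nneg|lia].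
Qed.

(** The recursion of the central binomial coefficients. The Wallis integrals satisfy it too, which
    is how pi enters. *)
Lemma walk1_prob0SS k : b k.+2 0 * k.+2%:R = b k 0 * k.+1%:R.
Proof.
have := walk1_prob_ratio k 0; rewrite add0r addr0 ?subr0 intrD -!pmulrn.
have -> : b k.+2 0 = ((b k (0 - 1 - 1) + b k (0 - 1 + 1)) / 2 +
    (b k (0 + 1 - 1) + b k (0 + 1 + 1)) / 2) / 2 by [].
rewrite (_ : 0 - 1 - 1 = - (2 : int))// (_ : 0 - 1 + 1 = 0 :> int)//.
rewrite (_ : 0 + 1 - 1 = 0 :> int)// (_ : 0 + 1 + 1 = 2 :> int)// walk1_probN.
rewrite -(natr1 k) (_ : k.+2%:R = k%:R + 2); last by rewrite -natrD addn2.
by move: (k%:R) (b k 0) (b k 2) => *; lra.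
Qed.

Lemma walk1_prob0_odd k : b k.*2.+1 0 = 0.
Proof.
elim: k => [|k IH]; first by rewrite /= addr0 mul0r.
rewrite doubleS; have := walk1_prob0SS k.*2.+1; rewrite IH mul0r => /eqP.
by rewrite mulf_eq0 pnatr_eq0 orbF => /eqP.
Qed.

(** Going from k to k + 2 multiplies the left side by (k + 1)(k + 3)/(k + 2)^2 <= 1. *)
Lemma walk1_prob0_sqr_le k : b k 0 ^+ 2 * k.+1%:R <= 1.
Proof.
suff : b k 0 ^+ 2 * k.+1%:R <= 1 /\ b k.+1 0 ^+ 2 * k.+2%:R <= 1 by case.
elim: k => [|k [IH1 IH2]].
  have -> : b 1 0 = 0 by exact: (walk1_prob0_odd 0).
  by rewrite /= expr1n mulr1 lexx expr0n/= mul0r ler01.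
split => //; have e := walk1_prob0SS k.
have k0 : 0 < k.+2%:R :> R by rewrite ltr0n.
have -> : b k.+2 0 = b k 0 * k.+1%:R / k.+2%:R by rewrite -e mulfK// gt_eqF.
rewrite expr_div_n mulrAC ler_pdivrMr ?exprn_gt0// mul1r.
rewrite exprMn [_ ^+ 2 * k.+1%:R ^+ 2]mulrC -mulrA.
have : k.+1%:R * (b k 0 ^+ 2 * k.+1%:R) * k.+3%:R <= k.+1%:R * k.+3%:R :> R.
  by rewrite -[leRHS]mul1r [k.+1%:R * (_ * _)]mulrC -mulrA ler_wpM2r ?mulr_ge0 ?ler0n.
move=> h; have : k.+1%:R * k.+3%:R <= k.+2%:R ^+ 2 :> R.
  by rewrite -natrX -natrM ler_nat; lia.
by apply: le_trans; apply: le_trans h; rewrite expr2; lra.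
Qed.

(** Unimodality brings m to 0 or 1 according to its parity, and [b k 1] is [b k.+1 0]; the sum
    covers both cases. *)
Lemma walk1_prob_le k m : b k m <= b k 0 + b k.+1 0.
Proof.
have b1 : b k.+1 0 = b k 1.
  have -> : b k.+1 0 = (b k (0 - 1) + b k (0 + 1)) / 2 by [].
  by rewrite sub0r add0r walk1_probN; lra.
have nneg (n : nat) : b k n%:Z <= b k 0 + b k.+1 0.
  elim/ltn_ind: n => -[|[|n]] IH; rewrite ?b1.
  - by rewrite lerDl walk1_prob_ge0.
  - by rewrite lerDr walk1_prob_ge0.
  apply: le_trans (_ : b k n%:Z <= _); last by rewrite -b1; exact: IH.
  by rewrite (_ : n.+2%:Z = n%:Z + 2)//; [exact: walk1_prob_unimodal|lia].
case: (intP m) => [|n|n]; [exact: (nneg 0%N)|exact: (nneg n.+1)|].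
by rewrite walk1_probN; exact: nneg n.+1.
Qed.

Lemma walk1_prob_sqr_le k m : b k m ^+ 2 * k.+1%:R <= 4.
Proof.
have h0 := walk1_prob0_sqr_le k; have h1 := walk1_prob0_sqr_le k.+1.
have h2 : b k.+1 0 ^+ 2 * k.+1%:R <= 1.
  by apply: le_trans h1; rewrite ler_wpM2l ?sqr_ge0// ler_nat.
have : b k m ^+ 2 <= (b k 0 + b k.+1 0) ^+ 2.
  by rewrite lerXn2r ?nnegrE ?addr_ge0 ?walk1_prob_ge0 ?walk1_prob_le.
move=> /(ler_wpM2r (ler0n R k.+1)) /le_trans; apply.
move: (b k 0) (b k.+1 0) (k.+1%:R) (ler0n R k.+1) h0 h2 => x y n n0 h0 h2.
have : 0 <= (x - y) ^+ 2 * n by rewrite mulr_ge0 ?sqr_ge0.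
have -> : (x + y) ^+ 2 * n = 2 * (x ^+ 2 * n) + 2 * (y ^+ 2 * n) -
  (x - y) ^+ 2 * n by ring.
by lra.
Qed.

End walk1.

(** * Dominated convergence for series, and summability of k^(-3/2) *)

Section series_lemmas.
Variable R : realType.
Implicit Types (f g c : nat -> R).

Lemma cvg_sumr (T : Type) (F : set_system T) (I : Type) (r : seq I)
    (f : I -> T -> R) (l : I -> R) : Filter F ->
  (forall i, f i x @[x --> F] --> l i) ->
  \sum_(i <- r) f i x @[x --> F] --> \sum_(i <- r) l i.
Proof.
move=> FF fl; apply: (@cvg_big R^o) => //; exact: add_continuous.
Qed.

Lemma series_dominated_cvg f c : (forall k, `|f k| <= c k) ->
  cvgn (series c) -> cvgn (series f).
Proof.
move=> fc cc; apply: normed_cvg; apply: series_le_cvg cc => // k.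
- exact: normr_ge0.
- by apply: le_trans (fc k); exact: normr_ge0.
Qed.

Lemma series_tail_le f c : (forall k, `|f k| <= c k) -> cvgn (series c) ->
  forall n, `|limn (series f) - series f n| <= limn (series c) - series c n.
Proof.
move=> fc cc n.
have cf := series_dominated_cvg fc cc.
apply: (@ler_cvg_to _ \oo _ _ (fun m => `|series f m - series f n|)
   (fun m => series c m - series c n)).
- by apply: cvg_norm; apply: cvgB => //; exact: cvg_cst.
- by apply: cvgB => //; exact: cvg_cst.
- exists n => // m /= nm; rewrite !sub_series_geq//.
  by apply: le_trans (ler_norm_sum _ _ _) _; exact: ler_sum.
Qed.

(** The filter is arbitrary because this serves both as l tends to 1 and as x tends to infinity. *)
Lemma tannery (T : Type) (F : set_system T) (f : T -> nat -> R) g c :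
    ProperFilter F -> (forall t k, `|f t k| <= c k) -> cvgn (series c) ->
    (forall k, f t k @[t --> F] --> g k) ->
  limn (series (f t)) @[t --> F] --> limn (series g).
Proof.
move=> FF fc cc fg.
have gc k : `|g k| <= c k.
  have h : `|f t k| @[t --> F] --> `|g k| by apply: cvg_norm; exact: fg.
  rewrite -(cvg_lim (@Rhausdorff R) h); apply: limr_le.
    by apply/cvg_ex; exists `|g k|.
  by near=> t.
apply/cvgrPdist_le => e e0.
have e3 : 0 < e / 3 by rewrite divr_gt0.
have /cvgrPdist_le/(_ _ e3)[n _ /(_ n (leqnn n))/= cn] := cc.
have fgn : series (f t) n @[t --> F] --> series g n.
  by rewrite /series/=; exact: cvg_sumr.
near=> t.
have h1 := le_trans (series_tail_le (fc t) cc n) (le_trans (ler_norm _) cn).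
have h2 := le_trans (series_tail_le gc cc n) (le_trans (ler_norm _) cn).
have h3 : `|series g n - series (f t) n| <= e / 3.
  by near: t; move/cvgrPdist_le : fgn; exact.
rewrite (_ : _ - _ = (limn (series g) - series g n) +
  (series g n - series (f t) n) - (limn (series (f t)) - series (f t) n)).
  apply: le_trans (ler_normB _ _) _.
  apply: le_trans (lerD (ler_normD _ _) (lexx _)) _.
  by apply: le_trans (lerD (lerD h2 h3) h1) _; lra.
by lra.
Unshelve. all: by end_near. Qed.

Definition invsqrtS (k : nat) : R := (Num.sqrt k.+1%:R)^-1.

Lemma invsqrtS_gt0 k : 0 < invsqrtS k.
Proof. by rewrite invr_gt0 sqrtr_gt0 ltr0n. Qed.

Lemma invsqrtS_sqr k : invsqrtS k ^+ 2 = k.+1%:R^-1.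
Proof. by rewrite exprVn sqr_sqrtr// ler0n. Qed.

Lemma invsqrtS_le1 k : invsqrtS k <= 1.
Proof.
rewrite invf_le1 ?sqrtr_gt0 ?ltr0n// -{1}sqrtr1 ler_sqrt ?ler0n//.
by rewrite ler1n.
Qed.

(** With s = sqrt(k + 1) and t = sqrt(k + 2), (t - s)(t + s) = 1, hence 1/s - 1/t = 1/(s t (s + t))
    >= 1/(2 t^3). *)
Lemma invsqrtS_cube_telescope k :
  invsqrtS k.+1 ^+ 3 <= 2 * (invsqrtS k - invsqrtS k.+1).
Proof.
set s := Num.sqrt (k.+1%:R : R); set t := Num.sqrt (k.+2%:R : R).
have s0 : 0 < s by rewrite sqrtr_gt0 ltr0n.
have t0 : 0 < t by rewrite sqrtr_gt0 ltr0n.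
have st : s <= t by rewrite ler_sqrt ?ler0n// ler_nat.
have ts : (t - s) * (t + s) = 1.
  by rewrite -subr_sqr !sqr_sqrtr ?ler0n// -natrB// subSnn.
rewrite /invsqrtS -/s -/t.
have -> : 2 * (s^-1 - t^-1) = 2 * ((t - s) * (t + s)) / (s * t * (t + s)).
  by field; rewrite !gt_eqF//= addr_gt0.
rewrite ts mulr1 exprVn -[leLHS]mul1r ler_pdivrMr ?exprn_gt0//.
rewrite mulrAC ler_pdivlMr ?mulr_gt0 ?addr_gt0// mul1r.
have : s * t * (t + s) <= t * t * (t + t).
  by apply: ler_pM; rewrite ?mulr_ge0 ?addr_ge0 ?ler_pM2r ?lerD2l ?(ltW s0)
    ?(ltW t0).
by rewrite !exprS expr0; lra.
Qed.

Lemma cvg_series_invsqrtS_cube : cvgn (series (fun k => invsqrtS k ^+ 3)).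
Proof.
apply: nondecreasing_is_cvgn.
  apply/nondecreasing_seqP => n; rewrite /series/= big_nat_recr//= lerDl.
  by rewrite exprn_ge0// ltW// invsqrtS_gt0.
exists 3 => _ [n _ <-].
suff : series (fun k => invsqrtS k ^+ 3) n.+1 <= 3 - 2 * invsqrtS n.
  have := invsqrtS_gt0 n; rewrite /series/= big_nat_recr//=.
  by have := exprn_gt0 3 (invsqrtS_gt0 n); lra.
elim: n => [|n IH].
  by rewrite /series/= big_nat1 /invsqrtS sqrtr1 invr1 expr1n; lra.
rewrite /series/= big_nat_recr//=; move: IH; rewrite /series/= => IH.
by have := invsqrtS_cube_telescope n; lra.
Qed.

End series_lemmas.

#[global] Instance infty_Z2_proper : ProperFilter infty_Z2.
Proof.
apply: filter_from_proper => [|n _].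
  apply: filter_fromT_filter; first by exists 0%N.
  move=> m n; exists (maxn m n) => y /= h; split => /=; apply: le_trans h; lia.
by exists (n%:Z, 0) => /=; nia.
Qed.

(** * Two-dimensional walk and potential kernel *)

Section walk2.
Variable R : realType.
Local Notation b := (walk1_prob R).
Local Notation q := (@invsqrtS R).
Implicit Types (x y : Z2) (i j : 'I_4).

Definition step_avg (h : Z2 -> R) (y : Z2) : R := (\sum_(i < 4) h (y + unit_step i)) / 4.
Local Notation avg := step_avg.

Lemma avgE h y :
  avg h y = (h (y + (1, 0)) + h (y + (-1, 0)) + h (y + (0, 1)) + h (y + (0, -1))) / 4.
Proof. by rewrite /avg /unit_step !big_ord_recl big_ord0/= addr0 !addrA. Qed.

(* The walk is the product of two independent one-dimensional walks in the
   coordinates x.1 + x.2 and x.1 - x.2. *)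
Definition walk2_prob (k : nat) (x : Z2) : R := b k (x.1 + x.2) * b k (x.1 - x.2).
Local Notation p := walk2_prob.

Lemma walk2_prob0 x : p 0 x = (x == 0)%R%:R.
Proof.
case: x => u v; rewrite /walk2_prob/= -natrM mulnb; congr ((_ : bool)%:R).
by apply/andP/eqP => [[/eqP uv /eqP uv']|[-> ->]//]; congr pair; lia.
Qed.

Lemma walk2_probS k y : p k.+1 y = avg (p k) y.
Proof.
rewrite avgE /walk2_prob/=; case: y => u v /=.
rewrite !addr0 (_ : u + 1 + v = u + v + 1) 1?(_ : u + 1 - v = u - v + 1); try lia.
rewrite (_ : u - 1 + v = u + v - 1) 1?(_ : u - 1 - v = u - v - 1); try lia.
rewrite (_ : u + (v + 1) = u + v + 1) 1?(_ : u - (v + 1) = u - v - 1); try lia.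
rewrite (_ : u + (v - 1) = u + v - 1) 1?(_ : u - (v - 1) = u - v + 1); try lia.
move: (b k (u + v + 1)) (b k (u + v - 1)) (b k (u - v + 1)) (b k (u - v - 1)) => *.
by field.
Qed.

Lemma walk2_probN k x : p k (- x) = p k x.
Proof.
rewrite /walk2_prob/= (_ : - x.1 + - x.2 = - (x.1 + x.2)); last lia.
by rewrite (_ : - x.1 - - x.2 = - (x.1 - x.2)) ?walk1_probN//; lia.
Qed.

Lemma walk2_prob_ge0 k x : 0 <= p k x.
Proof. by rewrite mulr_ge0 ?walk1_prob_ge0. Qed.

Lemma walk2_prob_le k x : p k x <= 4 / k.+1%:R.
Proof.
rewrite ler_pdivlMr ?ltr0n// /walk2_prob.
have := walk1_prob_sqr_le R k (x.1 + x.2); have := walk1_prob_sqr_le R k (x.1 - x.2).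
move: (b k (x.1 + x.2)) (b k (x.1 - x.2)) => u v.
have : 0 <= (u - v) ^+ 2 * k.+1%:R by rewrite mulr_ge0 ?sqr_ge0.
by rewrite sqrrB => *; lra.
Qed.

Lemma walk2_prob_support k x : (k%:Z ^+ 2 < x.1 ^+ 2 + x.2 ^+ 2) -> p k x = 0.
Proof.
move=> kx; have [xk|xk] := ltP k%:Z `|x.1 + x.2|.
  by rewrite /walk2_prob walk1_prob_support// mul0r.
have [xk'|xk'] := ltP k%:Z `|x.1 - x.2|.
  by rewrite /walk2_prob mulrC walk1_prob_support// mul0r.
suff : (x.1 + x.2) ^+ 2 + (x.1 - x.2) ^+ 2 <= k%:Z ^+ 2 + k%:Z ^+ 2 by nia.
by apply: lerD; rewrite -[leLHS]real_normK ?num_real// lerXn2r ?nnegrE.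
Qed.

Lemma srw_probE k x : srw_prob R k x = p k x.
Proof.
elim: k x => [|k IH] x.
  rewrite walk2_prob0 /srw_prob expn0 divr1; congr (_%:R).
  rewrite (eq_card (_ : _ =i [pred s : {ffun 'I_0 -> 'I_4} | x == 0])); last first.
    by move=> s; rewrite !inE big_ord0 eq_sym.
  case: eqP => _; last exact: eq_card0.
  by rewrite (eq_card (_ : _ =i predT))// card_ffun !card_ord.
rewrite walk2_probS avgE -!IH /srw_prob.
(* [F] and [G] identify words of length k + 1 with pairs of a first step and a word of length k. *)
have shift : #|[pred s : {ffun 'I_k.+1 -> 'I_4} | \sum_(i < k.+1) unit_step (s i) == x]| =
    (\sum_(a < 4) #|[pred s : {ffun 'I_k -> 'I_4} |
       (\sum_(i < k) unit_step (s i) == x - unit_step a)%R]|)%N.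
  rewrite -sum1_card.
  pose F (as_ : 'I_4 * {ffun 'I_k -> 'I_4}) : {ffun 'I_k.+1 -> 'I_4} :=
    [ffun i => if unlift ord0 i is Some j then as_.2 j else as_.1].
  pose G (s : {ffun 'I_k.+1 -> 'I_4}) : 'I_4 * {ffun 'I_k -> 'I_4} :=
    (s ord0, [ffun j => s (lift ord0 j)]).
  have FG : cancel F G.
    case=> a s; rewrite /F /G/= ffunE unlift_none/=; congr pair.
    by apply/ffunP => j; rewrite !ffunE liftK.
  have GF : cancel G F.
    move=> s; apply/ffunP => i; rewrite /F /G !ffunE/=.
    by case: unliftP => [j ->|->]//; rewrite ffunE.
  rewrite (reindex F)/=; last by exists G => s _; [exact: FG|exact: GF].
  under [RHS]eq_bigr do rewrite -sum1_card.
  rewrite pair_big_dep/=; apply: eq_bigl => -[a s] /=.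
  rewrite !inE big_ord_recl/= ffunE unlift_none/=.
  under eq_bigr do rewrite ffunE liftK/=.
  by rewrite [RHS]eq_sym subr_eq [RHS]eq_sym [X in X == _]addrC.
rewrite shift !big_ord_recl big_ord0 /unit_step/= addn0.
rewrite !natrD expnS natrM.
have -> : x + (1, 0) = x - (-1, 0) by congr pair => /=; lia.
have -> : x + (-1, 0) = x - (1, 0) by [].
have -> : x + (0, 1) = x - (0, -1) by congr pair => /=; lia.
have -> : x + (0, -1) = x - (0, 1) by [].
rewrite invfM; set e := (4 ^ k)%:R^-1.
do 4 move: (#|_|%:R) => ?.
by lra.
Qed.

Lemma walk1_prob_le_invsqrt k m : b k m <= 2 * q k.
Proof.
rewrite -(@ler_pXn2r _ 2) ?nnegrE ?walk1_prob_ge0 ?mulr_ge0 ?(ltW (invsqrtS_gt0 _ _))//.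
rewrite exprMn invsqrtS_sqr ler_pdivlMr ?ltr0n//.
by have := walk1_prob_sqr_le R k m; rewrite -natrX.
Qed.

Lemma walk1_prob_shift_le k m s : s \in [:: 0; 2; -2] ->
  `|b k m - b k (m + s)| <= 4 * q k ^+ 2.
Proof.
rewrite invsqrtS_sqr !inE => /or3P[]/eqP->.
- by rewrite addr0 subrr normr0 divr_ge0.
- exact: walk1_prob_diff.
- by rewrite -{1}(subrK 2 m) distrC; exact: walk1_prob_diff.
Qed.

Lemma unit_step_diag i : let e := unit_step i in
  (e.1 + e.2 \in [:: 1; -1]) && (e.1 - e.2 \in [:: 1; -1]).
Proof. by case: i => -[|[|[|[|]]]]. Qed.

(** Two unit steps change each diagonal coordinate by 0, 2 or -2. One factor then changes by at most
    4 q^2 while the other is at most 2 q, and the product rule has two such terms. *)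
Lemma walk2_prob_diff k x i j :
  `|p k x - p k (x + unit_step i + unit_step j)| <= 16 * q k ^+ 3.
Proof.
have /andP[i1 i2] := unit_step_diag i; have /andP[j1 j2] := unit_step_diag j.
set y : Z2 := x + unit_step i + unit_step j.
have [s ys sP] : exists2 s, y.1 + y.2 = x.1 + x.2 + s & s \in [:: 0; 2; -2].
  exists ((unit_step i).1 + (unit_step i).2 + ((unit_step j).1 + (unit_step j).2)).
    by rewrite /y/=; lia.
  by move: i1 j1; rewrite !inE => /orP[]/eqP-> /orP[]/eqP->.
have [r yr rP] : exists2 s, y.1 - y.2 = x.1 - x.2 + s & s \in [:: 0; 2; -2].
  exists ((unit_step i).1 - (unit_step i).2 + ((unit_step j).1 - (unit_step j).2)).
    by rewrite /y/=; lia.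
  by move: i2 j2; rewrite !inE => /orP[]/eqP-> /orP[]/eqP->.
rewrite /walk2_prob ys yr.
have h1 := walk1_prob_shift_le k (x.1 + x.2) sP.
have h2 := walk1_prob_shift_le k (x.1 - x.2) rP.
have l1 := walk1_prob_le_invsqrt k (x.1 + x.2 + s).
have l2 := walk1_prob_le_invsqrt k (x.1 - x.2).
have := walk1_prob_ge0 R k (x.1 + x.2 + s).
have := walk1_prob_ge0 R k (x.1 - x.2).
move: (b k (x.1 + x.2)) (b k (x.1 + x.2 + s)) (b k (x.1 - x.2)) (b k (x.1 - x.2 + r))
  h1 h2 l1 l2 => a a' c c' h1 h2 l1 l2 c0 a0.
have -> : a * c - a' * c' = (a - a') * c + a' * (c - c') by ring.
apply: le_trans (ler_normD _ _) _; rewrite !normrM (ger0_norm c0) (ger0_norm a0).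
have -> : 16 * q k ^+ 3 = 4 * q k ^+ 2 * (2 * q k) + 2 * q k * (4 * q k ^+ 2) by ring.
by apply: lerD; apply: ler_pM.
Qed.

(* Comparing p_k(x) with p_(k+1) at a neighbour of x avoids the parity problem. *)
Definition stagger (i : 'I_4) (x : Z2) (k : nat) : R := p k x - p k.+1 (x + unit_step i).

(** p_(k+1) at [x + unit_step i] is an average of p_k over points two steps away from x, so
    [walk2_prob_diff] applies to each term. *)
Lemma stagger_le i x k : `|stagger i x k| <= 16 * q k ^+ 3.
Proof.
rewrite /stagger walk2_probS /avg.
have -> : p k x = (\sum_(j < 4) p k x) / 4 by rewrite sumr_const card_ord -(mulr_natr (p k x) 4) mulfK// pnatr_eq0.
rewrite -mulrBl -sumrB normrM (ger0_norm (_ : 0 <= 4^-1)) ?invr_ge0//.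
rewrite ler_pdivrMr//; apply: le_trans (ler_norm_sum _ _ _) _.
apply: (@le_trans _ _ (\sum_(j < 4) 16 * q k ^+ 3)).
  by apply: ler_sum => j _; exact: walk2_prob_diff.
by rewrite sumr_const card_ord mulr_natr.
Qed.

Lemma cvg_series_invsqrtS_cubeM (c : R) : cvgn (series (fun k => c * q k ^+ 3)).
Proof. by apply: (@is_cvg_seriesZ _ _ c); exact: cvg_series_invsqrtS_cube. Qed.

Lemma cvg_walk2_prob x : p k x @[k --> \oo] --> 0.
Proof.
apply: (@squeeze_cvgr _ _ _ _ (fun=> 0) (fun k => 4 * harmonic k)).
- by apply: nearW => k; rewrite walk2_prob_ge0 walk2_prob_le.
- exact: cvg_cst.
- by rewrite -[X in _ --> X](mulr0 4); apply: cvgMr; exact: cvg_harmonic.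
Qed.

(** (k + 1)(1 - l) l^k is at most the sum of (1 - l) l^j over j <= k, which is 1 - l^(k+1). The
    bound is uniform in l, as dominated convergence for l -> 1 requires. *)
Lemma geometric_le_harmonic (l : R) k : 0 <= l <= 1 -> (1 - l) * l ^+ k <= k.+1%:R^-1.
Proof.
move=> /andP[l0 l1]; rewrite -[leRHS]mul1r ler_pdivlMr ?ltr0n//.
have -> : (1 - l) * l ^+ k * k.+1%:R = \sum_(j < k.+1) (1 - l) * l ^+ k.
  by rewrite sumr_const card_ord mulr_natr.
apply: (@le_trans _ _ (\sum_(j < k.+1) (1 - l) * l ^+ j)).
  apply: ler_sum => j _; rewrite ler_wpM2l ?subr_ge0// ler_wiXn2l//.
  by rewrite -ltnS.
by rewrite -mulr_sumr -opprB mulNr -subrX1 opprB gerBl exprn_ge0.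
Qed.

(* l^k (p_k(x) - p_k(y)), with y a neighbour of x, is l^k times the staggered
   difference, plus a telescoping term, plus [green_resid l y k]. *)
Definition green_resid (l : R) (y : Z2) (k : nat) : R := (1 - l) * l ^+ k * p k.+1 y.

Lemma green_resid_le l y k : 0 <= l <= 1 -> `|green_resid l y k| <= 4 * q k ^+ 3.
Proof.
move=> l01; have /andP[l0 l1] := l01; rewrite ger0_norm; last first.
  apply: mulr_ge0 (walk2_prob_ge0 _ _).
  by apply: mulr_ge0; [rewrite subr_ge0|exact: exprn_ge0].
rewrite /green_resid.
apply: (@le_trans _ _ (q k ^+ 2 * (4 * q k ^+ 2))).
  apply: ler_pM (walk2_prob_ge0 _ _) _ _.
    by apply: mulr_ge0; [rewrite subr_ge0|exact: exprn_ge0].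
    by rewrite invsqrtS_sqr geometric_le_harmonic.
  rewrite invsqrtS_sqr; apply: le_trans (walk2_prob_le _ _) _.
  by rewrite ler_pM2l// lef_pV2 ?posrE ?ltr0n// ler_nat.
rewrite mulrCA -exprD ler_pM2l// ler_wiXn2l//; last exact: invsqrtS_le1.
by rewrite ltW// invsqrtS_gt0.
Qed.

(** The series is G(0) - G(x) for l < 1 and a(x) for l = 1, so the convergence of the former to the
    latter is a continuity statement in l. *)
Definition green_diff (l : R) (x : Z2) (k : nat) : R := l ^+ k * (p k 0 - p k x).

Lemma green_diff_step l i x : 0 <= l <= 1 ->
  series (fun k => l ^+ k * (p k x - p k (x + unit_step i))) @ \oo -->
  limn (series (fun k => l ^+ k * stagger i x k)) - p 0 (x + unit_step i) +
  limn (series (green_resid l (x + unit_step i))).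
Proof.
move=> l01; have /andP[l0 l1] := l01.
set y := x + _.
have -> : series (fun k => l ^+ k * (p k x - p k y)) =
    (fun n => series (fun k => l ^+ k * stagger i x k) n +
       (l ^+ n * p n y - p 0 y) + series (green_resid l y) n).
  apply/funext => n; rewrite /series/=; elim: n => [|n IH].
    by rewrite !big_nil mul1r subrr !addr0.
  by rewrite !big_nat_recr//= IH /stagger /green_resid -/y exprS; ring.
apply: cvgD; last first.
  apply: (@series_dominated_cvg _ _ (fun k => 4 * q k ^+ 3)) => [k|].
    exact: green_resid_le.
  exact: cvg_series_invsqrtS_cubeM.
apply: cvgD.
  apply: (@series_dominated_cvg _ _ (fun k => 16 * q k ^+ 3)) => [k|]; last first.
    exact: cvg_series_invsqrtS_cubeM.
  rewrite normrM ger0_norm ?exprn_ge0// -[leRHS]mul1r.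
  by rewrite ler_pM ?exprn_ge0 ?exprn_ile1 ?stagger_le.
rewrite -[X in _ --> X]add0r; apply: cvgD; last exact: cvg_cst.
apply: (@squeeze_cvgr _ _ _ _ (fun=> 0) (fun k => p k y)).
- apply: nearW => k; rewrite mulr_ge0 ?exprn_ge0 ?walk2_prob_ge0//=.
  by rewrite ler_piMl ?walk2_prob_ge0 ?exprn_ile1.
- exact: cvg_cst.
- exact: cvg_walk2_prob.
Qed.

Lemma Z2_unit_step_ind (S : Z2 -> Prop) :
  S 0 -> (forall x i, S x -> S (x + unit_step i)) -> forall x, S x.
Proof.
move=> S0 SS; case=> u v.
have Su : S (u, 0).
  elim/int_ind: u => [|n IH|n IH]; first exact: S0.
    rewrite (_ : (_, _) = (n%:Z, 0) + unit_step (@Ordinal 4 0 isT)); first exact: SS.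
    by congr pair => /=; lia.
  rewrite (_ : (_, _) = (- n%:Z, 0) + unit_step (@Ordinal 4 1 isT)); first exact: SS.
  by congr pair => /=; lia.
elim/int_ind: v => [|n IH|n IH]; first exact: Su.
  rewrite (_ : (_, _) = (u, n%:Z) + unit_step (@Ordinal 4 2 isT)); first exact: SS.
  by congr pair => /=; lia.
rewrite (_ : (_, _) = (u, - n%:Z) + unit_step (@Ordinal 4 3 isT)); first exact: SS.
by congr pair => /=; lia.
Qed.

(** At l = 1 and odd parity of x the terms are not absolutely summable, so nothing dominates them
    directly. Going from 0 to x by unit steps leaves, for each step, two dominated series and a
    boundary term. *)
Lemma green_diffP x :
  (forall l, 0 <= l <= 1 -> cvgn (series (green_diff l x))) /\
  (forall l_ : nat -> R, (forall n, 0 <= l_ n <= 1) -> l_ @ \oo --> (1 : R) ->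
    limn (series (green_diff (l_ n) x)) @[n --> \oo] -->
    limn (series (green_diff 1 x))).
Proof.
elim/Z2_unit_step_ind: x => [|x i [IH1 IH2]].
  have s0 l : series (green_diff l 0) = fun=> 0.
    by apply/funext => n; rewrite /series/= big1// => k _; rewrite /green_diff subrr mulr0.
  split=> [l _|l_ _ _]; rewrite ?s0; first exact: is_cvg_cst.
  by under eq_cvg do rewrite s0; rewrite lim_cst//; exact: cvg_cst.
have stepE l n : series (green_diff l (x + unit_step i)) n = series (green_diff l x) n +
    series (fun k => l ^+ k * (p k x - p k (x + unit_step i))) n.
  by rewrite /series/= -big_split/=; apply: eq_bigr => k _; rewrite /green_diff; ring.
have stepL l : 0 <= l <= 1 -> series (green_diff l (x + unit_step i)) @ \oo -->
    limn (series (green_diff l x)) +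
    (limn (series (fun k => l ^+ k * stagger i x k)) - p 0 (x + unit_step i) +
     limn (series (green_resid l (x + unit_step i)))).
  move=> l01; under eq_cvg do rewrite stepE.
  by apply: cvgD; [exact: IH1|exact: green_diff_step].
split=> [l l01|l_ l01 l1]; first by apply/cvg_ex; eexists; exact: stepL.
have -> : (fun n => limn (series (green_diff (l_ n) (x + unit_step i)))) =
    fun n => limn (series (green_diff (l_ n) x)) +
    (limn (series (fun k => (l_ n) ^+ k * stagger i x k)) - p 0 (x + unit_step i) +
     limn (series (green_resid (l_ n) (x + unit_step i)))).
  by apply/funext => n; apply/cvg_lim => //; exact: stepL.
rewrite (cvg_lim _ (@stepL 1 _)) ?ler01 ?lexx//.
have lk k : l_ n ^+ k @[n --> \oo] --> (1 : R) ^+ k.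
  apply: (@cvg_comp _ _ _ l_ (fun y : R => y ^+ k) _ _ _ l1).
  exact: exprn_continuous.
apply: cvgD; first exact: IH2.
apply: cvgD; first (apply: cvgB; last exact: cvg_cst).
  apply: (tannery (c := fun k => 16 * q k ^+ 3)) => [n k||k].
  - have /andP[l0 l1'] := l01 n; rewrite normrM ger0_norm ?exprn_ge0// -[leRHS]mul1r.
    by rewrite ler_pM ?exprn_ge0 ?exprn_ile1 ?stagger_le.
  - exact: cvg_series_invsqrtS_cubeM.
  - by apply: cvgMl; exact: lk.
apply: (tannery (c := fun k => 4 * q k ^+ 3)) => [n k||k].
- exact: green_resid_le.
- exact: cvg_series_invsqrtS_cubeM.
- by apply: cvgMl; apply: cvgM; [apply: cvgB => //; exact: cvg_cst|exact: lk].
Qed.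

Local Notation a := (potential_kernel R).

Lemma potential_kernelE x : a x = limn (series (green_diff 1 x)).
Proof.
rewrite /potential_kernel; apply/cvg_lim => //.
rewrite (_ : (fun n => _) = [sequence series (green_diff 1 x) n.+1]_n); last first.
  apply/funext => n; rewrite /series/= big_mkord; apply: eq_bigr => k _.
  by rewrite /green_diff expr1n mul1r !srw_probE.
by rewrite cvg_shiftS; apply: (green_diffP x).1; rewrite ler01 lexx.
Qed.

Lemma potential_kernel0 : a 0 = 0.
Proof.
rewrite potential_kernelE; apply/cvg_lim => //.
rewrite (_ : series _ = fun=> 0); first exact: cvg_cst.
by apply/funext => n; rewrite /series/= big1// => k _; rewrite /green_diff subrr mulr0.
Qed.

Lemma potential_kernelN x : a (- x) = a x.
Proof.
rewrite !potential_kernelE; congr (limn (series _)); apply/funext => k.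
by rewrite /green_diff walk2_probN.
Qed.

Lemma potential_kernel_step i x : a (x + unit_step i) - a x =
  limn (series (stagger i x)) - p 0 (x + unit_step i).
Proof.
have l01 : 0 <= (1 : R) <= 1 by rewrite ler01 lexx.
apply/eqP; rewrite subr_eq [eqbRHS]addrC; apply/eqP.
rewrite [in LHS]potential_kernelE; apply/cvg_lim => //.
have stepE n : series (green_diff 1 (x + unit_step i)) n = series (green_diff 1 x) n +
    series (fun k => 1 ^+ k * (p k x - p k (x + unit_step i))) n.
  by rewrite /series/= -big_split/=; apply: eq_bigr => k _; rewrite /green_diff; ring.
under eq_cvg do rewrite stepE.
apply: cvgD; first by rewrite potential_kernelE; exact: (green_diffP x).1.
have := @green_diff_step _ i x l01.
have -> : (fun k => 1 ^+ k * stagger i x k) = stagger i x.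
  by apply/funext => k; rewrite expr1n mul1r.
have -> : series (green_resid 1 (x + unit_step i)) = fun=> 0.
  apply/funext => n; rewrite /series/= big1// => k _.
  by rewrite /green_resid subrr !mul0r.
by rewrite lim_cst// addr0.
Qed.

(** For fixed k the k-th term of the series vanishes once x is far away, and the terms are dominated
    uniformly in x. *)
Lemma potential_kernel_step_cvg i :
  a (x + unit_step i) - a x @[x --> infty_Z2] --> 0.
Proof.
have -> : (fun x => a (x + unit_step i) - a x) =
    fun x => limn (series (stagger i x)) - p 0 (x + unit_step i).
  by apply/funext => x; rewrite potential_kernel_step.
rewrite -[X in _ --> X](subr0 0).
have near0 k (z : Z2) : \forall x \near infty_Z2, p k (x + z) = 0.
  have sq (c d : int) : k%:Z < `|c| -> k%:Z ^+ 2 < c ^+ 2 + d ^+ 2.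
    move=> kc; have : k%:Z ^+ 2 < `|c| ^+ 2 by rewrite ltrXn2r.
    by rewrite real_normK ?num_real//; have := sqr_ge0 d; lia.
  (* If |x|^2 > 8 M^2, some coordinate of x exceeds 2 M in absolute value, and so exceeds k after
     the shift by z. *)
  have [M ME] : exists M : int, M = `|z.1| + `|z.2| + k%:Z by eexists.
  exists (absz (8 * M ^+ 2 + 1 : int)) => // x /= hx; apply: walk2_prob_support => /=.
  have {}hx : 8 * M ^+ 2 + 1 <= x.1 ^+ 2 + x.2 ^+ 2 by lia.
  have [h|h] : 2 * M < `|x.1| \/ 2 * M < `|x.2|.
    case: (ltP (2 * M) `|x.1|) => h1; [by left|right].
    by case: (ltP (2 * M) `|x.2|) => // h2; nia.
  - by apply: sq; lia.
  - by rewrite addrC; apply: sq; lia.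
apply: cvgB; last first.
  by apply: cvg_near_cst; exact: near0.
rewrite (_ : 0 = limn (series (fun=> 0 : R))); last first.
  apply/esym/cvg_lim => //; rewrite (_ : series _ = fun=> 0); first exact: cvg_cst.
  by apply/funext => n; rewrite /series/= big1.
apply: (tannery (c := fun k => 16 * q k ^+ 3)) => [x k||k].
- exact: stagger_le.
- exact: cvg_series_invsqrtS_cubeM.
- apply: cvg_near_cst; near=> x; rewrite /stagger.
  have -> : p k.+1 (x + unit_step i) = 0 by near: x; exact: near0.
  have -> : p k x = 0 by rewrite -(addr0 x); near: x; exact: near0.
  by rewrite subr0.
Unshelve. all: by end_near. Qed.

End walk2.

(** * Asymptotics of the Green function *)

Section wallis.
Variable R : realType.
Local Notation mu := (@lebesgue_measure R).
Local Notation b := (walk1_prob R).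

Local Notation I := (`[0%R, (pi / 2)%R]%classic : set R).

Definition wallis (n : nat) : R := \int[mu]_(x in I) (cos x ^+ n).

Let pihalf_gt0 : 0 < pi / 2 :> R.
Proof. by rewrite divr_gt0 ?pi_gt0. Qed.

Let continuous_cosX n : continuous (fun x : R => cos x ^+ n).
Proof.
move=> x; apply: (@cvg_comp _ _ _ (@cos R) (fun y : R => y ^+ n)).
- exact: continuous_cos.
- exact: exprn_continuous.
Qed.

Let integrable_cosX n : mu.-integrable I (EFin \o (fun x : R => cos x ^+ n)).
Proof.
apply: continuous_compact_integrable; first exact: segment_compact.
by apply: continuous_subspaceT => x; exact: continuous_cosX.
Qed.

Let cos01 x : I x -> (0 : R) <= cos x <= 1.
Proof.
rewrite /= in_itv/= => /andP[x0 x1]; rewrite cos_le1 andbT cos_ge0_pihalf// x1 andbT.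
by apply: le_trans x0; rewrite oppr_le0 ltW.
Qed.

Lemma wallis0 : wallis 0 = pi / 2.
Proof.
rewrite /wallis; under eq_Rintegral do rewrite expr0.
have muI : lebesgue_measure (`[0%R, (pi / 2)%R]%classic : set R) = (pi / 2)%:E.
  by rewrite lebesgue_measure_itv/= lte_fin pihalf_gt0 -EFinB subr0.
by rewrite Rintegral_cst// mul1r -[RHS]/(fine (pi / 2)%:E) -muI.
Qed.

Lemma wallisS n : wallis n.+1 <= wallis n.
Proof.
apply: le_Rintegral => //.
by move=> x /cos01/andP[c0 c1]; rewrite exprS ler_piMl// exprn_ge0.
Qed.

Lemma integral_pihalf (f F : R -> R) : continuous f ->
  (forall x : R, is_derive x 1 F (f x)) -> \int[mu]_(x in I) f x = F (pi / 2) - F 0.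
Proof.
move=> cf dF; have cF : continuous F.
  by move=> x; apply/differentiable_continuous/derivable1_diffP; exact: ex_derive.
rewrite /Rintegral (@continuous_FTC2 _ f F)//.
- by apply: continuous_subspaceT => x; exact: cf.
- split; first by move=> x _; exact: ex_derive.
  + by apply: cvg_at_right_filter; exact: cF.
  + by apply: cvg_at_left_filter; exact: cF.
- by move=> x _; rewrite derive1E derive_val.
Qed.

Lemma wallis1 : wallis 1 = 1.
Proof.
rewrite /wallis; under eq_Rintegral do rewrite expr1.
rewrite (@integral_pihalf _ (@sin R)) ?sin_pihalf ?sin0 ?subr0//.
exact: continuous_cos.
Qed.

(** The function sin cos^(n+1) vanishes at both ends of the interval, and its derivative is (n + 2)
    cos^(n+2) - (n + 1) cos^n. *)
Lemma wallisSS n : wallis n.+2 * n.+2%:R = wallis n * n.+1%:R.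
Proof.
apply/eqP; rewrite -subr_eq0; apply/eqP.
have -> : wallis n.+2 * n.+2%:R - wallis n * n.+1%:R =
    \int[mu]_(x in I) (n.+2%:R * cos x ^+ n.+2 - n.+1%:R * cos x ^+ n).
  have iZ m (r : R) : mu.-integrable I (EFin \o (fun x : R => r * cos x ^+ m)).
    apply: continuous_compact_integrable; first exact: segment_compact.
    apply: continuous_subspaceT => x; apply: cvgMr; exact: continuous_cosX.
  rewrite RintegralB// !RintegralZl//.
  by rewrite ![_%:R * _]mulrC.
have dF (x : R) : is_derive x 1 (fun x => sin x * cos x ^+ n.+1)
    (n.+2%:R * cos x ^+ n.+2 - n.+1%:R * cos x ^+ n).
  rewrite (_ : (fun x => _) = (@sin R * @cos R ^+ n.+1)); last first.
    by apply/funext => y; rewrite !fctE.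
  apply: is_derive_eq (is_deriveM (is_derive_sin x) (is_deriveX n.+1 (is_derive_cos x))) _.
  rewrite /GRing.scale/= !fctE -(natr1 n.+1).
  have := cos2Dsin2 x => /(canRL (addKr _)) s2.
  have -> : sin x * (n.+1%:R * cos x ^+ n * - sin x) =
     - (sin x ^+ 2) * (n.+1%:R * cos x ^+ n) by ring.
  by rewrite s2 !exprS; ring.
rewrite (integral_pihalf _ dF).
- by rewrite cos_pihalf sin0 expr0n/= mulr0 mul0r subr0.
- by move=> x; apply: cvgB; apply: cvgMr; exact: continuous_cosX.
Qed.

(** Both sides obey the recursion of [walk1_prob0SS] and start from pi/2. *)
Lemma wallis_even k : wallis k.*2 = pi / 2 * b k.*2 0.
Proof.
elim: k => [|k IH]; first by rewrite wallis0 /= mulr1.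
have n0 : k.*2.+2%:R != 0 :> R by rewrite pnatr_eq0.
apply: (mulIf n0); rewrite doubleS wallisSS IH.
by rewrite -[LHS]mulrA -[RHS]mulrA walk1_prob0SS.
Qed.

Lemma wallis_prod n : wallis n.+1 * wallis n * n.+1%:R = pi / 2.
Proof.
elim: n => [|n IH]; first by rewrite wallis1 wallis0 mul1r mulr1.
by rewrite mulrAC wallisSS -IH mulrAC [wallis n * _]mulrC.
Qed.

(** As [wallis] decreases, its square at 2k is at least the product of its values at 2k and 2k + 1,
    which [wallis_prod] evaluates. The upper bound below squares the value at 2k + 2 instead, so the
    same 1/(pi (k + 1)) appears one index later. *)
Lemma walk1_prob0_sqr_ge k : (pi * k.+1%:R)^-1 <= b k.*2 0 ^+ 2.
Proof.
have := wallis_prod k.*2; have := wallisS k.*2; rewrite wallis_even.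
have b0 := walk1_prob_ge0 R k.*2 0; have p0 := pi_gt0 R.
move: (b _ _) b0 (wallis _) => x x0 w wx e.
rewrite -div1r ler_pdivrMr ?mulr_gt0// ?ltr0n//.
have h : pi / 2 <= (pi / 2 * x) * (pi / 2 * x) * k.*2.+1%:R.
  by rewrite -{1}e ler_wpM2r ?ler0n// ler_wpM2r// mulr_ge0// ltW.
have {h} : pi / 2 * 1 <= pi / 2 * (pi * x ^+ 2 * (k.*2.+1%:R / 2)).
  by rewrite mulr1; apply: le_trans h _; rewrite expr2; lra.
rewrite ler_pM2l// => /le_trans; apply.
rewrite [leRHS]mulrCA [leRHS]mulrA ler_wpM2l ?mulr_ge0 ?sqr_ge0 ?(ltW p0)//.
by rewrite ler_pdivrMr// -natrM ler_nat; lia.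
Qed.

Lemma walk1_prob0_sqr_le_pi k : b k.+1.*2 0 ^+ 2 <= (pi * k.+1%:R)^-1.
Proof.
have := wallis_prod k.*2.+1; have := wallisS k.*2.+1; rewrite -doubleS wallis_even.
have b0 := walk1_prob_ge0 R k.+1.*2 0; have p0 := pi_gt0 R.
move: (b _ _) b0 (wallis _) => x x0 w wx e.
rewrite -div1r ler_pdivlMr ?mulr_gt0// ?ltr0n//.
have h : (pi / 2 * x) * (pi / 2 * x) * k.*2.+2%:R <= pi / 2.
  by rewrite -[leRHS]e ler_wpM2r ?ler0n// ler_wpM2l// mulr_ge0// ltW.
have {h} : pi / 2 * (pi * x ^+ 2 * (k.*2.+2%:R / 2)) <= pi / 2 * 1.
  by rewrite mulr1; apply: le_trans h; rewrite expr2; lra.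
rewrite ler_pM2l//; apply: le_trans.
by rewrite mulrCA mulrA -doubleS -muln2 natrM mulfK.
Qed.

End wallis.

(** * The logarithmic series with an explicit remainder *)

Section log_series.
Variable R : realType.

Definition log_partial (n : nat) (x : R) : R := \sum_(k < n) x ^+ k.+1 / k.+1%:R.

(** The derivative of the remainder is t^n/(1 - t), so by the mean value theorem the remainder at x
    is x c^n/(1 - c) for some c between 0 and x. *)
Lemma log_partial_bounds n (x : R) : 0 <= x < 1 ->
  log_partial n x <= - ln (1 - x) <= log_partial n x + x ^+ n.+1 / (1 - x).
Proof.
move=> /andP[]; rewrite le_eqVlt => /predU1P[<- _|x0 x1].
  rewrite subr0 ln1 oppr0 /log_partial big1 => [|i _]; last by rewrite expr0n mul0r.
  by rewrite lexx expr0n/= mul0r addr0 lexx.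
pose f t := - ln (1 - t) - log_partial n t.
pose df t : R := (1 - t)^-1 - \sum_(k < n) t ^+ k.
have dS m (t : R) : is_derive t 1 (log_partial m) (\sum_(k < m) t ^+ k).
  elim: m => [|m IH].
    rewrite big_ord0 (_ : log_partial 0 = cst 0); first exact: is_derive_cst.
    by apply/funext => y; rewrite /log_partial big_ord0.
  have -> : log_partial m.+1 = log_partial m + m.+1%:R^-1 \*: (@id R ^+ m.+1).
    apply/funext => y; rewrite /log_partial big_ord_recr/= !fctE.
    by congr (_ + _); exact: mulrC.
  apply: is_derive_eq (is_deriveD IH (is_deriveZ _ (is_deriveX m.+1 (is_derive_id t (1 : R))))) _.
  rewrite big_ord_recr/= /GRing.scale/= mulr1; congr (_ + _).
  by rewrite mulrA mulVf ?mul1r// pnatr_eq0.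
have d1 (t : R) : is_derive t 1 (fun y : R => 1 - y) (-1).
  rewrite (_ : (fun y : R => 1 - y) = (cst 1 - @id R))//.
  exact: is_derive_eq (is_deriveB (is_derive_cst _ _ _) (is_derive_id t (1 : R))) (sub0r _).
have dln (t : R) : t < 1 -> is_derive t 1 (fun y : R => ln (1 - y)) (- (1 - t)^-1).
  move=> t1; have h : 0 < 1 - t by rewrite subr_gt0.
  have := @is_derive1_comp _ (@ln R) (fun y => 1 - y) t _ _ (is_derive1_ln h) (d1 t).
  by rewrite mulrN1.
have dfP (t : R) : t < 1 -> is_derive t 1 f (df t).
  move=> t1; have := is_deriveB (is_deriveN (dln t t1)) (dS n t).
  by rewrite opprK.
have [c] : exists2 c, c \in `]0, x[%R & f x - f 0 = df c * (x - 0).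
  apply: MVT => // [t|].
    by rewrite in_itv/= => /andP[_ tx]; apply: dfP; exact: lt_trans x1.
  apply: derivable_within_continuous => t; rewrite in_itv/= => /andP[_ tx].
  by apply: ex_derive; apply: dfP; exact: le_lt_trans x1.
rewrite in_itv/= subr0 => /andP[c0 cx].
have f0 : f 0 = 0.
  rewrite /f subr0 ln1 oppr0 sub0r /log_partial big1 ?oppr0// => i _.
  by rewrite expr0n mul0r.
have c1 : 0 < 1 - c by rewrite subr_gt0 (lt_trans cx).
have dfE : df c = c ^+ n / (1 - c).
  apply: (mulIf (lt0r_neq0 c1)); rewrite mulfVK ?gt_eqF// mulrBl mulVf ?gt_eqF//.
  by have := subrX1 c n; move: (\sum_(i < n) _) => S; lra.
rewrite f0 subr0 dfE /f => e.
have e0 : 0 <= c ^+ n / (1 - c) * x.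
  by rewrite mulr_ge0 ?divr_ge0 ?exprn_ge0 ?ltW.
have e1 : c ^+ n / (1 - c) * x <= x ^+ n.+1 / (1 - x).
  rewrite exprS mulrC -mulrA ler_wpM2l ?(ltW x0)//.
  apply: ler_pM; rewrite ?exprn_ge0 ?invr_ge0 ?(ltW c0) ?(ltW c1)//.
    by rewrite lerXn2r ?nnegrE ?(ltW c0) ?(ltW x0) ?(ltW cx).
  by rewrite lef_pV2 ?posrE ?subr_gt0//; lra.
by apply/andP; split; lra.
Qed.

End log_series.

#[local] Arguments walk1_prob : simpl never.

Section green_asymptotics.
Variable R : realType.
Local Notation b := (walk1_prob R).
Local Notation p := (walk2_prob R).

Definition green (l : R) (x : Z2) : R := limn (series (fun k => l ^+ k * p k x)).

Lemma cvg_green l x : 0 <= l < 1 -> cvgn (series (fun k => l ^+ k * p k x)).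
Proof.
move=> /andP[l0 l1]; apply: (@series_dominated_cvg _ _ (geometric 4 l)) => [k|].
  have h0 : 0 <= l ^+ k * p k x by rewrite mulr_ge0 ?exprn_ge0 ?walk2_prob_ge0.
  rewrite (ger0_norm h0) /= mulrC.
  rewrite ler_wpM2r ?exprn_ge0//; apply: le_trans (walk2_prob_le _ _ _) _.
  by rewrite ler_pdivrMr ?ltr0n// ler_peMr// ler1n.
by apply: is_cvg_geometric_series; rewrite ger0_norm.
Qed.

Lemma walk2_prob0_even k : p k.*2 0 = b k.*2 0 ^+ 2.
Proof. by rewrite /walk2_prob expr2. Qed.

Lemma walk2_prob0_odd k : p k.*2.+1 0 = 0.
Proof. by rewrite /walk2_prob/= -/(b k.*2.+1 0) walk1_prob0_odd mul0r. Qed.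

Let green0_partial l n : series (fun k => l ^+ k * p k 0) n.*2 =
  \sum_(k < n) (l ^+ 2) ^+ k * b k.*2 0 ^+ 2.
Proof.
elim: n => [|n IH]; first by rewrite /series/= big_nil big_ord0.
rewrite doubleS /series/= 2?big_nat_recr//= walk2_prob0_odd mulr0 addr0.
rewrite big_ord_recr/= -IH /series/= walk2_prob0_even; congr (_ + _ * _).
by rewrite -exprM mul2n.
Qed.

Let green_nondecr l : 0 <= l ->
  nondecreasing_seq (series (fun k => l ^+ k * p k 0)).
Proof.
move=> l0; apply/nondecreasing_seqP => n; rewrite /series/= big_nat_recr//= lerDl.
by rewrite mulr_ge0 ?exprn_ge0 ?walk2_prob_ge0.
Qed.

(** Only even times contribute. As p_(2k)(0) >= 1/(pi (k + 1)) and l^(2k) >= l^(2k+2), the sum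
    dominates 1/pi times the logarithmic series at l^2. *)
Lemma green0_ge l : 0 <= l < 1 -> - ln (1 - l ^+ 2) / pi <= green l 0.
Proof.
move=> l01; have /andP[l0 l1] := l01.
have x0 : 0 <= l ^+ 2 by rewrite exprn_ge0.
have x1 : l ^+ 2 < 1 by rewrite expr_lt1.
have x01 : 0 <= l ^+ 2 < 1 by rewrite x0 x1.
have xn n : `|(l ^+ 2) ^+ n.+1 / (1 - l ^+ 2)| = (l ^+ 2) ^+ n.+1 / (1 - l ^+ 2).
  by rewrite ger0_norm// divr_ge0 ?exprn_ge0// subr_ge0 ltW.
have lim0 : (l ^+ 2) ^+ n.+1 / (1 - l ^+ 2) @[n --> \oo] --> 0.
  rewrite -[X in _ --> X](mul0r (1 - l ^+ 2)^-1); apply: cvgMl.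
  rewrite (cvg_shiftS (fun n => (l ^+ 2) ^+ n)); apply: cvg_expr.
  by rewrite ger0_norm.
have lim1 : (- ln (1 - l ^+ 2) - (l ^+ 2) ^+ n.+1 / (1 - l ^+ 2)) / pi @[n --> \oo] -->
    - ln (1 - l ^+ 2) / pi.
  apply: cvgMl; rewrite -[X in _ --> X]subr0; apply: cvgB => //; exact: cvg_cst.
rewrite -(cvg_lim _ lim1)//; apply: limr_le; first by apply/cvg_ex; eexists; exact: lim1.
apply: nearW => n.
have := nondecreasing_cvgn_le (green_nondecr l0) (@cvg_green l 0 l01) n.*2.
rewrite -/(green l 0); apply: le_trans.
rewrite green0_partial ler_pdivrMr ?pi_gt0//.
have /andP[_ h] := log_partial_bounds n x01.
apply: (@le_trans _ _ (log_partial n (l ^+ 2))); first by lra.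
rewrite /log_partial mulr_suml; apply: ler_sum => i _.
rewrite exprSr -mulrA -[leRHS]mulrA; apply: ler_wpM2l; first exact: exprn_ge0.
have := walk1_prob0_sqr_ge R i; rewrite invfM => /(ler_wpM2r (ltW (pi_gt0 R))).
rewrite mulrAC mulVf ?gt_eqF ?pi_gt0// mul1r; apply: le_trans.
by rewrite ler_piMl ?invr_ge0// ltW.
Qed.

(** Time 0 contributes the 1; the bound p_(2k+2)(0) <= 1/(pi (k + 1)) matches the logarithmic series
    term by term. *)
Lemma green0_le l : 0 <= l < 1 -> green l 0 <= 1 - ln (1 - l ^+ 2) / pi.
Proof.
move=> l01; have /andP[l0 l1] := l01.
have x0 : 0 <= l ^+ 2 by rewrite exprn_ge0.
have x1 : l ^+ 2 < 1 by rewrite expr_lt1.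
have x01 : 0 <= l ^+ 2 < 1 by rewrite x0 x1.
apply: limr_le; first exact: cvg_green.
apply: nearW => n.
apply: (@le_trans _ _ (series (fun k => l ^+ k * p k 0) n.+1.*2)).
  by apply: green_nondecr => //; rewrite -addnn; lia.
rewrite green0_partial big_ord_recl/= mul1r expr1n lerD2l.
rewrite -mulNr ler_pdivlMr ?pi_gt0//.
have /andP[h _] := log_partial_bounds n x01.
apply: le_trans h; rewrite /log_partial mulr_suml; apply: ler_sum => i _.
rewrite /bump/= add1n -mulrA; apply: ler_wpM2l; first exact: exprn_ge0.
have := walk1_prob0_sqr_le_pi R i; rewrite invfM => /(ler_wpM2r (ltW (pi_gt0 R))).
by rewrite [X in _ <= X -> _]mulrAC mulVf ?gt_eqF ?pi_gt0// mul1r.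
Qed.

Definition survival (e : R) : R := (1 + e)^-1.

Lemma survival_itv e : 0 < e -> 0 <= survival e < 1.
Proof.
by move=> e0; rewrite invr_ge0 addr_ge0 ?(ltW e0)//= invf_lt1 ?addr_gt0// ltrDl.
Qed.

Lemma lnn_cvgy : ln (N%:R : R) @[N --> \oo] --> +oo.
Proof.
apply/cvgryPge => A; near=> N.
have : expR A <= N%:R by near: N; exact: nbhs_infty_ger.
rewrite -{2}(expRK A) => h; rewrite ler_ln ?posrE ?expR_gt0//.
exact: lt_le_trans (expR_gt0 A) h.
Unshelve. all: by end_near. Qed.

Lemma lnn_inv_cvg0 : (ln (N%:R : R))^-1 @[N --> \oo] --> 0.
Proof.
apply/gtr0_cvgV0; last exact: lnn_cvgy.
by near=> N; near: N; move/cvgryPgt : lnn_cvgy; exact.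
Unshelve. all: by end_near. Qed.

(** With s the square root of v, ln v / v = 2 ln s / s^2 <= 2 / s. *)
Lemma lnln_div_ln_cvg0 (v : nat -> R) : v @ \oo --> +oo -> ln (v N) / v N @[N --> \oo] --> 0.
Proof.
move=> vy; apply/cvgrPdist_le => e e0.
near=> N.
have v1 : 1 <= v N by near: N; move/cvgryPge : vy; exact.
have v2 : (2 / e) ^+ 2 <= v N by near: N; move/cvgryPge : vy; exact.
have v0 : 0 < v N by apply: lt_le_trans v1.
set s := Num.sqrt (v N).
have s0 : 0 < s by rewrite sqrtr_gt0.
have vs : v N = s ^+ 2 by rewrite sqr_sqrtr// ltW.
rewrite sub0r normrN ger0_norm ?divr_ge0 ?ln_ge0 ?(ltW v0)//.
rewrite vs lnXn// ler_pdivrMr ?exprn_gt0// -mulr_natr.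
have es : 2 / e <= s.
  by rewrite -(@ler_pXn2r _ 2) ?nnegrE ?divr_ge0 ?(ltW e0) ?(ltW s0)// -vs.
have : 2 <= e * s by rewrite mulrC -ler_pdivrMr.
move=> /(ler_wpM2r (ltW s0)); have := ltW (ln_sublinear s0).
by rewrite expr2; lra.
Unshelve. all: by end_near. Qed.

Variable eps : nat -> R.
Hypothesis eps_gt0 : forall N, 0 < eps N.
Hypothesis epsE : asymp_equiv eps (fun N => (2 / pi * N%:R ^+ 2 * ln N%:R ^+ 2)^-1).

Let t (N : nat) : R := 2 / pi * N%:R ^+ 2 * ln N%:R ^+ 2.
Let rho N := eps N * t N.

Let rho_cvg : rho @ \oo --> (1 : R).
Proof.
rewrite (_ : rho = fun N => eps N / (t N)^-1); first exact: epsE.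
by apply/funext => N; rewrite invrK.
Qed.

Lemma eps_cvg0 : eps @ \oo --> (0 : R).
Proof.
have tV : (t N)^-1 @[N --> \oo] --> 0.
  apply: (@squeeze_cvgr _ _ _ _ (fun=> 0) (fun N => pi / 2 * (ln (N%:R : R))^-1)).
  - near=> N.
    have N1 : (1 <= N)%N by near: N; exact: nbhs_infty_ge.
    have l1 : 1 <= ln (N%:R : R) by near: N; move/cvgryPge : lnn_cvgy; exact.
    have l0 : 0 < ln (N%:R : R) by apply: lt_le_trans l1.
    have n1 : 1 <= N%:R :> R by rewrite ler1n.
    rewrite invr_ge0 !mulr_ge0 ?exprn_ge0 ?invr_ge0 ?(ltW l0) ?(ltW (pi_gt0 R))//=.
    rewrite -[pi / 2]invf_div -invfM lef_pV2 ?posrE.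
    + rewrite ler_pM// ?divr_ge0 ?(ltW (pi_gt0 R)) ?(ltW l0)//.
      * by rewrite ler_peMr ?divr_ge0 ?(ltW (pi_gt0 R))// exprn_ege1.
      * by rewrite expr2 ler_peMr// ltW.
    + by rewrite !mulr_gt0 ?exprn_gt0 ?invr_gt0 ?pi_gt0 ?(lt_le_trans ltr01 n1).
    + by rewrite mulr_gt0 ?divr_gt0 ?pi_gt0.
  - exact: cvg_cst.
  - rewrite -[X in _ --> X](mulr0 (pi / 2)); apply: cvgMr.
    exact: lnn_inv_cvg0.
have h : rho N * (t N)^-1 @[N --> \oo] --> (1 * 0 : R) by apply: cvgM.
rewrite mul1r in h; apply: cvg_trans h; apply: near_eq_cvg.
near=> N.
have N1 : (1 <= N)%N by near: N; exact: nbhs_infty_ge.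
have l1 : 1 <= ln (N%:R : R) by near: N; move/cvgryPge : lnn_cvgy; exact.
have l0 : 0 < ln (N%:R : R) by apply: lt_le_trans l1.
have n0 : 0 < N%:R :> R by rewrite ltr0n.
by rewrite /rho mulfK// /t gt_eqF// !mulr_gt0 ?exprn_gt0 ?invr_gt0 ?pi_gt0.
Unshelve. all: by end_near. Qed.

Lemma survival_cvg1 : survival (eps N) @[N --> \oo] --> (1 : R).
Proof.
have h : 1 + eps N @[N --> \oo] --> (1 + 0 : R).
  by apply: cvgD; [exact: cvg_cst|exact: eps_cvg0].
have hV : (1 + eps N)^-1 @[N --> \oo] --> (1 + 0 : R)^-1.
  by apply: cvgV => //; rewrite addr0 oner_neq0.
by rewrite addr0 invr1 in hV.
Qed.

Lemma neg_ln_survival_cvg :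
  - ln (1 - survival (eps N) ^+ 2) / ln N%:R @[N --> \oo] --> (2 : R).
Proof.
(* Chosen so that 1 - l^2 = c / (N^2 log^2 N). It tends to pi, so the limit 2 comes from the factor
   N^2 alone. *)
pose c N := pi / 2 * rho N * ((2 + eps N) * survival (eps N) ^+ 2).
have cc : c @ \oo --> (pi : R).
  rewrite (_ : pi = pi / 2 * 1 * ((2 + 0) * (1 ^+ 2))); last by rewrite addr0; field.
  apply: cvgM; first by apply: cvgMr; exact: rho_cvg.
  apply: cvgM; first by apply: cvgD; [exact: cvg_cst|exact: eps_cvg0].
  apply: (@cvg_comp _ _ _ _ (fun y : R => y ^+ 2) _ _ _ survival_cvg1).
  exact: exprn_continuous.
have lnc : ln (c N) @[N --> \oo] --> ln (pi : R).
  by apply: (@cvg_comp _ _ _ c (@ln R) _ _ _ cc); apply: continuous_ln; exact: pi_gt0.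
have lnV := lnn_inv_cvg0.
have h : 2 + 2 * (ln (ln (N%:R : R)) / ln (N%:R : R)) - ln (c N) * (ln (N%:R : R))^-1
    @[N --> \oo] --> 2 + 2 * 0 - ln (pi : R) * 0.
  apply: cvgB; last by apply: cvgM.
  apply: cvgD; [exact: cvg_cst|apply: cvgMr].
  by apply: (lnln_div_ln_cvg0 (v := fun N => ln N%:R)); exact: lnn_cvgy.
rewrite !mulr0 addr0 subr0 in h; apply: cvg_trans h; apply: near_eq_cvg.
near=> N.
have N1 : (1 <= N)%N by near: N; exact: nbhs_infty_ge.
have l1 : 1 <= ln (N%:R : R) by near: N; move/cvgryPge : lnn_cvgy; exact.
have l0 : 0 < ln (N%:R : R) by apply: lt_le_trans l1.
have n0 : 0 < N%:R :> R by rewrite ltr0n.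
have e0 := eps_gt0 N; have p0 := pi_gt0 R.
have e1 : 0 < 1 + eps N by rewrite addr_gt0.
have cE : 1 - survival (eps N) ^+ 2 = c N / (N%:R ^+ 2 * ln N%:R ^+ 2).
  rewrite /c /rho /t /survival; move: (@pi R) p0 => q q0.
  by field; rewrite !gt_eqF.
have c0 : 0 < c N.
  have r0 : 0 < rho N by rewrite mulr_gt0// !mulr_gt0 ?exprn_gt0 ?invr_gt0.
  have s0 : 0 < survival (eps N) by rewrite invr_gt0.
  rewrite /c; apply: mulr_gt0; first by rewrite mulr_gt0// divr_gt0.
  by rewrite mulr_gt0 ?exprn_gt0// addr_gt0.
rewrite cE; move: (c N) c0 => cN cN0.
have -> : ln (cN / (N%:R ^+ 2 * ln N%:R ^+ 2)) =
    ln cN - (2 * ln (N%:R : R) + 2 * ln (ln (N%:R : R))).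
  rewrite ln_div ?posrE ?mulr_gt0 ?exprn_gt0//; congr (_ - _).
  by rewrite lnM ?posrE ?exprn_gt0// !lnXn// !mulr_natl.
by field; rewrite gt_eqF.
Unshelve. all: by end_near. Qed.

Lemma green0_asymp : green (survival (eps N)) 0 / ln N%:R @[N --> \oo] --> 2 / pi.
Proof.
have h := neg_ln_survival_cvg.
have lnV := lnn_inv_cvg0.
have hl : - ln (1 - survival (eps N) ^+ 2) / ln N%:R / pi @[N --> \oo] --> 2 / pi.
  by apply: cvgMl.
have hu : (ln (N%:R : R))^-1 + - ln (1 - survival (eps N) ^+ 2) / ln N%:R / pi
    @[N --> \oo] --> 0 + 2 / pi by apply: cvgD.
rewrite add0r in hu; apply: squeeze_cvgr hl hu.
near=> N.
have l1 : 1 <= ln (N%:R : R) by near: N; move/cvgryPge : lnn_cvgy; exact.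
have l0 : 0 < ln (N%:R : R) by apply: lt_le_trans l1.
have s01 := survival_itv (eps_gt0 N).
rewrite [_ / ln _ / pi]mulrAC ler_pM2r ?invr_gt0// green0_ge//=.
rewrite -[X in X + _]mul1r -mulrDl ler_pM2r ?invr_gt0// mulNr; exact: green0_le.
Unshelve. all: by end_near. Qed.

Lemma green0_cvgy : green (survival (eps N)) 0 @[N --> \oo] --> +oo.
Proof.
apply/cvgryPge => A; near=> N.
have l1 : 1 <= ln (N%:R : R) by near: N; move/cvgryPge : lnn_cvgy; exact.
have l2 : A * pi <= ln (N%:R : R) by near: N; move/cvgryPge : lnn_cvgy; exact.
have l0 : 0 < ln (N%:R : R) by apply: lt_le_trans l1.
have : pi^-1 < green (survival (eps N)) 0 / ln N%:R.
  near: N; have := green0_asymp => /cvgr_gt; apply.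
  by rewrite -[ltLHS]mul1r ltr_pM2r ?invr_gt0 ?pi_gt0// ltr1n.
rewrite ltr_pdivlMr// => /ltW; apply: le_trans.
by rewrite mulrC ler_pdivlMr ?pi_gt0.
Unshelve. all: by end_near. Qed.

End green_asymptotics.

(** * Potential theory of finite sets *)

Section potential_theory.
Variable R : realType.
Local Notation p := (walk2_prob R).
Local Notation a := (potential_kernel R).
Local Notation gdiff l x := (limn (series (green_diff (l : R) x))).
Local Notation avg := (@step_avg R).

Lemma infty_Z2_shift (z : Z2) : x + z @[x --> infty_Z2] --> infty_Z2.
Proof.
move=> S [n _ nS].
have [M ME] : exists M : int, M = `|z.1| + `|z.2| + n%:Z by eexists.
exists (absz (8 * M ^+ 2 + 1 : int)) => // x /= hx; apply: nS => /=.
have {}hx : 8 * M ^+ 2 + 1 <= x.1 ^+ 2 + x.2 ^+ 2 by lia.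
have sq (c d : int) : n%:Z < `|c| -> n%:Z <= c ^+ 2 + d ^+ 2.
  move=> nc; have : `|c| <= `|c| ^+ 2 by rewrite expr2 ler_peMl//; lia.
  by rewrite real_normK ?num_real//; have := sqr_ge0 d; lia.
have [h|h] : 2 * M < `|x.1| \/ 2 * M < `|x.2|.
  case: (ltP (2 * M) `|x.1|) => h1; [by left|right].
  by case: (ltP (2 * M) `|x.2|) => // h2; nia.
- by apply: sq; lia.
- by rewrite addrC; apply: sq; lia.
Qed.

Lemma potential_kernel_shift_cvg (z : Z2) : a (x + z) - a x @[x --> infty_Z2] --> 0.
Proof.
elim/Z2_unit_step_ind: z => [|z i IH].
  rewrite (_ : (fun x => _) = fun=> 0); first exact: cvg_cst.
  by apply/funext => x; rewrite addr0 subrr.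
rewrite (_ : (fun x => _) =
    fun x => (a (x + z + unit_step i) - a (x + z)) + (a (x + z) - a x)); last first.
  by apply/funext => x; rewrite addrA subrKA.
rewrite -[X in _ --> X](addr0 0); apply: cvgD => //.
apply: (@cvg_comp _ _ _ (fun x => x + z) (fun x => a (x + unit_step i) - a x)).
- exact: infty_Z2_shift.
- exact: potential_kernel_step_cvg.
Qed.

(** Averaging turns p_k into p_(k+1), so for partial sums the identity holds up to -p_n(x), which
    tends to 0. *)
Lemma avg_potential_kernel x : avg a x = a x + (x == 0)%R%:R.
Proof.
have cvga y : series (green_diff 1 y) @ \oo --> a y.
  by rewrite potential_kernelE; apply: (green_diffP R y).1; rewrite ler01 lexx.
have h1 : avg (fun y => series (green_diff 1 y) n) x @[n --> \oo] --> avg a x.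
  by rewrite /step_avg; apply: cvgMl; exact: cvg_sumr.
have h2 : series (green_diff 1 x) n + (x == 0)%R%:R - p n x @[n --> \oo] -->
    a x + (x == 0)%R%:R - 0.
  apply: cvgB; last exact: cvg_walk2_prob.
  by apply: cvgD; [exact: cvga|exact: cvg_cst].
rewrite subr0 in h2; apply: cvg_unique h1 _ => //.
rewrite (_ : (fun n => _) = fun n => series (green_diff 1 x) n + (x == 0)%R%:R - p n x)//.
apply/funext; elim=> [|n IH].
  rewrite avgE /series/= !big_nil walk2_prob0; lra.
have -> : avg (fun y => series (green_diff 1 y) n.+1) x =
    avg (fun y => series (green_diff 1 y) n) x + (p n 0 - p n.+1 x).
  rewrite walk2_probS !avgE /series/= !big_nat_recr//= /green_diff expr1n.
  by move: (p n 0) => ?; do 4 move: (p n _) => ?; do 4 move: (\sum_(_ <= _ < n) _) => ?; lra.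
rewrite IH /series/= big_nat_recr//= /green_diff expr1n mul1r.
by move: (p n 0) (p n x) (p n.+1 x) (\sum_(_ <= _ < n) _) => *; lra.
Qed.

Lemma green_diffE l x : 0 <= l < 1 -> gdiff l x = green l 0 - green l x.
Proof.
move=> l01; apply/cvg_lim => //.
rewrite (_ : series _ = fun n => series (fun k => l ^+ k * p k 0) n -
    series (fun k => l ^+ k * p k x) n); last first.
  apply/funext => n; rewrite /series/= -sumrB; apply: eq_bigr => k _.
  by rewrite /green_diff mulrBr.
by apply: cvgB; exact: cvg_green.
Qed.

Lemma greenN l x : green l (- x) = green l x :> R.
Proof. by congr (limn (series _)); apply/funext => k; rewrite walk2_probN. Qed.

Lemma green_ge0 (l : R) x : 0 <= l < 1 -> 0 <= green l x.
Proof.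
move=> l01; apply: limr_ge; first exact: cvg_green.
apply: nearW => n; apply: sumr_ge0 => k _.
by rewrite mulr_ge0 ?walk2_prob_ge0// exprn_ge0//; case/andP: l01.
Qed.

Lemma green_bound (l : R) x : 0 <= l < 1 -> green l x <= 4 / (1 - l).
Proof.
move=> l01; have /andP[l0 l1] := l01.
have cg : series (geometric 4 l) @ \oo --> 4 / (1 - l).
  by apply: cvg_geometric_series; rewrite ger0_norm.
rewrite -(cvg_lim _ cg)//; apply: lim_series_le; first exact: cvg_green.
  by apply/cvg_ex; eexists; exact: cg.
move=> k /=; rewrite mulrC ler_wpM2r ?exprn_ge0//.
apply: le_trans (walk2_prob_le _ _ _) _.
by rewrite ler_pdivrMr ?ltr0n// ler_peMr// ler1n.
Qed.

Lemma green_resolvent l x : 0 <= l < 1 ->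
  green l x = (x == 0)%R%:R + l * avg (green l) x :> R.
Proof.
move=> l01; apply/cvg_lim => //.
rewrite -(cvg_shiftS (series (fun k => l ^+ k * p k x))).
have -> : [sequence series (fun k => l ^+ k * p k x) n.+1]_n =
    fun n => (x == 0)%R%:R + l * avg (fun y => series (fun k => l ^+ k * p k y) n) x.
  apply/funext => n; rewrite /series/= big_nat_recl//= mul1r walk2_prob0; congr (_ + _).
  rewrite /step_avg exchange_big/= mulr_suml mulr_sumr; apply: eq_bigr => k _.
  by rewrite walk2_probS /step_avg exprS -mulr_sumr !mulrA.
apply: cvgD; first exact: cvg_cst.
rewrite /step_avg; apply: cvgMr; apply: cvgMl; apply: cvg_sumr => i.
exact: cvg_green.
Qed.

(** * Maximum principle and uniqueness for potentials *)

Section max_principle.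
Variables (A : {fset Z2}) (h : Z2 -> R) (c : R).
Hypothesis h_infty : h @ infty_Z2 --> (0 : R).
Hypothesis h_harmonic : forall x, x \notin A -> avg h x = h x.
Hypothesis hA : forall x, x \in A -> h x <= c.
Hypothesis c_ge0 : 0 <= c.

Let exists_max x0 : 0 < h x0 -> exists x1, forall x, h x <= h x1.
Proof.
move=> h0; have [n _ nh] : \forall x \near infty_Z2, h x < h x0 by exact: cvgr_lt h_infty _ h0.
(* A positive value beats all values outside a finite box, here [-n, n]^2 indexed by ordinals. *)
pose B := ('I_(2 * n + 1) * 'I_(2 * n + 1))%type.
pose f (q : B) : Z2 := ((q.1 : nat)%:Z - n%:Z, (q.2 : nat)%:Z - n%:Z).
have lt0 : (n < 2 * n + 1)%N by lia.
pose q0 : B := (Ordinal lt0, Ordinal lt0).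
pose q1 := [arg max_(q > q0) h (f q)]%O.
have fB x : ~~ (n%:Z <= x.1 ^+ 2 + x.2 ^+ 2) -> exists q, f q = x.
  rewrite -ltNge => xn.
  have s1 : `|x.1| <= n%:Z.
    have : `|x.1| <= x.1 ^+ 2 \/ x.1 = 0 by nia.
    by case=> [|->]; rewrite ?normr0//; have := sqr_ge0 x.2; lia.
  have s2 : `|x.2| <= n%:Z.
    have : `|x.2| <= x.2 ^+ 2 \/ x.2 = 0 by nia.
    by case=> [|->]; rewrite ?normr0//; have := sqr_ge0 x.1; lia.
  have o1 : (absz (x.1 + n%:Z)%R < 2 * n + 1)%N by lia.
  have o2 : (absz (x.2 + n%:Z)%R < 2 * n + 1)%N by lia.
  clear xn; case: x s1 s2 o1 o2 => u v /= s1 s2 o1 o2.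
  by exists (Ordinal o1, Ordinal o2); congr pair => /=; lia.
have maxq q : h (f q) <= h (f q1).
  by rewrite /q1; case: arg_maxP => // i _; exact.
exists (f q1) => x.
have [xn|/fB[q <-]//] := boolP (n%:Z <= x.1 ^+ 2 + x.2 ^+ 2).
have [x0n|/fB[q2 q2E]] := boolP (n%:Z <= x0.1 ^+ 2 + x0.2 ^+ 2).
  by have := nh _ x0n; rewrite ltxx.
by apply: le_trans (maxq q2); rewrite q2E ltW//; exact: nh.
Qed.

(** A maximum above c is attained off A, where harmonicity passes it on to all neighbours. Following
    a single ray suffices: the value stays constant along it although h tends to 0. *)
Lemma max_principle x : h x <= c.
Proof.
rewrite leNgt; apply/negP => cx.
have [x1 x1max] := exists_max (le_lt_trans c_ge0 cx).
have M_gt : c < h x1 by apply: lt_le_trans (x1max x).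
pose e : Z2 := (1, 0).
have ray (k : nat) : h (x1 + e *+ k) = h x1.
  elim: k => [|k IH]; first by rewrite mulr0n addr0.
  have yA : x1 + e *+ k \notin A.
    by apply/negP => /hA; rewrite IH leNgt M_gt.
  have -> : x1 + e *+ k.+1 = x1 + e *+ k + (1, 0) by rewrite mulrSr addrA.
  have := h_harmonic yA; rewrite avgE IH.
  have := x1max (x1 + e *+ k + (1, 0)).
  have := x1max (x1 + e *+ k + (-1, 0)); have := x1max (x1 + e *+ k + (0, 1)).
  have := x1max (x1 + e *+ k + (0, -1)).
  by do 5 move: (h _) => ?; lra.
have eE (k : nat) : e *+ k = (k%:Z, 0).
  elim: k => // k IH; rewrite mulrSr IH; congr pair => /=; lia.
have [n _ nh] : \forall x \near infty_Z2, h x < h x1.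
  by apply: cvgr_lt h_infty _ _; exact: le_lt_trans M_gt.
pose k := (n + absz x1.1)%N.
suff : h (x1 + e *+ k) < h x1 by rewrite ray ltxx.
apply: nh; rewrite eE /k /=.
have h1 : n%:Z <= x1.1 + (n + `|x1.1|)%N%:Z by lia.
have h2 : n%:Z <= n%:Z ^+ 2 by rewrite expr2; nia.
have h3 : n%:Z ^+ 2 <= (x1.1 + (n + `|x1.1|)%N%:Z) ^+ 2 by rewrite lerXn2r ?nnegrE//; lia.
by have := sqr_ge0 (x1.2 + 0); lia.
Qed.

End max_principle.

(** The potential h of nu tends to 0 at infinity since nu has total mass 0, and avg h - h is nu on A
    and 0 elsewhere. The maximum principle gives h <= c, hence nu <= 0 on A where h = c; total mass
    0 then forces nu = 0. *)
Lemma potential_kernel_unique_ge0 (A : {fset Z2}) (nu : Z2 -> R) (c : R) : 0 <= c ->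
  \sum_(y <- A) nu y = 0 ->
  (forall x, x \in A -> \sum_(y <- A) a (x - y) * nu y = c) ->
  forall y, y \in A -> nu y = 0.
Proof.
move=> c0 nu0 nuc.
pose h x := \sum_(y <- A) a (x - y) * nu y.
have avgh x : avg h x = h x + \sum_(y <- A | y == x) nu y.
  rewrite /step_avg /h exchange_big/= mulr_suml [X in _ + X]big_mkcond -big_split/=.
  apply: eq_bigr => y _; rewrite -mulr_suml mulrAC.
  have -> : (\sum_(i < 4) a (x + unit_step i - y)) / 4 = avg a (x - y).
    by congr (_ / _); apply: eq_bigr => i _; rewrite addrAC.
  rewrite avg_potential_kernel mulrDl subr_eq0 [x == y]eq_sym; congr (_ + _).
  by case: eqP => _; rewrite ?mul1r ?mul0r.
have h_infty : h @ infty_Z2 --> 0.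
  have -> : h = fun x => \sum_(y <- A) (a (x - y) - a x) * nu y.
    apply/funext => x; under eq_bigr do rewrite mulrBl.
    by rewrite sumrB -mulr_sumr nu0 mulr0 subr0.
  have hl : \sum_(y <- A) (a (x - y) - a x) * nu y @[x --> infty_Z2] -->
      \sum_(y <- A) (0 * nu y : R).
    by apply: cvg_sumr => y; apply: cvgMl; exact: potential_kernel_shift_cvg.
  by rewrite big1 in hl => // y _; rewrite mul0r.
have hle x : h x <= c.
  apply: (@max_principle A) => // y yA; last by rewrite /h nuc.
  rewrite avgh big1_seq ?addr0// => z /andP[/eqP-> yA'].
  by rewrite yA' in yA.
have nu_le y : y \in A -> nu y <= 0.
  move=> yA; have := avgh y; rewrite -big_filter filter_pred1_uniq// big_seq1.
  have : avg h y <= c.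
    rewrite avgE; have := hle (y + (1, 0)); have := hle (y + (-1, 0)).
    have := hle (y + (0, 1)); have := hle (y + (0, -1)).
    by do 4 move: (h _) => ?; lra.
  by rewrite /h nuc//; move: (avg _ _) (nu y) => *; lra.
move=> y yA; apply/eqP; rewrite eq_le nu_le//=.
move: nu0; rewrite (bigD1_seq y)//= => /eqP; rewrite addr_eq0 => /eqP->.
rewrite oppr_ge0 big_seq_cond; apply: sumr_le0 => z /andP[zA _]; exact: nu_le.
Qed.

Lemma potential_kernel_unique (A : {fset Z2}) (nu : Z2 -> R) (c : R) :
  \sum_(y <- A) nu y = 0 ->
  (forall x, x \in A -> \sum_(y <- A) a (x - y) * nu y = c) ->
  forall y, y \in A -> nu y = 0.
Proof.
move=> nu0 nuc y yA; have [c0|c0] := leP 0 c.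
  exact: (potential_kernel_unique_ge0 c0 nu0 nuc).
apply/eqP; rewrite -oppr_eq0; apply/eqP.
apply: (@potential_kernel_unique_ge0 A (fun y => - nu y) (- c)) => //.
- by rewrite oppr_ge0 ltW.
- by rewrite sumrN nu0 oppr0.
- by move=> x xA; under eq_bigr do rewrite mulrN; rewrite sumrN nuc.
Qed.

(** * The limiting linear system *)

Section equilibrium_system.
Variable A : {fset Z2}.
Hypothesis A0 : 0 \in A.

Let n := size A.
Let s (i : 'I_n) : Z2 := nth 0 A i.

Let sumE (f : Z2 -> R) : \sum_(y <- A) f y = \sum_(i < n) f (s i).
Proof. by rewrite (big_nth 0) big_mkord. Qed.

Let s_in i : s i \in A. Proof. by rewrite mem_nth. Qed.

Let s_surj y : y \in A -> exists i, s i = y.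
Proof.
move=> yA; have yn : (index y A < n)%N by rewrite index_mem.
by exists (Ordinal yn); rewrite /s nth_index.
Qed.

Let s_inj : injective s.
Proof.
by move=> i j /eqP; rewrite nth_uniq ?fset_uniq// => /eqP ij; exact: val_inj.
Qed.

(** The summand 1 adds the normalization of the total mass to each difference equation. The row of 0
    is that normalization alone, since a is even. *)
Definition potential_mx : 'M[R]_n := \matrix_(i, j) (a (s i - s j) - a (s j) + 1).

(** For a kernel vector the row of 0 says that its sum vanishes; the other rows then say that its
    potential is constant on A. The transpose is taken because [det0P] provides row vectors. *)
Lemma potential_mx_unit : potential_mx \in unitmx.
Proof.
rewrite -unitmx_tr unitmxE unitfE; apply/det0P => -[v v0 vM].
have [i0 i0E] := s_surj A0.
have Mv i : \sum_j (a (s i - s j) - a (s j) + 1) * v 0 j = 0.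
  have := congr1 (fun w : 'rV_n => w 0 i) vM; rewrite !mxE => E; rewrite -[RHS]E.
  by apply: eq_bigr => j _; rewrite !mxE mulrC.
have v_sum : \sum_j v 0 j = 0.
  rewrite -[RHS](Mv i0); apply: eq_bigr => j _.
  by rewrite i0E sub0r potential_kernelN subrr add0r mul1r.
pose nu y := \sum_(j | s j == y) v 0 j.
have nuE j : nu (s j) = v 0 j.
  by rewrite /nu (big_pred1 j)// => k /=; rewrite (inj_eq s_inj).
suff v0' j : v 0 j = 0 by move/eqP: v0; apply; apply/rowP => j; rewrite v0' mxE.
rewrite -nuE; apply: (@potential_kernel_unique A nu (\sum_j a (s j) * v 0 j)) => //.
  by rewrite sumE; under eq_bigr do rewrite nuE.
move=> x /s_surj[i <-]; rewrite sumE; under eq_bigr do rewrite nuE.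
apply/eqP; rewrite -subr_eq0 -sumrB -[X in X == _]addr0 -[X in _ + X == _]v_sum -big_split/=.
by rewrite -[X in _ == X](Mv i); apply/eqP; apply: eq_bigr => k _; ring.
Qed.

(* The solution of the linear system that both the normalized escape
   probabilities and the hitting distribution from far away satisfy in the
   limit. *)
Definition limit_measure (y : Z2) : R :=
  \sum_(i | s i == y) \sum_j invmx potential_mx i j.

(** Each entry of mu is a fixed linear combination, through the inverse matrix, of the convergent
    left sides. The filter is N -> oo for the escape probabilities and y -> oo for the hitting
    distribution. *)
Lemma equilibrium_system_cvg (T : Type) (F : set_system T) (mu : T -> Z2 -> R) :
    ProperFilter F ->
    (forall x, x \in A ->
      \sum_(y <- A) (a (x - y) - a y + 1) * mu t y @[t --> F] --> (1 : R)) ->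
  forall y, y \in A -> mu t y @[t --> F] --> limit_measure y.
Proof.
move=> FF mu1 _ /s_surj[i <-].
rewrite /limit_measure (big_pred1 i) => [|k /=]; last by rewrite (inj_eq s_inj).
have -> : (fun t => mu t (s i)) = fun t => \sum_j invmx potential_mx i j *
    (\sum_(y <- A) (a (s j - y) - a y + 1) * mu t y).
  apply/funext => t.
  have := congr1 (fun w : 'cV_n => w i 0)
    (mulKmx potential_mx_unit (\col_j mu t (s j))).
  rewrite !mxE => <-; apply: eq_bigr => j _; rewrite !mxE sumE; congr (_ * _).
  by apply: eq_bigr => k _; rewrite !mxE.
have hl : \sum_j invmx potential_mx i j *
    (\sum_(y <- A) (a (s j - y) - a y + 1) * mu t y) @[t --> F] -->
    \sum_j (invmx potential_mx i j * 1 : R).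
  by apply: cvg_sumr => j; apply: cvgMr; exact: mu1.
have E : \sum_j (invmx potential_mx i j * 1 : R) = \sum_j invmx potential_mx i j.
  by apply: eq_bigr => j _; rewrite mulr1.
by rewrite E in hl.
Qed.

End equilibrium_system.

(** * Hitting probabilities and first passage *)

Section hitting.
Variable A : {fset Z2}.
Implicit Types (h : Z2 -> R) (l : R).

(** One step of the walk killed on entering A. The starting point may itself lie in A, as suits a
    hitting time that ignores time 0. *)
Definition avoid_avg h : Z2 -> R := avg (fun z => if z \in A then 0 else h z).

Local Notation K := avoid_avg.

Lemma avoid_avg_comb (I : Type) (r : seq I) (c : I -> R) (h : I -> Z2 -> R) :
  K (fun z => \sum_(i <- r) c i * h i z) = fun y => \sum_(i <- r) c i * K (h i) y.
Proof.
apply/funext => y; rewrite /avoid_avg /step_avg mulr_suml.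
under [RHS]eq_bigr do rewrite mulrA mulr_sumr mulr_suml.
rewrite [RHS]exchange_big/=; apply: eq_bigr => j _.
case: ifP => _; last by rewrite mulr_suml.
by rewrite mul0r big1// => i _; rewrite mulr0 mul0r.
Qed.

Lemma iter_avoid_avg_comb m (I : Type) (r : seq I) (c : I -> R) (h : I -> Z2 -> R) :
  iter m K (fun z => \sum_(i <- r) c i * h i z) =
  fun y => \sum_(i <- r) c i * iter m K (h i) y.
Proof. by elim: m => // m IH; rewrite iterS IH avoid_avg_comb. Qed.

Lemma iter_avoid_avgD m l h1 h2 :
  iter m K (fun z => h1 z + l * h2 z) =
  fun y => iter m K h1 y + l * iter m K h2 y.
Proof.
have := iter_avoid_avg_comb m [:: true; false]
  (fun b => if b then 1 else l) (fun b => if b then h1 else h2).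
rewrite [X in iter _ _ X](_ : _ = fun z => h1 z + l * h2 z); last first.
  by apply/funext => z; rewrite !big_cons big_nil mul1r addr0.
by move=> ->; apply/funext => z; rewrite !big_cons big_nil mul1r addr0.
Qed.

Lemma iter_avoid_avg_bound m h (C : R) : (forall z, 0 <= h z <= C) ->
  forall z, 0 <= iter m K h z <= C.
Proof.
move=> h0C; elim: m => [//|m IH] z; rewrite iterS /avoid_avg avgE.
have C0 : 0 <= C by have /andP[] := h0C 0; exact: le_trans.
have hz w : 0 <= (if w \in A then 0 else iter m K h w) <= C.
  by case: ifP => // _; rewrite lexx.
have := hz (z + (1, 0)); have := hz (z + (-1, 0)).
have := hz (z + (0, 1)); have := hz (z + (0, -1)).
by do 4 move: (if _ then _ else _) => ?; lra.
Qed.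

(* The probability, starting from y, that the first visit to A at a positive
   time happens at time k + 1, at the site x. *)
Definition first_hit (k : nat) (x y : Z2) : R :=
  iter k K (avg (fun z => (z == x)%R%:R)) y.

Definition hit_gf l x y : R := limn (series (fun k => l ^+ k.+1 * first_hit k x y)).

Lemma first_hit_ge0 k x y : 0 <= first_hit k x y.
Proof.
suff /andP[] : 0 <= first_hit k x y <= 1 by [].
apply: iter_avoid_avg_bound => z; rewrite avgE.
by do 4 case: (_ == x)%R => /=; lra.
Qed.

Let avg_indic h : avg (fun z => if z \in A then h z else 0) =
  fun y => \sum_(x <- A) h x * avg (fun z => (z == x)%R%:R) y.
Proof.
apply/funext => y; rewrite /step_avg.
under [RHS]eq_bigr do rewrite mulrA mulr_sumr mulr_suml.
rewrite [RHS]exchange_big/= mulr_suml; apply: eq_bigr => j _; rewrite -mulr_suml.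
congr (_ / _); case: ifPn => jA.
  rewrite (bigD1_seq (y + unit_step j)) ?fset_uniq// eqxx mulr1 big1 => [|i].
    by rewrite /= addr0.
  by rewrite eq_sym => /negPf->; rewrite mulr0.
rewrite big1_seq// => x /andP[_ xA]; case: eqP => [yx|_]; rewrite ?mulr0//.
by rewrite yx xA in jA.
Qed.

Lemma first_hit_sum k y :
  \sum_(x <- A) first_hit k x y = iter k K (avg (fun z => (z \in A)%R%:R)) y.
Proof.
rewrite (_ : (fun z => (z \in A)%:R) = fun z => if z \in A then 1 else 0); last first.
  by apply/funext => z; case: ifP.
rewrite (avg_indic (fun=> 1)) iter_avoid_avg_comb.
by apply: eq_bigr => x _; rewrite mul1r.
Qed.

(** A step lands in A or not. The factor 1 gives the shape expected by [iter_avoid_avgD]. *)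
Let avg_split h : avg h = fun y =>
  (\sum_(x <- A) h x * avg (fun z => (z == x)%R%:R) y) + 1 * K h y.
Proof.
rewrite -(congr1 (fun f => fun y => f y + 1 * K h y) (avg_indic h)).
apply/funext => y; rewrite mul1r /avoid_avg -mulrDl -big_split/=; congr (_ / _).
by apply: eq_bigr => i _; case: ifP; rewrite ?addr0 ?add0r.
Qed.

(** Conservation of mass: the missing part is the probability of avoiding A during m steps. *)
Lemma first_hit_mass m y : \sum_(k < m) \sum_(x <- A) first_hit k x y <= 1.
Proof.
have one : avg (fun=> 1) = fun=> 1.
  by apply/funext => z; rewrite avgE; lra.
suff E : (\sum_(k < m) \sum_(x <- A) first_hit k x y) + iter m K (fun=> 1) y = 1.
  rewrite -[leRHS]E lerDl.
  suff /andP[] : 0 <= iter m K (fun=> 1) y <= 1 by [].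
  by apply: iter_avoid_avg_bound => z; rewrite ler01 lexx.
elim: m => [|m IH]; first by rewrite big_ord0 add0r.
have step : iter m K (fun=> 1) y =
    \sum_(x <- A) first_hit m x y + iter m.+1 K (fun=> 1) y.
  rewrite {1}(_ : (fun=> 1) = fun y =>
    (\sum_(x <- A) 1 * avg (fun z => (z == x)%R%:R) y) + 1 * K (fun=> 1) y); last first.
    by rewrite -avg_split one.
  rewrite iter_avoid_avgD iter_avoid_avg_comb mul1r [iter m.+1 _ _]iterSr; congr (_ + _).
  by apply: eq_bigr => x _; rewrite mul1r.
by rewrite big_ord_recr/= -addrA -[RHS]IH step.
Qed.

Lemma first_hit_series_le m x y : x \in A -> series (fun k => first_hit k x y) m <= 1.
Proof.
move=> xA; apply: le_trans (first_hit_mass m y); rewrite /series/= big_mkord.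
apply: ler_sum => k _; rewrite (bigD1_seq x)//= lerDl.
by apply: sumr_ge0 => z _; exact: first_hit_ge0.
Qed.

Lemma cvg_first_hit x y : x \in A -> cvgn (series (fun k => first_hit k x y)).
Proof.
move=> xA; apply: nondecreasing_is_cvgn.
  apply/nondecreasing_seqP => m; rewrite /series/= big_nat_recr//= lerDl.
  exact: first_hit_ge0.
by exists 1 => _ [m _ <-]; exact: first_hit_series_le.
Qed.

Let gf_dom l x y k : 0 <= l <= 1 -> `|l ^+ k.+1 * first_hit k x y| <= first_hit k x y.
Proof.
move=> /andP[l0 l1]; rewrite ger0_norm ?mulr_ge0 ?exprn_ge0 ?first_hit_ge0//.
by rewrite ler_piMl ?first_hit_ge0 ?exprn_ile1.
Qed.

Lemma cvg_hit_gf l x y : 0 <= l <= 1 -> x \in A ->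
  cvgn (series (fun k => l ^+ k.+1 * first_hit k x y)).
Proof.
move=> l01 xA; apply: (series_dominated_cvg (c := fun k => first_hit k x y)) => [k|].
- exact: gf_dom.
- exact: cvg_first_hit.
Qed.

Lemma hit_gf_sum_le1 l y : 0 <= l <= 1 -> \sum_(x <- A) hit_gf l x y <= 1.
Proof.
move=> l01; have hl : \sum_(x <- A) series (fun k => l ^+ k.+1 * first_hit k x y) m
    @[m --> \oo] --> \sum_(x <- A) hit_gf l x y.
  rewrite big_seq; under eq_cvg do rewrite big_seq.
  apply: (@cvg_big R^o) => //; first exact: add_continuous.
  by move=> x xA; exact: cvg_hit_gf.
rewrite -(cvg_lim _ hl)//; apply: limr_le; first by apply/cvg_ex; eexists; exact: hl.
apply: nearW => m; apply: le_trans (first_hit_mass m y).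
rewrite [leRHS]exchange_big/=; apply: ler_sum => x _; rewrite /series/= big_mkord.
by apply: ler_sum => k _; apply: le_trans (gf_dom _ _ _ l01); exact: ler_norm.
Qed.

Lemma hit_gf_cvg (l_ : nat -> R) x y : (forall N, 0 <= l_ N <= 1) ->
  l_ @ \oo --> (1 : R) -> x \in A ->
  hit_gf (l_ N) x y @[N --> \oo] --> hit_gf 1 x y.
Proof.
move=> l01 l1 xA; apply: (tannery (c := fun k => first_hit k x y)) => [N k||k].
- exact: gf_dom.
- exact: cvg_first_hit.
- apply: cvgMl; apply: (@cvg_comp _ _ _ l_ (fun z : R => z ^+ k.+1) _ _ _ l1).
  exact: exprn_continuous.
Qed.

(* First-passage decomposition at the first visit to A at a positive time. *)
Lemma green_hit_gf l y z : 0 <= l < 1 -> z \in A ->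
  green l (y - z) = (y == z)%R%:R + \sum_(x <- A) hit_gf l x y * green l (x - z).
Proof.
move=> l01 zA; have /andP[l0 l1] := l01.
have l01' : 0 <= l <= 1 by rewrite l0 ltW.
pose g w := green l (w - z).
have gE w : g w = (w == z)%R%:R + l * avg g w.
  rewrite /g green_resolvent// subr_eq0; congr (_ + _ * _).
  by congr (_ / _); apply: eq_bigr => i _; rewrite addrAC.
pose B0 w := \sum_(x <- A) g x * avg (fun z => (z == x)%R%:R) w.
(* As z lies in A, g and l avg g agree off A. This gives a renewal equation for avg g, iterated
   below with a remainder bounded by a multiple of l^(m+1). *)
have avggE : avg g = fun w => B0 w + l * K (avg g) w.
  rewrite {1}avg_split; apply/funext => w; rewrite mul1r; congr (_ + _).
  rewrite /avoid_avg /step_avg mulrA mulr_sumr; congr (_ / _); apply: eq_bigr => i _.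
  case: ifPn => [_|iA]; first by rewrite mulr0.
  rewrite gE; case: eqP => [iz|_]; last by rewrite add0r.
  by rewrite iz zA in iA.
have iterE m w : l * avg g w = \sum_(x <- A) g x *
    series (fun k => l ^+ k.+1 * first_hit k x w) m + l ^+ m.+1 * iter m K (avg g) w.
  elim: m => [|m IH].
    by rewrite expr1 big1 ?add0r// => x _; rewrite /series/= big_nil mulr0.
  rewrite IH avggE iter_avoid_avgD -iterSr mulrDr -avggE addrA; congr (_ + _); last first.
    by rewrite mulrA -exprSr.
  rewrite /B0 iter_avoid_avg_comb mulr_sumr -big_split/=; apply: eq_bigr => x _.
  by rewrite /series/= big_nat_recr//= mulrDr; congr (_ + _); rewrite mulrCA.
have [C gC] : exists C : R, forall w, 0 <= avg g w <= C.
  exists (4 / (1 - l)) => w; rewrite avgE.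
  have gb v : 0 <= g v <= 4 / (1 - l) by rewrite green_ge0 ?green_bound.
  have := gb (w + (1, 0)); have := gb (w + (-1, 0)).
  have := gb (w + (0, 1)); have := gb (w + (0, -1)).
  by do 4 move: (g _) => ?; lra.
rewrite -/(g y) gE; congr (_ + _).
have h1 : \sum_(x <- A) g x * series (fun k => l ^+ k.+1 * first_hit k x y) m
    @[m --> \oo] --> \sum_(x <- A) g x * hit_gf l x y.
  rewrite big_seq; under eq_cvg do rewrite big_seq.
  apply: (@cvg_big R^o) => //; first exact: add_continuous.
  by move=> x xA; apply: cvgMr; exact: cvg_hit_gf.
have h2 : \sum_(x <- A) g x * series (fun k => l ^+ k.+1 * first_hit k x y) m
    @[m --> \oo] --> l * avg g y - 0.
  have -> : (fun m => \sum_(x <- A) g x *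
      series (fun k => l ^+ k.+1 * first_hit k x y) m) =
      fun m => l * avg g y - l ^+ m.+1 * iter m K (avg g) y.
    by apply/funext => m; rewrite (iterE m y) addrK.
  apply: cvgB; first exact: cvg_cst.
  apply: (@squeeze_cvgr _ _ _ _ (fun=> 0) (fun m => l ^+ m.+1 * C)).
  - apply: nearW => m; have /andP[i0 i1] := iter_avoid_avg_bound m gC y.
    by rewrite mulr_ge0 ?exprn_ge0//= ler_wpM2l ?exprn_ge0.
  - exact: cvg_cst.
  - rewrite -[X in _ --> X](mul0r C); apply: cvgMl.
    by rewrite (cvg_shiftS (fun m => l ^+ m)); apply: cvg_expr; rewrite ger0_norm.
rewrite subr0 in h2; have := cvg_unique _ h1 h2 => /(_ (@Rhausdorff R)) <-.
by apply: eq_bigr => x _; rewrite mulrC.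
Qed.

Definition escape_gf l y : R := 1 - \sum_(x <- A) hit_gf l x y.

Lemma escape_gf_ge0 l y : 0 <= l <= 1 -> 0 <= escape_gf l y.
Proof. by move=> l01; rewrite subr_ge0 hit_gf_sum_le1. Qed.

(* The first-passage decomposition says that I - F is a left inverse of the
   Green matrix G, hence a right inverse; apply G (I - F) = I to the vector 1. *)
Lemma green_escape_gf l x : 0 <= l < 1 -> x \in A ->
  \sum_(y <- A) green l (x - y) * escape_gf l y = 1.
Proof.
move=> l01 xA.
pose n := size A; pose s (i : 'I_n) : Z2 := nth 0 A i.
have sumE (f : Z2 -> R) : \sum_(y <- A) f y = \sum_(i < n) f (s i).
  by rewrite (big_nth 0) big_mkord.
have s_in i : s i \in A by rewrite mem_nth.
have xn : (index x A < n)%N by rewrite index_mem.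
pose ix := Ordinal xn; have ixE : s ix = x by rewrite /s nth_index.
have s_inj : injective s.
  by move=> i j /eqP; rewrite nth_uniq ?fset_uniq// => /eqP ij; exact: val_inj.
pose G : 'M[R]_n := \matrix_(i, j) green l (s i - s j).
pose F : 'M[R]_n := \matrix_(i, j) hit_gf l (s j) (s i).
have FG : (1%:M - F) *m G = 1%:M.
  rewrite mulmxBl mul1mx; apply/matrixP => i j; rewrite !mxE.
  rewrite (green_hit_gf _ l01 (s_in j)) (inj_eq s_inj) sumE.
  apply/eqP; rewrite -addrA eq_sym -subr_eq0 opprD addNKr oppr_eq0 subr_eq0; apply/eqP.
  by apply: eq_bigr => k _; rewrite !mxE.
have := congr1 (fun M => (M *m const_mx 1 : 'cV_n) ix 0) (mulmx1C FG).
rewrite mul1mx -mulmxA [RHS]mxE => <-.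
rewrite mxE sumE; apply: eq_bigr => j _; rewrite [G _ _]mxE ixE; congr (_ * _).
rewrite mulmxBl mul1mx !mxE /escape_gf sumE; congr (_ - _).
by apply: eq_bigr => k _; rewrite !mxE mulr1.
Qed.

End hitting.

(** * Limits of the escape and hitting probabilities *)

Section limits.
Variable A : {fset Z2}.
Hypothesis A0 : 0 \in A.
Variable l_ : nat -> R.
Hypothesis l01 : forall N, 0 <= l_ N < 1.
Hypothesis l1 : l_ @ \oo --> (1 : R).
Hypothesis gy : green (l_ N) 0 @[N --> \oo] --> +oo.

Let l01' N : 0 <= l_ N <= 1.
Proof. by have /andP[h0 h1] := l01 N; rewrite h0 ltW. Qed.

Let g N : R := green (l_ N) 0.
Let gd N x : R := g N - green (l_ N) x.

Let gd_cvg x : gd N x @[N --> \oo] --> a x.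
Proof.
rewrite potential_kernelE.
rewrite (_ : (fun N => _) = fun N => gdiff (l_ N) x); last first.
  by apply/funext => N; rewrite green_diffE.
exact: (green_diffP R x).2 l01' l1.
Qed.

Let gV : (g N)^-1 @[N --> \oo] --> 0.
Proof.
apply/gtr0_cvgV0; last exact: gy.
by near=> N; near: N; move/cvgryPgt : gy; exact.
Unshelve. all: by end_near. Qed.

Let m N y : R := g N * escape_gf A (l_ N) y.

(** m(y) is the diagonal term of the sum of nonnegative terms in [green_escape_gf], which equals 1.
    This bound absorbs all error terms below. *)
Let m_itv N y : y \in A -> 0 <= m N y <= 1.
Proof.
move=> yA; have e0 z : 0 <= escape_gf A (l_ N) z by exact: escape_gf_ge0 (l01' N).
rewrite mulr_ge0 ?green_ge0//= -(green_escape_gf (l01 N) yA).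
rewrite (bigD1_seq y) ?fset_uniq//= subrr lerDl.
by apply: sumr_ge0 => z _; rewrite mulr_ge0 ?green_ge0.
Qed.

Let bounded_mul_cvg0 (f h : nat -> R) : f @ \oo --> (0 : R) ->
  (forall N, 0 <= h N <= 1) -> f N * h N @[N --> \oo] --> 0.
Proof.
move=> f0 h01.
have nf : `|f N| @[N --> \oo] --> (0 : R).
  by rewrite -[X in _ --> X](@normr0 R R); exact: cvg_norm.
apply: (@squeeze_cvgr _ _ _ _ (fun N => - `|f N|) (fun N => `|f N|)) => //.
- apply: nearW => N; have /andP[h0 h1] := h01 N.
  by rewrite -ler_norml normrM (ger0_norm h0) ler_piMr.
- by rewrite -[X in _ --> X]oppr0; exact: cvgN.
Qed.

Let m_sum N x : x \in A ->
  \sum_(y <- A) m N y = 1 + \sum_(y <- A) gd N (x - y) * escape_gf A (l_ N) y.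
Proof.
move=> xA; rewrite -(green_escape_gf (l01 N) xA) -big_split/=; apply: eq_bigr => y _.
by rewrite /m /gd -mulrDl addrC subrK.
Qed.

Let sum_cvg_in (T : Type) (F : set_system T) (f : Z2 -> T -> R) (k : Z2 -> R) :
  Filter F -> (forall y, y \in A -> f y t @[t --> F] --> k y) ->
  \sum_(y <- A) f y t @[t --> F] --> \sum_(y <- A) k y.
Proof.
move=> FF fk; rewrite big_seq; under eq_cvg do rewrite big_seq.
by apply: (@cvg_big R^o) => //; exact: add_continuous.
Qed.

Lemma escape_gf_cvg y : y \in A ->
  g N * escape_gf A (l_ N) y @[N --> \oo] --> limit_measure A y.
Proof.
apply: (equilibrium_system_cvg A0 (mu := m)) => x xA.
have g0 : \forall N \near \oo, 0 < g N by move/cvgryPgt : gy; exact.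
(* The difference of the equations at x and 0 holds exactly with [gd] in place of a. Replacing [gd]
   by a, and the total mass by 1, costs terms of the form o(1) times m. *)
have h1 : 1 + \sum_(y <- A) (a (x - y) - gd N (x - y) - (a y - gd N y)) * m N y +
     \sum_(y <- A) (g N)^-1 * gd N y * m N y @[N --> \oo] -->
   (1 : R) + \sum_(y <- A) 0 + \sum_(y <- A) 0.
  apply: cvgD; first (apply: cvgD; first exact: cvg_cst).
  - apply: sum_cvg_in => z zA; apply: bounded_mul_cvg0 => [|N]; last exact: m_itv.
    have h w : a w - gd N w @[N --> \oo] --> 0.
      by rewrite -[X in _ --> X](subrr (a w)); apply: cvgB; [exact: cvg_cst|exact: gd_cvg].
    by rewrite -[X in _ --> X](subrr 0); apply: cvgB; exact: h.
  - apply: sum_cvg_in => z zA; apply: bounded_mul_cvg0 => [|N]; last exact: m_itv.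
    by rewrite -[X in _ --> X](mul0r (a z)); apply: cvgM.
rewrite !big1// !addr0 in h1; apply: cvg_trans h1; apply: near_eq_cvg.
near=> N.
have gN : 0 < g N by near: N.
have E0 := m_sum N A0; have Ex := m_sum N xA.
have gdN z : gd N (0 - z) = gd N z by rewrite sub0r /gd greenN.
have E0' : \sum_(z <- A) m N z = 1 + \sum_(z <- A) (g N)^-1 * gd N z * m N z.
  rewrite E0; congr (_ + _); apply: eq_bigr => z _; rewrite gdN /m.
  by field; rewrite gt_eqF.
have Exx : \sum_(z <- A) (gd N (x - z) - gd N z) * m N z = 0.
  have : \sum_(z <- A) (gd N (x - z) - gd N z) * escape_gf A (l_ N) z = 0.
    apply/eqP; under eq_bigr do rewrite mulrBl; rewrite sumrB subr_eq0; apply/eqP.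
    apply: (addrI 1); rewrite -Ex E0; congr (_ + _).
    by apply: eq_bigr => z _; rewrite gdN.
  move=> /(congr1 ( *%R (g N))); rewrite mulr0 mulr_sumr => E; rewrite -[RHS]E.
  by apply: eq_bigr => z _; rewrite /m; ring.
have -> : \sum_(z <- A) (a (x - z) - a z + 1) * m N z =
    \sum_(z <- A) (a (x - z) - gd N (x - z) - (a z - gd N z)) * m N z +
    \sum_(z <- A) (gd N (x - z) - gd N z) * m N z + \sum_(z <- A) m N z.
  by rewrite -!big_split/=; apply: eq_bigr => z _; ring.
by rewrite Exx E0'; ring.
Unshelve. all: by end_near. Qed.

Let hit_sum_cvg y z : z \in A ->
  \sum_(x <- A) hit_gf A (l_ N) x y * gd N (x - z) @[N --> \oo] -->
  \sum_(x <- A) hit_gf A 1 x y * a (x - z).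
Proof.
by move=> zA; apply: sum_cvg_in => x xA; apply: cvgM; [exact: (@hit_gf_cvg A l_ x y l01' l1 xA)|exact: gd_cvg].
Qed.

(** The first-passage decomposition rewritten through the convergent differences [gd]. The left side
    does not depend on z, and the right side has a finite limit although g diverges. *)
Let hit_eq N y z : z \in A -> g N * escape_gf A (l_ N) y =
  gd N (y - z) + (y == z)%R%:R - \sum_(x <- A) hit_gf A (l_ N) x y * gd N (x - z).
Proof.
move=> zA; have := green_hit_gf y (l01 N) zA; rewrite /escape_gf /gd => E.
have -> : \sum_(x <- A) hit_gf A (l_ N) x y * (g N - green (l_ N) (x - z)) =
    (\sum_(x <- A) hit_gf A (l_ N) x y) * g N -
    \sum_(x <- A) hit_gf A (l_ N) x y * green (l_ N) (x - z).
  by rewrite mulr_suml -sumrB; apply: eq_bigr => x _; rewrite mulrBr.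
by rewrite E; ring.
Qed.

(** Recurrence: by [hit_eq] the escape probability is 1/g times a convergent quantity. *)
Lemma hit_prob_sum y : \sum_(x <- A) hit_gf A 1 x y = 1.
Proof.
have h1 : \sum_(x <- A) hit_gf A (l_ N) x y @[N --> \oo] -->
    \sum_(x <- A) hit_gf A 1 x y.
  by apply: sum_cvg_in => x xA; exact: (@hit_gf_cvg A l_ x y l01' l1 xA).
have h2 : (1 : R) - (g N)^-1 * (gd N (y - 0) + (y == 0)%R%:R -
    \sum_(x <- A) hit_gf A (l_ N) x y * gd N (x - 0)) @[N --> \oo] -->
    1 - 0 * (a (y - 0) + (y == 0)%R%:R - \sum_(x <- A) hit_gf A 1 x y * a (x - 0)).
  apply: cvgB; first exact: cvg_cst.
  apply: cvgM => //; apply: cvgB; last exact: hit_sum_cvg.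
  by apply: cvgD; [exact: gd_cvg|exact: cvg_cst].
rewrite mul0r (subr0 (1 : R)) in h2.
suff h3 : \sum_(x <- A) hit_gf A (l_ N) x y @[N --> \oo] --> (1 : R).
  exact: (cvg_unique (@Rhausdorff R) h1 h3).
apply: cvg_trans h2; apply: near_eq_cvg; near=> N.
have gN : 0 < g N by near: N; move/cvgryPgt : gy; exact.
by rewrite -hit_eq// mulKf ?gt_eqF// /escape_gf subKr.
Unshelve. all: by end_near. Qed.

(** Compare the limits of [hit_eq] for z and for 0. *)
Lemma hit_prob_potential y z : z \in A ->
  \sum_(x <- A) hit_gf A 1 x y * (a (x - z) - a x) =
  a (y - z) - a y + (y == z)%R%:R - (y == 0)%R%:R.
Proof.
move=> zA.
have h w : w \in A -> gd N (y - w) + (y == w)%R%:R -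
    \sum_(x <- A) hit_gf A (l_ N) x y * gd N (x - w) @[N --> \oo] -->
    a (y - w) + (y == w)%R%:R - \sum_(x <- A) hit_gf A 1 x y * a (x - w).
  move=> wA; apply: cvgB; last exact: hit_sum_cvg.
  by apply: cvgD; [exact: gd_cvg|exact: cvg_cst].
have hz := h _ zA; have h0 := h _ A0.
have E : (fun N => gd N (y - z) + (y == z)%R%:R -
    \sum_(x <- A) hit_gf A (l_ N) x y * gd N (x - z)) =
  (fun N => gd N (y - 0) + (y == 0)%R%:R -
    \sum_(x <- A) hit_gf A (l_ N) x y * gd N (x - 0)).
  by apply/funext => N; rewrite -!hit_eq.
rewrite E in hz.
have : a (y - z) + (y == z)%R%:R - \sum_(x <- A) hit_gf A 1 x y * a (x - z) =
    a y + (y == 0)%R%:R - \sum_(x <- A) hit_gf A 1 x y * a x.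
  have -> : \sum_(x <- A) hit_gf A 1 x y * a x = \sum_(x <- A) hit_gf A 1 x y * a (x - 0).
    by apply: eq_bigr => x _; rewrite subr0.
  by rewrite -{4}(subr0 y); exact: (cvg_unique (@Rhausdorff R) hz h0).
under [in X in _ -> X]eq_bigr do rewrite mulrBr.
by rewrite sumrB; do 2 move: (\sum_(_ <- _) _) => ?; lra.
Qed.

Lemma hit_prob_cvg x : x \in A -> hit_gf A 1 x y @[y --> infty_Z2] --> limit_measure A x.
Proof.
apply: (equilibrium_system_cvg A0 (mu := fun y x => hit_gf A 1 x y)) => z zA.
have h : a (y + (- z)) - a y + (y == z)%R%:R - (y == 0)%R%:R + 1 @[y --> infty_Z2] -->
    (0 : R) + 0 - 0 + 1.
  have near_neq w : (y == w)%R%:R @[y --> infty_Z2] --> (0 : R).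
    apply: cvg_near_cst; exists (absz (w.1 ^+ 2 + w.2 ^+ 2 + 1)%R) => // y /= hy.
    by case: eqP => // yw; rewrite yw in hy; lia.
  apply: cvgD; last exact: cvg_cst.
  by apply: cvgB => //; apply: cvgD => //; exact: potential_kernel_shift_cvg.
rewrite addr0 subr0 add0r in h.
rewrite (_ : (fun y => _) = fun y => a (y + (- z)) - a y + (y == z)%R%:R - (y == 0)%R%:R + 1)//.
apply/funext => y; rewrite -hit_prob_potential// -[X in _ = _ + X](hit_prob_sum y).
rewrite -big_split/=; apply: eq_bigr => w _.
by rewrite -(potential_kernelN R (z - w)) opprB; ring.
Qed.

(** By [m_sum] at 0 the left side equals the sum of [gd N y * m N y] as soon as g > 0. *)
Lemma escape_gf_sumB :
  g N ^+ 2 * (\sum_(y <- A) escape_gf A (l_ N) y - (g N)^-1) @[N --> \oo] -->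
  \sum_(y <- A) a y * limit_measure A y.
Proof.
have h : \sum_(y <- A) gd N y * m N y @[N --> \oo] --> \sum_(y <- A) a y * limit_measure A y.
  by apply: sum_cvg_in => y yA; apply: cvgM; [exact: gd_cvg|exact: escape_gf_cvg].
apply: cvg_trans h; apply: near_eq_cvg; near=> N.
have gN : 0 < g N by near: N; move/cvgryPgt : gy; exact.
have := m_sum N A0; rewrite /m -mulr_sumr => E.
have -> : g N ^+ 2 * (\sum_(y <- A) escape_gf A (l_ N) y - (g N)^-1) =
    g N * (g N * (\sum_(y <- A) escape_gf A (l_ N) y) - 1) by field; rewrite gt_eqF.
rewrite E addrC addKr mulr_sumr; apply: eq_bigr => y _.
by rewrite sub0r /gd greenN /m; ring.
Unshelve. all: by end_near. Qed.

End limits.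

Lemma escape_gf_singleton (l : R) : 0 <= l < 1 ->
  escape_gf [fset 0]%fset l 0 = (green l 0)^-1.
Proof.
move=> l01; have := @green_escape_gf [fset 0]%fset l 0 l01 (fset11 0).
rewrite big_seq_fset1 subrr => E.
have g0 : green l 0 != 0 by apply: contra_eq_neq E => ->; rewrite mul0r eq_sym oner_neq0.
by apply: (mulfI g0); rewrite E mulfV.
Qed.

End potential_theory.

(** * Law of the killed walk *)

Section fine_probability.
Context d (T : measurableType d) (R : realType) (mu : probability T R).
Implicit Types E F : set T.

Lemma probability_fineK E : measurable E -> (fine (mu E))%:E = mu E.
Proof. by move=> mE; rewrite fineK// fin_num_measure. Qed.

Lemma fine_probability_le E F : measurable E -> measurable F -> E `<=` F ->
  fine (mu E) <= fine (mu F).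
Proof.
move=> mE mF EF; rewrite fine_le ?fin_num_measure//.
by apply: le_measure; rewrite ?inE.
Qed.

Lemma fine_probability_bigcup (F : nat -> set T) : (forall i, measurable (F i)) ->
  trivIset setT F ->
  series (fun i => fine (mu (F i))) @ \oo --> fine (mu (\bigcup_i F i)).
Proof.
move=> mF tF; have := @measure_sigma_additive _ _ _ mu F mF tF.
rewrite -[X in _ --> X]probability_fineK; last exact: bigcupT_measurable.
have <- : fine \o (fun n => \sum_(0 <= i < n) mu (F i))%E =
    series (fun i => fine (mu (F i))).
  apply/funext => n; rewrite /series/= (eq_bigr (fun i => (fine (mu (F i)))%:E)) ?sumEFin//.
  by move=> i _; rewrite probability_fineK.
exact: fine_cvg.
Qed.

Lemma fine_probability_ord n (F : 'I_n -> set T) : (forall i, measurable (F i)) ->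
  (forall i j t, F i t -> F j t -> i = j) ->
  fine (mu (\bigcup_i F i)) = \sum_i fine (mu (F i)).
Proof.
move=> mF tF; pose F' (k : nat) := oapp F set0 (insub k).
have F'E (i : 'I_n) : F' i = F i by rewrite /F' valK.
have F'P k t : F' k t -> exists2 i : 'I_n, i = k :> nat & F i t.
  by rewrite /F'; case: insubP => //= i _ ik Fi; exists i.
have -> : \bigcup_i F i = \big[setU/set0]_(i < n) F' i.
  rewrite -bigcup_mkord; apply/seteqP; split => t.
    by case=> i _ Fi; exists i => //=; rewrite F'E.
  by case=> k _ /F'P[i _ Fi]; exists i.
rewrite measure_bigsetU.
- rewrite (eq_bigr (fun i => (fine (mu (F i)))%:E)) ?sumEFin// => i _.
  by rewrite F'E probability_fineK.
- by move=> k; rewrite /F'; case: insubP => [i _ _|_] /=; [exact: mF|exact: measurable0].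
- move=> k l _ _ [t [/F'P[i <- Fi] /F'P[j <- Fj]]].
  by rewrite (tF _ _ _ Fi Fj).
Qed.

End fine_probability.

Section exponential.
Variable R : realType.
Local Notation mu := (@lebesgue_measure R).

Lemma exponential_prob_setT (r : R) : 0 < r -> exponential_prob r [set: R] = 1%E.
Proof. exact: integral_exponential_pdf. Qed.

Lemma exponential_prob_0c (r x : R) : 0 <= x ->
  exponential_prob r `[0, x]%classic = (1 - expR (- (r * x)))%:E.
Proof.
rewrite le_eqVlt => /predU1P[<-|x0].
  by rewrite set_itv1 /exponential_prob integral_set1 mulr0 oppr0 expR0 subrr.
by rewrite exponential_prob_itv0c// mulNr.
Qed.

Lemma exponential_prob_oc (r x y : R) : 0 < r -> 0 <= x -> x <= y ->
  exponential_prob r `]x, y]%classic = (expR (- (r * x)) - expR (- (r * y)))%:E.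
Proof.
move=> r0 x0 xy; have y0 := le_trans x0 xy.
have := exponential_prob_0c r y0.
rewrite (@itv_bndbnd_setU _ _ (BLeft 0) (BRight x) (BRight y)) ?bnd_simp//.
rewrite {1}/exponential_prob ge0_integral_setU//=.
- rewrite -!/(exponential_prob _ _) exponential_prob_0c//.
  by case: (exponential_prob _ _) => [e [E]| |]//; congr EFin; lra.
- apply/measurable_funTS/measurableT_comp => //; exact: measurable_exponential_pdf.
- by move=> t _; rewrite lee_fin exponential_pdf_ge0// ltW.
- apply/disj_setPS => t /=; rewrite !in_itv/= => -[/andP[_ tx] /andP[xt _]].
  by have := lt_le_trans xt tx; rewrite ltxx.
Qed.

End exponential.

Section walk_law.
Variables (R : realType) (d : measure_display) (Omega : measurableType d).
Variables (P : Z2 -> probability Omega R).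
Variables (Z : nat -> Omega -> Z2) (T : nat -> Omega -> R).
Variable (xi : R -> Omega -> R).
Hypothesis walkP : is_srw P Z T xi.
Local Notation tau := (jump_time T).

Lemma jump_time0 w : tau 0 w = 0.
Proof. by rewrite /jump_time big_ord0. Qed.

Lemma jump_timeS n w : tau n.+1 w = tau n w + T n w.
Proof. by rewrite /jump_time big_ord_recr. Qed.

Lemma jump_time_lt n m w : (n < m)%N -> tau n w < tau m w.
Proof.
elim: m => // m IH; rewrite ltnS leq_eqVlt jump_timeS => /predU1P[->|/IH nm].
  by rewrite ltrDl (srw_holding_gt0 walkP).
by apply: lt_trans nm _; rewrite ltrDl (srw_holding_gt0 walkP).
Qed.

Lemma jump_time_le n m w : (n <= m)%N -> tau n w <= tau m w.
Proof. by rewrite leq_eqVlt => /predU1P[->//|/(jump_time_lt w)/ltW]. Qed.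

Lemma jump_time_ge0 n w : 0 <= tau n w.
Proof. by rewrite -(jump_time0 w) jump_time_le. Qed.

Lemma exists_jump_interval w t : 0 <= t -> exists n, tau n w <= t < tau n.+1 w.
Proof.
move=> t0; have tex := srw_no_explosion walkP w t.
case: (ex_minnP tex) => -[|n] tn nmin; first by rewrite jump_time0 ltNge t0 in tn.
exists n; rewrite tn andbT leNgt; apply/negP => /nmin; by rewrite ltnn.
Qed.

Lemma walkE n w t : tau n w <= t < tau n.+1 w -> walk Z T w t = Z n w.
Proof.
move=> /andP[nt tn]; rewrite /walk; set S := [set n | _].
have : S (get S) by apply: getPex; exists n; rewrite /S/= nt tn.
rewrite {1}/S/=; set m := get S => /andP[mt tm]; congr (Z _ _).
apply/eqP; rewrite eqn_leq; apply/andP; split; rewrite -ltnS ltnNge; apply/negP.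
- by move=> /(jump_time_le w) h; have := lt_le_trans tn h; rewrite ltNge mt.
- by move=> /(jump_time_le w) h; have := lt_le_trans tm h; rewrite ltNge nt.
Qed.

Lemma walk_jump_time n w : walk Z T w (tau n w) = Z n w.
Proof. by apply: walkE; rewrite lexx jump_time_lt. Qed.

Lemma srw_neq n w : Z n.+1 w <> Z n w.
Proof.
by move=> e; have := srw_nn walkP n w; rewrite e /nn !subrr.
Qed.

Section first_jump.
Variables (E : Type) (f : R -> E).

Lemma first_jump_le (s t : R) : 0 <= s -> s <= t -> f s <> f 0 -> (first_jump f <= t%:E)%E.
Proof.
move=> s0 st fs; apply: (@le_trans _ _ s%:E); last by rewrite lee_fin.
by apply: ereal_inf_lbound; exists s.
Qed.

Lemma first_jump_ge (b : R) : (forall s, 0 <= s < b -> f s = f 0) ->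
  (b%:E <= first_jump f)%E.
Proof.
move=> fb; apply: le_ereal_inf_tmp => _ [s [s0 fs] <-]; rewrite lee_fin leNgt.
by apply/negP => sb; apply: fs; apply: fb; rewrite s0.
Qed.

Lemma Htilde_eq_pinfty (A : set E) :
  Htilde A f = +oo%E <-> forall t, ~ [/\ 0 <= t, (first_jump f <= t%:E)%E & A (f t)].
Proof.
split=> [Hy t Ht|Hno].
  have : (Htilde A f <= t%:E)%E by apply: ereal_inf_lbound; exists t.
  by rewrite Hy.
rewrite /Htilde (_ : [set _ | _ in _] = set0) ?ereal_inf0//.
by apply/seteqP; split => // z [t Ht tz]; case: (Hno t).
Qed.

End first_jump.

Lemma first_jump_walk w t : (first_jump (walk Z T w) <= t%:E)%E <-> tau 1 w <= t.
Proof.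
have w0 : walk Z T w 0 = Z 0 w by rewrite -(jump_time0 w) walk_jump_time.
split=> [|t1]; last first.
  apply: (first_jump_le (s := tau 1 w)) => //; first exact: jump_time_ge0.
  by rewrite walk_jump_time w0; exact: srw_neq.
rewrite -lee_fin; apply: le_trans; apply: first_jump_ge => s s01.
by rewrite w0; apply: walkE; rewrite jump_time0.
Qed.

(** In terms of the jump chain, times at or after the first jump are those with index n + 1, which
    is why [Z 0] is never tested. *)
Lemma Htilde_walkP (A : set Z2) x w :
  (exists2 t, Htilde A (walk Z T w) = t%:E & walk Z T w t = x) <->
  (exists n, [/\ forall j, (j < n)%N -> ~ A (Z j.+1 w), A (Z n.+1 w) & Z n.+1 w = x]).
Proof.
have inS s : [/\ 0 <= s, (first_jump (walk Z T w) <= s%:E)%E & A (walk Z T w s)] ->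
    exists n, A (Z n.+1 w) /\ tau n.+1 w <= s.
  move=> [s0 /first_jump_walk s1 As]; have [[|n] sn] := exists_jump_interval w s0.
    by move: sn => /andP[_]; rewrite ltNge s1.
  by exists n; rewrite -(walkE sn); split => //; case/andP: sn.
have HtauE n : (forall j, (j < n)%N -> ~ A (Z j.+1 w)) -> A (Z n.+1 w) ->
    Htilde A (walk Z T w) = (tau n.+1 w)%:E.
  move=> nA An; apply/eqP; rewrite eq_le; apply/andP; split.
    apply: ereal_inf_lbound; exists (tau n.+1 w) => //; split.
    - exact: jump_time_ge0.
    - by apply/first_jump_walk; exact: jump_time_le.
    - by rewrite walk_jump_time.
  apply: le_ereal_inf_tmp => _ [s /inS[m [Am ms]] <-]; rewrite lee_fin.
  apply: le_trans ms; apply: jump_time_le; rewrite ltnS leqNgt; apply/negP => /nA.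
  exact.
split=> [[t Ht tx]|[n [nA An nx]]]; last first.
  by exists (tau n.+1 w); [exact: HtauE|rewrite walk_jump_time].
have : exists n, `[< A (Z n.+1 w) >].
  apply: contrapT => hno.
  suff Hy : Htilde A (walk Z T w) = +oo%E by rewrite Hy in Ht.
  apply/Htilde_eq_pinfty => s /inS[n [An _]]; apply: hno; exists n; exact/asboolP.
move=> hex; case: (ex_minnP hex) => n /asboolP An nmin.
have nA j : (j < n)%N -> ~ A (Z j.+1 w).
  by move=> jn /asboolP/nmin; rewrite leqNgt jn.
exists n; split => //; move: Ht; rewrite (HtauE _ nA An) => -[tE].
by rewrite -tx -tE walk_jump_time.
Qed.

Lemma escapeP (eps : R) (A : {fset Z2}) w : 0 < eps ->
  ~ escape Z T xi eps [set` A] w <->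
  exists n, [/\ forall j, (j < n)%N -> Z j.+1 w \notin A, Z n.+1 w \in A &
    tau n.+1 w < xi eps w].
Proof.
move=> e0; set f := killed_walk Z T xi eps w.
have xi0 := srw_killing_gt0 walkP w e0.
have f0 : f 0 = Some (Z 0 w).
  by rewrite /f /killed_walk xi0 -(jump_time0 w) walk_jump_time.
have key : (exists t, [/\ 0 <= t, (first_jump f <= t%:E)%E & embed [set` A] (f t)]) <->
    exists n, Z n.+1 w \in A /\ tau n.+1 w < xi eps w.
  split=> [[t [t0 tj]]|[n [nA nxi]]].
    rewrite /f /killed_walk; case: ifPn => [txi [y /= yA [yE]]|_ [y _ //]].
    have t1 : tau 1 w <= t.
      rewrite leNgt; apply/negP => t1.
      (* The first jump of the killed path may be the killing itself, so it is bounded below only by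
         this minimum; before the killing time that is enough. *)
      have : ((Order.min (tau 1 w) (xi eps w))%:E <= first_jump f)%E.
        apply: first_jump_ge => s /andP[s0]; rewrite lt_min => /andP[s1 sxi].
        rewrite f0 /f /killed_walk sxi; congr Some; apply: walkE.
        by rewrite jump_time0 s0.
      by move=> /le_trans/(_ tj); rewrite lee_fin leNgt lt_min t1 txi.
    have [[|n] tn] := exists_jump_interval w t0.
      by move: tn => /andP[_]; rewrite ltNge t1.
    exists n; rewrite -(walkE tn) -yE; split => //.
    by apply: le_lt_trans txi; case/andP: tn.
  have ft k : tau k w < xi eps w -> f (tau k w) = Some (Z k w).
    by move=> kxi; rewrite /f /killed_walk kxi walk_jump_time.
  exists (tau n.+1 w); split.
  - exact: jump_time_ge0.
  - have n1 : tau 1 w <= tau n.+1 w by exact: jump_time_le.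
    apply: (first_jump_le (s := tau 1 w)) => //; first exact: jump_time_ge0.
    by rewrite ft ?(le_lt_trans n1)// f0 => -[]; exact: srw_neq.
  - by rewrite ft//; exists (Z n.+1 w).
have -> : ~ escape Z T xi eps [set` A] w <->
    exists t, [/\ 0 <= t, (first_jump f <= t%:E)%E & embed [set` A] (f t)].
  split=> [h|[t ht]]; last by move=> /Htilde_eq_pinfty/(_ t).
  by apply: contrapT => hno; apply: h; apply/Htilde_eq_pinfty => t ht; apply: hno; exists t.
rewrite key; split=> [hex|[n [_ ? ?]]]; last by exists n.
have {}hex : exists n, (Z n.+1 w \in A) && (tau n.+1 w < xi eps w).
  by have [n [h1 h2]] := hex; exists n; rewrite h1 h2.
case: (ex_minnP hex) => n /andP[nA nxi] nmin; exists n; split => // j jn.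
apply/negP => jA; have : (n <= j)%N.
  apply: nmin; rewrite jA /=; apply: le_lt_trans nxi; apply: jump_time_le.
  by rewrite ltnS ltnW.
by rewrite leqNgt jn.
Qed.


Definition prefix_event (m : nat) (s : nat -> Z2) : set Omega :=
  [set w | forall k, (k <= m)%N -> Z k w = s k].

Definition path_weight (y : Z2) (m : nat) (s : nat -> Z2) : R :=
  (s 0%N == y)%:R * \prod_(k < m) ((nn (s k) (s k.+1))%:R / 4).

Lemma path_weight_ge0 y m s : 0 <= path_weight y m s.
Proof. by rewrite mulr_ge0//; apply: prodr_ge0 => k _; rewrite divr_ge0. Qed.

Lemma measurable_forall_le (m : nat) (F : nat -> set Omega) :
  (forall k, measurable (F k)) -> measurable [set w | forall k, (k <= m)%N -> F k w].
Proof. by move=> mF; apply: (@bigcap_measurableType _ _ F [set k | (k <= m)%N]). Qed.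

Lemma measurable_prefix_event m s : measurable (prefix_event m s).
Proof.
apply: (@measurable_forall_le m (fun k => [set w | Z k w = s k])) => k.
exact: srw_measurable_chain walkP _ _.
Qed.

Lemma measurable_jump_time m : measurable_fun setT (tau m).
Proof. by apply: measurable_sum => i; exact: srw_measurable_holding walkP _. Qed.

(** * Integrating out the holding times *)

Section killing.
Variables (eps : R) (y : Z2) (n : nat) (s : nat -> Z2).
Hypothesis eps0 : 0 < eps.
Local Notation lam := (survival eps).

Lemma measurable_jump_lt_killing m c : measurable [set w | tau m w + c < xi eps w].
Proof.
have mf : measurable_fun setT (fun w => tau m w + c).
  by apply: measurable_funD => //; exact: measurable_jump_time.
have mg := srw_measurable_killing walkP eps0.
have := measurable_fun_ltr mf mg.
by move=> /(_ measurableT [set true]); rewrite setTI; apply.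
Qed.

(** Shaped for the induction on m: to integrate out one more holding time, the set [B m] confines it
    to a small interval and the offset [c] takes over its approximate value. *)
Definition killing_event (m : nat) (c : R) (B : nat -> set R) : set Omega :=
  prefix_event n s `&` [set w | forall k, (k <= n)%N -> (m <= k)%N -> B k (T k w)]
    `&` [set w | tau m w + c < xi eps w].

Lemma measurable_killing_event m c B : (forall k, measurable (B k)) ->
  measurable (killing_event m c B).
Proof.
move=> mB; apply: measurableI; last exact: measurable_jump_lt_killing.
apply: measurableI; first exact: measurable_prefix_event.
apply: (@measurable_forall_le n (fun k => [set w | (m <= k)%N -> B k (T k w)])) => k.
have [mk|km] := leqP m k.
  rewrite (_ : [set w | _] = T k @^-1` B k); last first.
    by apply/seteqP; split => w /=; [exact|].
  rewrite -[X in measurable X]setTI.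
  by apply: (srw_measurable_holding walkP k) => //; exact: mB.
rewrite (_ : [set w | _] = setT)//.
by apply/seteqP; split => w //=; rewrite leqNgt km.
Qed.

(* Sandwiching T m between consecutive multiples of h turns the sum over its
   possible values into a geometric series; the two bounds meet as h -> 0. *)
Lemma killing_event_law m c (B : nat -> set R) (q : nat -> R) : (m <= n.+1)%N -> 0 <= c ->
  (forall k, measurable (B k)) -> (forall k, exponential_prob 1 (B k) = (q k)%:E) ->
  (forall k, 0 <= q k) ->
  fine (P y (killing_event m c B)) =
  path_weight y n s * lam ^+ m * expR (- (eps * c)) * \prod_(m <= k < n.+1) q k.
Proof.
elim: m c B q => [|m IH] c B q.
  move=> _ c0 mB qB q0.
  pose C1 : set R := setT; pose C2 : set R := `[0, c]%classic.
  pose E (C : set R) := [set w | [/\ forall k, (k <= n)%N -> Z k w = s k,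
     forall k, (k <= n)%N -> B k (T k w) & C (xi eps w)]].
  have mE (C : set R) : measurable C -> measurable (E C).
    move=> mC; rewrite (_ : E C = prefix_event n s `&`
        [set w | forall k, (k <= n)%N -> (T k @^-1` B k) w] `&` (xi eps @^-1` C)); last first.
      by apply/seteqP; split => w /=; [case=> ? ? ?; split => //; split|case=> -[? ?] ?; split].
    apply: measurableI; last first.
      rewrite -[X in measurable X]setTI.
      by apply: (srw_measurable_killing walkP eps0).
    apply: measurableI; first exact: measurable_prefix_event.
    apply: (@measurable_forall_le n (fun k => T k @^-1` B k)) => k.
    rewrite -[X in measurable X]setTI.
    by apply: (srw_measurable_holding walkP k) => //; exact: mB.
  have mC1 : measurable C1 by exact: measurableT.
  have mC2 : measurable C2 by exact: measurable_itv.
  (* The event that xi exceeds c is reached as a complement: by positivity of xi, xi <= c means that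
     xi lies in [0, c]. *)
  have -> : killing_event 0 c B = E C1 `\` E C2.
    apply/seteqP; split => w; rewrite /killing_event/= jump_time0 add0r.
      case=> -[wp wB] cw; split; first by split => // k kn; exact: wB.
      by case=> _ _; rewrite /C2/= in_itv/= [xi eps w <= c]leNgt cw andbF.
    case=> -[wp wB _] nC; split; first by split => // k kn _; exact: wB.
    rewrite ltNge; apply/negP => wc; apply: nC; split => //.
    by rewrite /C2/= in_itv/= wc ltW// (srw_killing_gt0 walkP).
  have PE (C : set R) r : measurable C -> exponential_prob eps C = r%:E ->
      P y (E C) = (path_weight y n s * (\prod_(k < n.+1) q k) * r)%:E.
    move=> mC Cr; rewrite /E (@srw_law _ _ _ _ _ _ _ walkP y eps n s B C eps0 mB mC) Cr.
    rewrite (eq_bigr (fun k : 'I_n.+1 => (q k)%:E)); last by move=> k _; exact: qB.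
    by rewrite prodEFin -!EFinM.
  rewrite measureD; [|exact: mE|exact: mE|by rewrite ltey_eq fin_num_measure//; exact: mE].
  rewrite (_ : E C1 `&` E C2 = E C2); last first.
    by apply/seteqP; split => w /=; [case|case=> ? ? ?; split].
  have -> : (P y (E C1) - P y (E C2) = (path_weight y n s * (\prod_(k < n.+1) q k) * 1)%:E -
      (path_weight y n s * (\prod_(k < n.+1) q k) * (1 - expR (- (eps * c))))%:E)%E.
    by congr (_ - _)%E; apply: PE; rewrite ?exponential_prob_setT ?exponential_prob_0c.
  by rewrite -EFinB/= expr0 mulr1 -(big_mkord xpredT q); ring.
move=> mn c0 mB qB q0.
set X := path_weight y n s * lam ^+ m * expR (- (eps * c)) * \prod_(m.+1 <= k < n.+1) q k.
have lam0 : 0 < lam by rewrite invr_gt0 addr_gt0.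
have X0 : 0 <= X.
  apply: mulr_ge0; last by apply: prodr_ge0 => k _.
  by rewrite mulr_ge0 ?expR_ge0// mulr_ge0 ?path_weight_ge0// exprn_ge0// ltW.
set pr := fine _.
(* An error linear in the mesh h suffices: the choices of h below make it smaller than any given
   e. *)
suff H (h : R) : 0 < h -> X * lam * (1 - (1 + eps) * h) <= pr <= X * (lam + h).
  transitivity (X * lam); last by rewrite /X exprSr; ring.
  apply/eqP; rewrite eq_le; apply/andP; split; apply/ler_addgt0Pr => e e0.
    have h0 : 0 < e / (X + 1) by rewrite divr_gt0// ltr_wpDl.
    have /andP[_] := H _ h0; move=> /le_trans; apply.
    rewrite mulrDr lerD2l mulrCA ler_piMr ?(ltW e0)// ler_pdivrMr ?ltr_wpDl// mul1r.
    by rewrite lerDl.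
  have e1 : 0 <= 1 + eps by rewrite addr_ge0// ltW.
  have a0 : 0 < X * lam * (1 + eps) + 1.
    by apply: ltr_wpDl => //; do 2 apply: mulr_ge0 => //; exact: ltW.
  have h0 : 0 < e / (X * lam * (1 + eps) + 1) by rewrite divr_gt0.
  have /andP[+ _] := H _ h0; rewrite mulrBr mulr1 lerBlDr => /le_trans; apply.
  rewrite lerD2l mulrA mulrCA ler_piMr ?(ltW e0)// ler_pdivrMr// mul1r lerDl//.
move=> h0.
pose I (i : nat) : set R := `]i%:R * h, i.+1%:R * h]%classic.
pose F (i : nat) : set Omega := killing_event m.+1 c B `&` (T m @^-1` I i).
have mF i : measurable (F i).
  apply: measurableI; first exact: measurable_killing_event.
  rewrite -[X in measurable X]setTI; apply: (srw_measurable_holding walkP m) => //.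
  exact: measurable_itv.
have tF : trivIset setT F.
  apply/trivIsetP => i j _ _ ij; apply/seteqP; split => // w [[_ /=] + [_ /=]].
  rewrite /I/= !in_itv/= => /andP[i1 i2] /andP[j1 j2].
  have k1 : i%:R * h < j.+1%:R * h by apply: lt_le_trans j2.
  have k2 : j%:R * h < i.+1%:R * h by apply: lt_le_trans i2.
  move: k1 k2; rewrite !ltr_pM2r// !ltr_nat !ltnS => k1 k2.
  by move: ij; rewrite eqn_leq k1 k2.
have UF : \bigcup_i F i = killing_event m.+1 c B.
  apply/seteqP; split => w; first by case=> i _ [].
  move=> Ew; have T0 := srw_holding_gt0 walkP m w.
  have tex : exists i : nat, T m w <= i.+1%:R * h.
    have := archi_boundP (divr_ge0 (ltW T0) (ltW h0)); set N := Num.bound _ => TN.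
    exists N; rewrite -ler_pdivrMr//; apply: ltW; apply: lt_le_trans TN _.
    by rewrite ler_nat.
  case: (ex_minnP tex) => i Ti imin; exists i => //; split => //=.
  rewrite /I/= in_itv/= Ti andbT ltNge; apply/negP.
  case: i {Ti} imin => [_|i imin]; first by rewrite mul0r leNgt T0.
  by move=> /imin; rewrite ltnn.
have cvgF := @fine_probability_bigcup _ _ _ (P y) F mF tF; rewrite UF -/pr in cvgF.
pose incr i := expR (- (i%:R * h)) - expR (- (i.+1%:R * h)).
have IE i : exponential_prob 1 (I i) = (incr i)%:E.
  by rewrite exponential_prob_oc ?mulr_ge0 ?(ltW h0) ?ler_pM2r ?ler_nat// !mul1r.
have d0 i : 0 <= incr i by rewrite subr_ge0 ler_expR lerN2 ler_pM2r// ler_nat.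
(* With [T m] confined to [I i], the induction hypothesis is used with its value replaced by i h for
   the upper bound and by (i + 1) h for the lower one. *)
pose Bi i k := if k == m then I i else B k.
pose qi i k := if k == m then incr i else q k.
have mBi i k : measurable (Bi i k) by rewrite /Bi; case: ifP => // _; exact: measurable_itv.
have qBi i k : exponential_prob 1 (Bi i k) = (qi i k)%:E by rewrite /Bi /qi; case: ifP.
have qi0 i k : 0 <= qi i k by rewrite /qi; case: ifP.
have IHi i e : 0 <= e -> fine (P y (killing_event m (c + e) (Bi i))) =
    X * (expR (- (eps * e)) * incr i).
  move=> e0; rewrite (IH _ _ (qi i))// ?(ltnW mn)// ?addr_ge0// big_ltn//.
  rewrite {1}/qi eqxx (eq_big_nat _ _ (F2 := q)) => [|k /andP[mk _]].
    by rewrite /X mulrDr opprD expRD; ring.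
  by rewrite /qi gtn_eqF.
have upper i : fine (P y (F i)) <= X * (expR (- (eps * (i%:R * h))) * incr i).
  rewrite -IHi ?mulr_ge0 ?(ltW h0)//; apply: fine_probability_le => //.
    exact: measurable_killing_event.
  move=> w [[[wp wB] wx] TI]; have : i%:R * h < T m w.
    by move: TI; rewrite /I/= in_itv/= => /andP[].
  split; first split => // k kn mk.
    rewrite /Bi; case: eqP => [->//|/eqP km]; apply: wB => //.
    by rewrite ltn_neqAle eq_sym km.
  by move: wx => /=; rewrite jump_timeS; lra.
have lower i : X * (expR (- (eps * (i.+1%:R * h))) * incr i) <= fine (P y (F i)).
  rewrite -IHi ?mulr_ge0 ?(ltW h0)//; apply: fine_probability_le => //.
    exact: measurable_killing_event.
  move=> w [[wp wB] wx].
  have : I i (T m w) by have := wB _ mn (leqnn m); rewrite /Bi eqxx.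
  move=> TI; split => //; split; first split => // k kn mk.
    by have := wB _ kn (ltnW mk); rewrite /Bi gtn_eqF.
  by move: wx TI => /=; rewrite /I/= in_itv/= jump_timeS => ? /andP[_ ?]; lra.
(* The sum over i is geometric with ratio x; u/(1 - x) tends to 1/(1 + eps) as h -> 0. The estimates
   rest on 1 - t <= e^(-t) <= 1/(1 + t). *)
pose x := expR (- ((1 + eps) * h)); pose u := 1 - expR (- h).
have dE i : incr i = expR (- (i%:R * h)) * u.
  by rewrite /incr /u mulrBr mulr1 -expRD -(natr1 i) mulrDl mul1r opprD.
have xE i : expR (- (eps * (i%:R * h))) * incr i = u * x ^+ i.
  rewrite dE mulrA -expRD mulrC /x -expRM_natl; congr (_ * expR _); ring.
have xE' i : expR (- (eps * (i.+1%:R * h))) * incr i = expR (- (eps * h)) * u * x ^+ i.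
  rewrite -[RHS]mulrA -xE [RHS]mulrA -expRD; congr (expR _ * _).
  by rewrite -(natr1 i); ring.
have a1 : 1 < 1 + eps by rewrite ltrDl.
have a0 : 0 < 1 + eps by apply: lt_trans a1.
have x1 : x < 1 by rewrite expR_lt1 oppr_lt0 mulr_gt0.
have x0 : 0 <= x by exact: expR_ge0.
have geo (C : R) : series (geometric C x) @ \oo --> C / (1 - x).
  by apply: cvg_geometric_series; rewrite ger0_norm.
have expN_le t : expR (- t) * (1 + t) <= 1.
  have : expR (- t) * (1 + t) <= expR (- t) * expR t.
    by rewrite ler_wpM2l ?expR_ge0//; exact: expR_ge1Dx.
  by rewrite [leRHS]mulrC expRxMexpNx_1.
have E1 : expR (- h) * (1 + h) <= 1 by exact: expN_le.
have E2 : 1 - h <= expR (- h) by exact: expR_ge1Dx.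
have X1 : x * (1 + (1 + eps) * h) <= 1 by exact: expN_le.
have X2 : 1 - (1 + eps) * h <= x by exact: expR_ge1Dx.
have xEE : x = expR (- h) * expR (- (eps * h)) by rewrite -expRD /x; congr expR; ring.
have lamE : lam * (1 + eps) = 1 by rewrite /survival mulVf// gt_eqF.
have x1' : 0 < 1 - x by rewrite subr_gt0.
apply/andP; split.
- apply: (@le_trans _ _ (X * (expR (- (eps * h)) * u) / (1 - x))).
    rewrite -[leLHS]mulrA -[leRHS]mulrA ler_wpM2l// ler_pdivlMr//.
    apply: (@le_trans _ _ (lam * (x * (1 - x)))).
      by rewrite -!mulrA ler_wpM2l ?(ltW lam0)// ler_wpM2r// ltW.
    apply: (@le_trans _ _ (lam * (x * ((1 + eps) * h)))).
      by rewrite ler_wpM2l ?(ltW lam0)// ler_wpM2l//; lra.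
    have -> : lam * (x * ((1 + eps) * h)) = lam * (1 + eps) * (x * h) by ring.
    rewrite lamE mul1r xEE [expR (- h) * _]mulrC -mulrA ler_wpM2l ?expR_ge0//.
    by rewrite /u; lra.
  rewrite -(cvg_lim _ (geo _))// -(cvg_lim _ cvgF)//; apply: lim_series_le.
  + by apply/cvg_ex; eexists; exact: geo.
  + by apply/cvg_ex; eexists; exact: cvgF.
  + by move=> i /=; rewrite -mulrA -xE'; exact: lower.
- apply: (@le_trans _ _ (X * u / (1 - x))).
    rewrite -(cvg_lim _ (geo _))// -(cvg_lim _ cvgF)//; apply: lim_series_le.
    + by apply/cvg_ex; eexists; exact: cvgF.
    + by apply/cvg_ex; eexists; exact: geo.
    + by move=> i /=; rewrite -mulrA -xE; exact: upper.
  rewrite -mulrA ler_wpM2l// ler_pdivrMr//.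
  have -> : (lam + h) * (1 - x) = lam * ((1 + (1 + eps) * h) - x * (1 + (1 + eps) * h)) +
      (1 - lam * (1 + eps)) * h * (1 - x) by ring.
  rewrite lamE subrr !mul0r addr0; apply: (@le_trans _ _ (lam * ((1 + eps) * h))).
    by rewrite mulrA lamE mul1r /u; lra.
  by rewrite ler_wpM2l ?(ltW lam0)//; lra.
Qed.

Lemma killed_prefix_law :
  fine (P y (prefix_event n s `&` [set w | tau n w < xi eps w])) =
  path_weight y n s * lam ^+ n.
Proof.
have := @killing_event_law n 0 (fun=> setT) (fun=> 1) (leqnSn n) (lexx 0).
rewrite mulr0 oppr0 expR0 mulr1 big1// mulr1 => <- //; last first.
  by move=> k; exact: exponential_prob_setT.
congr (fine (P y _)); apply/seteqP; split => w; rewrite /killing_event/= addr0.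
  by case=> wp ?; split => //; split.
by case=> -[].
Qed.

End killing.

Lemma prefix_law y m s : fine (P y (prefix_event m s)) = path_weight y m s.
Proof.
have := @srw_law _ _ _ _ _ _ _ walkP y 1 m s (fun=> setT) setT ltr01 (fun=> measurableT) measurableT.
rewrite exponential_prob_setT// mule1 [X in (_ * X)%E]big1// mule1 -/(path_weight y m s) => E.
have -> : prefix_event m s = [set w | [/\ forall k, (k <= m)%N -> Z k w = s k,
    forall k, (k <= m)%N -> setT (T k w) & setT (xi 1 w)]].
  by apply/seteqP; split => w /=; [move=> ?; split|case].
by rewrite E.
Qed.

Lemma nn_unit_step x i : nn x (x + unit_step i).
Proof.
by rewrite /nn/= !opprD !addNKr !normrN; case: i => -[|[|[|[|]]]].
Qed.

Lemma nnP x z : nn x z -> exists i, z = x + unit_step i.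
Proof.
case: x z => x1 x2 [z1 z2]; rewrite /nn/= => h.
have [[e1 e2]|[e1 e2]|[e1 e2]|[e1 e2]] : [\/ z1 = x1 + 1 /\ z2 = x2,
    z1 = x1 - 1 /\ z2 = x2, z1 = x1 /\ z2 = x2 + 1 | z1 = x1 /\ z2 = x2 - 1].
  move/eqP: h; have [<-|/eqP h1] := eqVneq x1 z1.
    have [h2|h2] := ltrP z2 x2; first by move=> h; constructor 4; lia.
    by move=> h; constructor 3; lia.
  have [h2|h2] := ltrP z1 x1; first by move=> h; constructor 2; lia.
  by move=> h; constructor 1; lia.
- by exists (@Ordinal 4 0 isT); rewrite e1 e2; congr pair => /=; rewrite ?addr0.
- by exists (@Ordinal 4 1 isT); rewrite e1 e2; congr pair => /=; rewrite ?addr0.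
- by exists (@Ordinal 4 2 isT); rewrite e1 e2; congr pair => /=; rewrite ?addr0.
- by exists (@Ordinal 4 3 isT); rewrite e1 e2; congr pair => /=; rewrite ?addr0.
Qed.

Lemma unit_step_inj : injective unit_step.
Proof.
move=> [[|[|[|[|//]]]] ?] [[|[|[|[|//]]]] ?] //= _; exact: val_inj.
Qed.

Definition extend_path (m : nat) (s : nat -> Z2) (i : 'I_4) (k : nat) : Z2 :=
  if (k <= m)%N then s k else s m + unit_step i.

Lemma path_weight_extend y m s i :
  path_weight y m.+1 (extend_path m s i) = path_weight y m s / 4.
Proof.
have Ele k : (k <= m)%N -> extend_path m s i k = s k by rewrite /extend_path => ->.
have ES : extend_path m s i m.+1 = s m + unit_step i by rewrite /extend_path ltnn.
rewrite /path_weight big_ord_recr/= ES !Ele// nn_unit_step mul1r -mulrA.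
congr (_ * (_ * _)); apply: eq_bigr => k _.
by rewrite !Ele ?ltn_ord// ltnW.
Qed.

Lemma prefix_event_extend m s :
  prefix_event m s = \bigcup_i prefix_event m.+1 (extend_path m s i).
Proof.
apply/seteqP; split => w.
  move=> ws; have [i Zi] := nnP (srw_nn walkP m w); exists i => // k.
  rewrite leq_eqVlt => /predU1P[->|km]; last by rewrite /extend_path -ltnS km; exact: ws.
  by rewrite /extend_path ltnn Zi ws.
case=> i _ ws k km; rewrite ws ?(leqW km)//.
by rewrite /extend_path km.
Qed.

Lemma prefix_event_split y m s (X : set Omega) : measurable X ->
  fine (P y (prefix_event m s `&` X)) =
  \sum_(i < 4) fine (P y (prefix_event m.+1 (extend_path m s i) `&` X)).
Proof.
move=> mX; rewrite prefix_event_extend setI_bigcupl.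
apply: fine_probability_ord => [i|i j w [wi _] [wj _]].
  by apply: measurableI => //; exact: measurable_prefix_event.
have := wi m.+1 (leqnn _); have := wj m.+1 (leqnn _).
by rewrite /extend_path ltnn => -> /addrI/unit_step_inj.
Qed.

(** * First visits of the jump chain, with and without killing *)

Section hitting_law.
Variables (A : {fset Z2}) (y : Z2) (D : nat -> set Omega) (l : R).
Hypothesis mD : forall k, measurable (D k).
Hypothesis lawD : forall m s,
  fine (P y (prefix_event m s `&` D m)) = path_weight y m s * l ^+ m.
Variable g : pred Z2.
Local Notation avg := (@step_avg R).

(** Used twice: for escape, with [D k] the survival of k jumps and g the membership in A; for the
    harmonic measure, with [D k] the whole space, l = 1 and g a single site. *)
Definition hit_after (m r : nat) : set Omega :=
  [set w | forall j, (j < r)%N -> Z (m + j).+1 w \notin A]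
    `&` [set w | g (Z (m + r).+1 w)] `&` D (m + r).+1.

Lemma measurable_chain_pred k (Q : pred Z2) : measurable [set w | Q (Z k w)].
Proof.
have -> : [set w | Q (Z k w)] = \bigcup_(z in [set z | Q z]) [set w | Z k w = z].
  by apply/seteqP; split => w /= => [Qw|[z Qz ->//]]; exists (Z k w).
rewrite bigcup_mkcond; apply: countable_bigcupT_measurable => // z.
case: ifP => // _; exact: srw_measurable_chain walkP _ _.
Qed.

Lemma measurable_hit_after m r : measurable (hit_after m r).
Proof.
apply: measurableI => //; apply: measurableI; last exact: measurable_chain_pred.
case: r => [|r].
  by rewrite (_ : [set w | _] = setT)//; apply/seteqP; split.
rewrite (_ : [set w | _] = [set w | forall j, (j <= r)%N ->
    [set w | Z (m + j).+1 w \notin A] w])//.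
apply: (@measurable_forall_le r (fun j => [set w | Z (m + j).+1 w \notin A])) => j.
exact: (@measurable_chain_pred _ (fun z => z \notin A)).
Qed.

(** The Markov property in weighted form: splitting according to the next site shows that only the
    last site of the prefix matters. *)
Lemma hit_after_law r m s : fine (P y (prefix_event m s `&` hit_after m r)) =
  path_weight y m s * l ^+ (m + r).+1 * iter r (avoid_avg A) (avg (fun z => (g z)%R%:R)) (s m).
Proof.
elim: r m s => [|r IH] m s; rewrite prefix_event_split; try exact: measurable_hit_after.
  rewrite addn0 /= /step_avg mulr_suml mulr_sumr; apply: eq_bigr => i _.
  have [gi|gi] := boolP (g (s m + unit_step i)).
    rewrite (_ : _ `&` _ = prefix_event m.+1 (extend_path m s i) `&` D m.+1).
      by rewrite lawD path_weight_extend /= mul1r; ring.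
    apply/seteqP; split => w [ws]; rewrite /hit_after addn0; first by case.
    move=> wD; split => //; split => // ; split => //=.
    by rewrite (ws _ (leqnn _)) /extend_path ltnn.
  rewrite (_ : _ `&` _ = set0) ?measure0 ?mul0r ?mulr0//.
  apply/seteqP; split => // w [ws]; rewrite /hit_after addn0 => -[[_ /=]].
  by rewrite (ws _ (leqnn _)) /extend_path ltnn (negPf gi).
rewrite iterS /= {1}/avoid_avg /step_avg mulr_suml mulr_sumr; apply: eq_bigr => i _.
have E w : prefix_event m.+1 (extend_path m s i) w -> Z m.+1 w = s m + unit_step i.
  by move=> ws; rewrite (ws _ (leqnn _)) /extend_path ltnn.
case: ifPn => iA.
  rewrite (_ : _ `&` _ = set0) ?measure0 ?mul0r ?mulr0//.
  apply/seteqP; split => // w [/E ZE [[/(_ 0%N isT) + _] _]].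
  by rewrite addn0 ZE iA.
rewrite (_ : _ `&` _ = prefix_event m.+1 (extend_path m s i) `&` hit_after m.+1 r).
  rewrite IH path_weight_extend addSnnS.
  rewrite (_ : extend_path _ _ _ _ = s m + unit_step i); last by rewrite /extend_path ltnn.
  have F (a b c : R) : a / 4 * b * c = a * b * (c / 4) by ring.
  exact: F.
apply/seteqP; split => w [ws]; rewrite /hit_after addSnnS => -[[wA wg] wD]; split => //;
  split => //; split => //.
  by move=> j jr; rewrite addSnnS; exact: wA.
case=> [_|j jr]; first by rewrite addn0 (E _ ws).
by rewrite -addSnnS; exact: wA.
Qed.

Lemma hit_law r : fine (P y (hit_after 0 r)) =
  l ^+ r.+1 * iter r (avoid_avg A) (avg (fun z => (g z)%R%:R)) y.
Proof.
have := hit_after_law r 0 (fun=> y).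
rewrite /path_weight eqxx big_ord0 mulr1 mul1r add0n => <-.
have mH := measurable_hit_after 0 r.
have mp := measurable_prefix_event 0 (fun=> y).
have p1 : fine (P y (prefix_event 0 (fun=> y))) = 1.
  by rewrite prefix_law /path_weight eqxx big_ord0 mulr1.
have P0 : P y (~` prefix_event 0 (fun=> y)) = 0%E.
  by rewrite probability_setC// -(probability_fineK (P y) mp) p1 -EFinB subrr.
rewrite (@measureDI _ _ _ (P y) _ (prefix_event 0 (fun=> y)))// [hit_after 0 r `&` _]setIC.
rewrite [X in fine (X + _)%E](_ : _ = 0%E) ?add0e//.
  apply: (@subset_measure0 _ _ _ (P y) _ (~` prefix_event 0 (fun=> y))) => //.
  - exact: measurableD.
  - exact: measurableC.
Qed.

(** Since g selects sites of A, the events for different r are disjoint: a hit at r violates the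
    avoidance required by any later one. *)
Lemma hit_event_law : (forall z, g z -> z \in A) ->
  series (fun r => l ^+ r.+1 * iter r (avoid_avg A) (avg (fun z => (g z)%R%:R)) y) @ \oo -->
  fine (P y (\bigcup_r hit_after 0 r)).
Proof.
move=> gA.
have -> : (fun r => l ^+ r.+1 * iter r (avoid_avg A) (avg (fun z => (g z)%R%:R)) y) =
    (fun r => fine (P y (hit_after 0 r))).
  by apply/funext => r; rewrite hit_law.
apply: fine_probability_bigcup; first exact: measurable_hit_after.
have lt_disj i j w : (i < j)%N -> hit_after 0 i w -> hit_after 0 j w -> False.
  by move=> ij [[_ /gA iA] _] [[/(_ _ ij)]]; rewrite iA.
apply/trivIsetP => i j _ _; rewrite neq_ltn => /orP[] ij; apply/seteqP; split => // w [wi wj].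
  exact: lt_disj ij wi wj.
exact: lt_disj ij wj wi.
Qed.

Lemma measurable_hit_event : measurable (\bigcup_r hit_after 0 r).
Proof. by apply: bigcupT_measurable => r; exact: measurable_hit_after. Qed.

End hitting_law.

Lemma escapeE (eps : R) (A : {fset Z2}) : 0 < eps ->
  escape Z T xi eps [set` A] =
  ~` \bigcup_r hit_after A (fun n => [set w | tau n w < xi eps w]) (fun z => z \in A) 0 r.
Proof.
move=> e0; apply/seteqP; split => w.
  move=> we [r _ [[wA wr] wx]]; apply/(@escapeP eps A w e0): we.
  by exists r; split.
move=> hno; apply: contrapT => /escapeP-/(_ e0)[r [wA wr wx]].
by apply: hno; exists r.
Qed.

Lemma equilibrium_measureE (eps : R) (A : {fset Z2}) x : 0 < eps ->
  equilibrium_measure P Z T xi eps [set` A] x = escape_gf A (survival eps) x.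
Proof.
move=> e0; have mD k : measurable [set w | tau k w < xi eps w].
  have := measurable_jump_lt_killing e0 k 0; congr (measurable _).
  by apply/seteqP; split => w /=; rewrite addr0.
have lawD m s := @killed_prefix_law eps x m s e0.
have gA z : z \in A -> z \in A by [].
rewrite /equilibrium_measure escapeE// probability_setC; last exact: measurable_hit_event.
rewrite -probability_fineK; last exact: measurable_hit_event.
rewrite -EFinB/=; congr (1 - _); symmetry.
have /cvg_lim <- // := @hit_event_law A x _ _ mD lawD (fun z => z \in A) gA.
symmetry; apply: cvg_lim => //.
have -> : (fun r => survival eps ^+ r.+1 * iter r (avoid_avg A)
      (@step_avg R (fun z => (z \in A)%R%:R)) x) =
    fun r => \sum_(z <- A) survival eps ^+ r.+1 * first_hit R A r z x.
  by apply/funext => r; rewrite -mulr_sumr first_hit_sum.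
have -> : series (fun r => \sum_(z <- A) survival eps ^+ r.+1 * first_hit R A r z x) =
    (fun n => \sum_(z <- A) series (fun r => survival eps ^+ r.+1 * first_hit R A r z x) n).
  by apply/funext => n; rewrite /series/= exchange_big.
have /andP[l0 l1] := survival_itv e0.
rewrite big_seq; under eq_cvg do rewrite big_seq.
apply: (@cvg_big R^o) => [|z zA]; first exact: add_continuous.
apply: cvg_hit_gf => //.
by rewrite l0 ltW.
Qed.

Lemma hit_site_law (A : {fset Z2}) x y : x \in A ->
  fine (P y [set w | exists2 t, Htilde [set` A] (walk Z T w) = t%:E & walk Z T w t = x]) =
  hit_gf A 1 x y.
Proof.
move=> xA; have mD (k : nat) : measurable [set: Omega] by [].
have lawD m s : fine (P y (prefix_event m s `&` setT)) = path_weight y m s * 1 ^+ m.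
  by rewrite setIT prefix_law expr1n mulr1.
have gA z : pred1 x z -> z \in A by move=> /eqP->.
have -> : [set w | exists2 t, Htilde [set` A] (walk Z T w) = t%:E & walk Z T w t = x] =
    \bigcup_r hit_after A (fun=> setT) (pred1 x) 0 r.
  apply/seteqP; split => w.
    move=> /Htilde_walkP[r [wA _ wx]]; exists r => //; split => //; split; last exact/eqP.
    by move=> j jr; apply/negP; exact: wA.
  move=> [r _ [[wA /eqP wx] _]]; apply/Htilde_walkP; exists r; split => //.
    by move=> j jr; apply/negP; exact: wA.
  by rewrite /= wx.
have /cvg_lim <- // := @hit_event_law A y _ _ mD lawD (pred1 x) gA.
Qed.

(** The sequence [l_] is the approximation from below through which the identities at l = 1 are
    obtained. *)
Lemma harmonic_measureE (A : {fset Z2}) (l_ : nat -> R) x : 0 \in A ->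
  (forall N, 0 <= l_ N < 1) -> l_ @ \oo --> (1 : R) ->
  green (l_ N) 0 @[N --> \oo] --> +oo -> x \in A ->
  harmonic_measure P Z T [set` A] x = limit_measure R A x.
Proof.
move=> A0 l01 l1 gy xA; rewrite /harmonic_measure.
under eq_fun do rewrite hit_site_law//.
by apply: cvg_lim => //; exact: (hit_prob_cvg A0 l01 l1 gy).
Qed.

End walk_law.

(** * Interlacements *)

Section visiting.
Variable R : realType.

Definition visiting (A : set Z2) : set (W R) :=
  [set w | exists t x, A x /\ val w t = Some x].

(** Visiting A is invariant under time shifts. *)
Lemma piW_preimage_visiting A : @piW R @^-1` Wstar_visiting A = visiting A.
Proof.
apply/seteqP; split => [w [w' [t [x [Ax w't]]] piE]|w]; last by exists w.
have : shift_rel (w' : trajW R) (w : trajW R) by apply/generic_quotient.eqmodP.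
move=> /asboolP[h wE]; exists (t - h), x; split => //.
by rewrite wE subrK.
Qed.

Lemma measurable_coord (t : R) z : measurable [set w : W R | val w t = z].
Proof. by apply: sub_sigma_algebra; exists t, z. Qed.

(** By right-continuity every visited state is seen at a rational time, so visiting a set is a
    countable union of coordinate events. *)
Lemma step_path_rat (w : R -> option Z2) t : step_path w ->
  exists q : rat, w (ratr q) = w t.
Proof.
move=> /(_ t)[[e /= e0 H] _].
have /rat_in_itvoo[q] : t < t + e by rewrite ltrDl.
rewrite in_itv/= => /andP[tq qe]; exists q; apply: H => //=.
by rewrite distrC ger0_norm ?subr_ge0 ?(ltW tq)// ltrBlDl.
Qed.

Lemma measurable_visiting A : measurable (visiting A).
Proof.
have -> : visiting A = \bigcup_(q : rat) \bigcup_(x : Z2)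
    (if `[< A x >] then [set w : W R | val w (ratr q) = Some x] else set0).
  apply/seteqP; split => w.
    move=> [t [x [Ax wt]]]; have [sp _ _ _ _] := set_valP w.
    have [q wq] := step_path_rat t sp.
    by exists q => //; exists x => //; rewrite asboolT//= wq.
  by move=> [q _ [x _]]; case: asboolP => // Ax wq; exists (ratr q), x.
apply: bigcupT_measurable_rat => q; apply: countable_bigcupT_measurable => // x.
by case: ifP => // _; exact: measurable_coord.
Qed.

Lemma measurable_Wstar_visiting A : measurable (@Wstar_visiting R A).
Proof. by rewrite /measurable/= /measurable_Wstar/= piW_preimage_visiting; exact: measurable_visiting. Qed.

End visiting.

Section npoints.
Variable R : realType.
Lemma npoints_eq0 (B : set (Wstar R)) c :
  npoints B c = 0%E <-> forall i w, c i = Some w -> ~ B w.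
Proof.
split=> [n0 i w ci Bw|h]; last first.
  rewrite /npoints (_ : [set i | _] = set0) ?esum_set0//.
  by apply/seteqP; split => // i [w ci]; exact: h ci.
have : (1 <= npoints B c)%E.
  apply: esum_ge; exists [set i]; last by rewrite fsbig_set1.
  by split => // _ ->; exists w.
by rewrite n0 lee_fin ler10.
Qed.

Lemma measurable_npoints (B : set (Wstar R)) k : measurable B ->
  measurable [set c : point_config R | npoints B c = k%:R%:E].
Proof. by move=> mB; apply: sub_sigma_algebra; exists B, k. Qed.

Lemma vacant_npoints (A : {fset Z2}) :
  [set c : point_config R | forall x, x \in A -> ~ interlacement c x] =
  [set c | npoints (Wstar_visiting [set` A]) c = 0%:R%:E].
Proof.
apply/seteqP; split => c /=.
  move=> h; apply/npoints_eq0 => i w ci [w' [t [x [/= xA w't]]] piE].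
  apply: (h x xA); exists i, w; split => //; exists w' => //.
  by exists t, x.
move=> /npoints_eq0 h x xA [i [w [ci [w' [t [z [/= -> w't]]] piE]]]].
apply: (h i w ci); exists w' => //; by exists t, x.
Qed.
End npoints.

(** * Total mass of the intensity and vacancy probabilities *)

Section intensity.
Variables (R : realType) (d : measure_display) (Omega : measurableType d).
Variables (P : Z2 -> probability Omega R).
Variables (Z : nat -> Omega -> Z2) (T : nat -> Omega -> R) (xi : R -> Omega -> R).
Hypothesis walkP : is_srw P Z T xi.
Variables (eps : R) (eps_gt0 : 0 < eps).

Definition killed_capacity (A : {fset Z2}) : R :=
  \sum_(x <- A) escape_gf A (survival eps) x.

Lemma Q_setT (A : {fset Z2}) (Q : {measure set (W R) -> \bar R}) :
  is_Q P Z T xi eps A Q -> Q setT = (killed_capacity A)%:E.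
Proof.
move=> [Qout Qin].
have Qx x : x \in A -> Q [set w : W R | val w 0 = Some x] = (escape_gf A (survival eps) x)%:E.
  move=> xA; have mT D : coord_salgebra D (setT : set (R -> option Z2)).
    exact: (@measurableT _ (g_sigma_algebraType _)).
  have := Qin x setT setT xA (mT _) (mT _).
  rewrite (_ : [set w : W R | _] = [set w : W R | val w 0 = Some x]); last first.
    by apply/seteqP; split => w /=; [case|split].
  move=> ->; rewrite /condp setIT (_ : [set w | setT _] = setT)// probability_setT mulr1.
  rewrite -(equilibrium_measureE walkP A x eps_gt0) /equilibrium_measure.
  (* If escape has probability 0, the conditional probability is 0/0 = 0 by convention, which agrees
     with the vanishing equilibrium measure. *)
  by have [->|e0] := eqVneq (fine (P x (escape Z T xi eps [set` A]))) 0;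
    [rewrite mul0r|rewrite divff// mulr1].
pose F x := [set w : W R | val w 0 = Some x].
have mF x : measurable (F x) by exact: measurable_coord.
have tF : trivIset [set` A] F.
  by move=> x y _ _ [w [+ wy]]; rewrite /F/= wy => -[].
have -> : setT = \bigcup_(x in [set` A]) F x `|` [set w : W R | ~ embed [set` A] (val w 0)].
  apply/seteqP; split => // w _; have [[x xA wx]|no] := pselect (embed [set` A] (val w 0)).
    by left; exists x.
  by right.
have mU : measurable (\bigcup_(x in [set` A]) F x).
  by apply: fin_bigcup_measurable => //; exact: finite_fset.
rewrite measureU0//; last first.
  rewrite (_ : [set w : W R | _] = ~` \bigcup_(x in [set` A]) F x); first exact: measurableC.
  apply/seteqP; split => w /= h; first by case=> x xA wx; apply: h; exists x.
  by case=> x xA wx; apply: h; exists x.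
rewrite measure_fin_bigcup//.
rewrite fsbig_finite/=; last exact: finite_fset.
rewrite set_fsetK /killed_capacity -sumEFin big_seq [RHS]big_seq.
by apply: eq_bigr => x xA; exact: Qx.
Qed.

Lemma nu_visiting (Q : {fset Z2} -> {measure set (W R) -> \bar R})
    (nu : {measure set (Wstar R) -> \bar R}) (A : {fset Z2}) :
  is_nu Q nu -> is_Q P Z T xi eps A (Q A) ->
  nu (Wstar_visiting [set` A]) = (killed_capacity A)%:E.
Proof.
move=> [_ _ nuQ] QA; have := nuQ A setT measurableT.
by rewrite setTI preimage_setT (Q_setT QA).
Qed.

Lemma killed_capacity_ge0 A : 0 <= killed_capacity A.
Proof.
have /andP[l0 l1] := survival_itv eps_gt0.
by apply: sumr_ge0 => x _; apply: escape_gf_ge0; rewrite l0 ltW.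
Qed.

Lemma vacancy_prob (Q : {fset Z2} -> {measure set (W R) -> \bar R})
    (nu : {measure set (Wstar R) -> \bar R}) (u : R)
    (PP : probability (point_config R) R) (A : {fset Z2}) :
  0 < u -> is_nu Q nu -> is_Q P Z T xi eps A (Q A) ->
  is_poisson_pm (fun B => (u%:E * nu B)%E) PP ->
  PP [set c | forall x, x \in A -> ~ interlacement c x] =
    (expR (- (u * killed_capacity A)))%:E.
Proof.
move=> u0 nuP QP [PP1 _ _]; rewrite vacant_npoints.
rewrite PP1; [|exact: measurable_Wstar_visiting|]; rewrite (nu_visiting nuP QP) -EFinM ?ltry//=.
rewrite /poisson_prob; case: ltrP => [r0|r0].
  by rewrite esum_set1 /poisson_pmf r0 ?expr0 ?fact0 ?invr1 ?mul1r// lee_fin expR_ge0.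
(* For a rate that is not positive [poisson_prob] is the Dirac mass at 0, which agrees with the
   exponential formula at rate 0. *)
have -> : u * killed_capacity A = 0.
  by apply/eqP; rewrite eq_le r0 mulr_ge0 ?killed_capacity_ge0 ?(ltW u0).
by rewrite oppr0 expR0 diracE mem_set.
Qed.

End intensity.

(** * Inclusion-exclusion *)

Section inclusion_exclusion.
Variable R : realType.
Implicit Types (B : {fset Z2}) (C : seq Z2).

(** Vacancy on [B] and occupation on [C]: occupation at x is no condition at x minus vacancy at
    x. *)
Fixpoint incl_excl (phi : {fset Z2} -> R) B C : R :=
  if C is x :: C' then incl_excl phi B C' - incl_excl phi (x |` B)%fset C' else phi B.

Lemma incl_excl_div phi (c : R) B C :
  incl_excl phi B C / c = incl_excl (fun B => phi B / c) B C.
Proof. by elim: C B => //= x C IH B; rewrite mulrBl !IH. Qed.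

(** The recursion evaluates phi only at sets containing [B]. With [x0] = 0 this matches formulas
    known only for sets containing the origin. *)
Lemma eq_incl_excl (x0 : Z2) phi psi B C :
  (forall B, x0 \in B -> phi B = psi B) -> x0 \in B ->
  incl_excl phi B C = incl_excl psi B C.
Proof.
move=> phiE; elim: C B => [|x C IH] B xB /=; first exact: phiE.
by rewrite !IH// !inE xB orbT.
Qed.

Lemma incl_excl_cvg (x0 : Z2) (phi : nat -> {fset Z2} -> R) (phi0 : {fset Z2} -> R) B C :
  (forall B, x0 \in B -> phi N B @[N --> \oo] --> phi0 B) -> x0 \in B ->
  incl_excl (phi N) B C @[N --> \oo] --> incl_excl phi0 B C.
Proof.
move=> phiP; elim: C B => [|x C IH] B xB /=; first exact: phiP.
by apply: cvgB; apply: IH => //; rewrite !inE xB orbT.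
Qed.

(** The occupation map is a parameter so that one formula serves both the interlacement and
    [Qalpha]. *)
Definition pattern (T : Type) (occ : T -> Z2 -> bool) B C : set T :=
  [set w | (forall x, x \in B -> occ w x = false) /\ (forall x, x \in C -> occ w x)].

Section law.
Variables (d : measure_display) (T : measurableType d) (mu : probability T R).
Variable occ : T -> Z2 -> bool.
Local Notation pattern := (pattern occ).

Hypothesis mocc : forall B, measurable (pattern B [::]).

Lemma pattern_cons x B C :
  pattern B (x :: C) = pattern B C `\` pattern (x |` B)%fset C.
Proof.
apply/seteqP; split => w.
  move=> [wB wC]; split; first by split => // y yC; apply: wC; rewrite inE yC orbT.
  by move=> [/(_ x)]; rewrite !inE eqxx wC ?inE ?eqxx// => /(_ isT).
move=> [[wB wC] nw]; split => // y; rewrite inE => /predU1P[->|]; last exact: wC.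
apply/negPn/negP => /negbTE wx; apply: nw; split => // z.
by rewrite !inE => /predU1P[->//|]; exact: wB.
Qed.

Lemma pattern_law B C : measurable (pattern B C) /\
  fine (mu (pattern B C)) = incl_excl (fun B => fine (mu (pattern B [::]))) B C.
Proof.
elim: C B => [|x C IH] B; first by split => //; exact: mocc.
have [m1 E1] := IH B; have [m2 E2] := IH (x |` B)%fset.
have s12 : pattern (x |` B)%fset C `<=` pattern B C.
  by move=> w [wB wC]; split => // y yB; apply: wB; rewrite !inE yB orbT.
rewrite pattern_cons; split; first exact: measurableD.
rewrite /= -E1 -E2 measureD//; last by rewrite ltey_eq fin_num_measure.
rewrite setIidr//.
by rewrite fineB ?fin_num_measure.
Qed.

End law.
End inclusion_exclusion.

(** * Scaling limit of the capacities *)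

Section capacity_limit.
Variables (R : realType) (d : measure_display) (Omega : measurableType d).
Variables (P : Z2 -> probability Omega R).
Variables (Z : nat -> Omega -> Z2) (T : nat -> Omega -> R) (xi : R -> Omega -> R).
Hypothesis walkP : is_srw P Z T xi.
Variables (alpha : R) (eps u : nat -> R).
Hypothesis alpha_gt0 : 0 < alpha.
Hypothesis eps_gt0 : forall N, 0 < eps N.
Hypothesis epsE : asymp_equiv eps (fun N => (2 / pi * N%:R ^+ 2 * ln N%:R ^+ 2)^-1).
Hypothesis uE : asymp_equiv u (fun N => 2 / pi * alpha * ln N%:R ^+ 2).
Local Notation l_ := (fun N => survival (eps N)).
Local Notation g := (fun N => green (l_ N) 0).

Let l01 N : 0 <= l_ N < 1 := survival_itv (eps_gt0 N).
Let l1 : l_ @ \oo --> (1 : R) .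
Proof. exact: survival_cvg1 epsE. Qed.
Let gy : g @ \oo --> +oo := green0_cvgy eps_gt0 epsE.

Lemma capacityE A : 0 \in A ->
  capacity P Z T A = \sum_(y <- A) potential_kernel R y * limit_measure R A y.
Proof.
move=> A0; rewrite /capacity big_seq [RHS]big_seq; apply: eq_bigr => x xA.
by rewrite (harmonic_measureE walkP A0 l01 l1 gy xA).
Qed.

Lemma capacity_singleton : capacity P Z T [fset 0]%fset = 0.
Proof. by rewrite capacityE ?inE// big_seq_fset1 potential_kernel0 mul0r. Qed.

Lemma intensity_asymp : u N / g N ^+ 2 @[N --> \oo] --> pi / 2 * alpha.
Proof.
have a0 : alpha != 0 by rewrite gt_eqF.
have p0 : (pi : R) != 0 by rewrite gt_eqF// pi_gt0.
have h : u N / (2 / pi * alpha * ln N%:R ^+ 2) * (2 / pi * alpha) *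
    (g N / ln N%:R * (g N / ln N%:R))^-1 @[N --> \oo] -->
    1 * (2 / pi * alpha) * (2 / pi * (2 / pi))^-1.
  apply: cvgM; first by apply: cvgMl; exact: uE.
  apply: cvgV; first by rewrite !mulf_neq0// invr_eq0.
  by apply: cvgM; exact: green0_asymp epsE.
have -> : pi / 2 * alpha = 1 * (2 / pi * alpha) * (2 / pi * (2 / pi))^-1.
  by move: (pi : R) p0 => q q0; field.
apply: cvg_trans h; apply: near_eq_cvg.
have g0 : \forall N \near \oo, 0 < g N by move/cvgryPgt : gy; apply.
near=> N; have gN : g N != 0 by rewrite gt_eqF//; near: N.
have lN : ln (N%:R : R) != 0.
  rewrite gt_eqF// ln_gt0// ltr1n; near: N; exact: nbhs_infty_gt.
by move: (pi : R) p0 (ln _) lN => q q0 t t0; field; rewrite gN t0 a0 q0.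
Unshelve. all: by end_near.
Qed.

Lemma killed_capacity_cvg A : 0 \in A ->
  u N * (killed_capacity (eps N) A - killed_capacity (eps N) [fset 0]%fset) @[N --> \oo] -->
  pi / 2 * alpha * capacity P Z T A.
Proof.
move=> A0; rewrite capacityE//.
apply: cvg_trans (cvgM intensity_asymp (escape_gf_sumB A0 l01 l1 gy)); apply: near_eq_cvg.
have g0 : \forall N \near \oo, 0 < g N by move/cvgryPgt : gy; apply.
near=> N; have gN : g N != 0 by rewrite gt_eqF//; near: N.
rewrite /killed_capacity big_seq_fset1 escape_gf_singleton//.
by rewrite /= mulrA divfK// expf_neq0.
Unshelve. all: by end_near.
Qed.

End capacity_limit.

Theorem theorem5p3 (R : realType)
  (d : measure_display) (Omega : measurableType d)
  (P : Z2 -> probability Omega R)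
  (Z : nat -> Omega -> Z2) (T : nat -> Omega -> R) (xi : R -> Omega -> R)
  (walkP : is_srw P Z T xi)
  (Q : R -> {fset Z2} -> {measure set (W R) -> \bar R})
  (QP : forall (eps : R) (A : {fset Z2}), 0 < eps ->
    is_Q P Z T xi eps A (Q eps A))
  (nu : R -> {measure set (Wstar R) -> \bar R})
  (nuP : forall eps : R, 0 < eps -> is_nu (Q eps) (nu eps))
  (PP : R -> R -> probability (point_config R) R)
  (PPP : forall eps u : R, 0 < eps -> 0 < u ->
    is_poisson_pm (fun B => (u%:E * nu eps B)%E) (PP eps u))
  (alpha : R) (alpha_gt0 : 0 < alpha)
  (Qalpha : probability spins R)
  (QalphaP : is_Qalpha alpha (capacity P Z T) Qalpha)
  (eps u : nat -> R)
  (eps_gt0 : forall N, 0 < eps N)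
  (epsE : asymp_equiv eps (fun N => (2 / pi * N%:R ^+ 2 * ln N%:R ^+ 2)^-1))
  (u_gt0 : forall N, 0 < u N)
  (uE : asymp_equiv u (fun N => 2 / pi * alpha * ln N%:R ^+ 2)) :
  fdd_cvg (fun N => vacant0_law (PP (eps N) (u N))) (fun E => fine (Qalpha E)).
Proof.
move=> A eta; set E := [set y | _].
(* The conditioning on the vacancy of 0 is absorbed by putting 0 into [B]. If [eta 0] is true, then
   0 lies in both [B] and [C] and the pattern is empty, as it should be. *)
pose B := (0 |` [fset x in A | ~~ eta x])%fset.
pose C := [fset x in A | eta x]%fset : seq Z2.
have B0 : 0 \in B by rewrite !inE eqxx.
pose occ (c : point_config R) x := occupation c x.
have vacE B' : pattern occ B' [::] =
    [set c : point_config R | forall x, x \in B' -> ~ interlacement c x].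
  apply/seteqP; split => c; first by move=> [h _] x /h /asboolPn.
  by move=> h; split => // x /h /asboolPn/negbTE.
have spinE B' : pattern (fun (y : spins) x => y x) B' [::] =
    [set y : spins | forall x, x \in B' -> y x = false].
  by apply/seteqP; split => y; [case|split].
have EP (O : Type) (o : O -> Z2 -> bool) :
    [set w | o w 0 = false] `&` [set w | E (o w)] = pattern o B C.
  apply/seteqP; split => w.
    move=> [w0 wA]; split => x; rewrite !inE/=.
      by move=> /predU1P[->//|/andP[xA /negbTE <-]]; exact: wA.
    by move=> /andP[xA ex]; rewrite wA.
  move=> [wB wC]; split; first exact: wB.
  move=> x xA; case ex: (eta x); first by apply: wC; rewrite !inE/= xA ex.
  by apply: wB; rewrite !inE/= xA ex orbT.
have mocc B' : measurable (pattern occ B' [::]).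
  rewrite vacE vacant_npoints; apply: measurable_npoints.
  exact: measurable_Wstar_visiting.
have mspin x b : measurable [set y : spins | y x = b].
  by apply: sub_sigma_algebra; exists x, b.
have mspins B' : measurable (pattern (fun (y : spins) x => y x) B' [::]).
  rewrite spinE; rewrite (_ : [set y | _] = \bigcap_(x in [set` B']) [set y : spins | y x = false]).
    by apply: fin_bigcap_measurable => // ; exact: finite_fset.
  by apply/seteqP; split.
have vacP N B' : fine (PP (eps N) (u N) (pattern occ B' [::])) =
    expR (- (u N * killed_capacity (eps N) B')).
  by rewrite vacE (vacancy_prob walkP (eps_gt0 N) (u_gt0 N) (nuP _ _) (QP _ _ _) (PPP _ _ _ _)).
have vac0 (c : point_config R) : ~ interlacement c 0 <-> occ c 0 = false.
  by split => [/asboolPn/negbTE|/negbT/asboolPn].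
(* Since cap({0}) = 0, the site 0 is almost surely vacant under [Qalpha], so 0 may be added to the
   vacant sites in the limit law too. *)
have spin0 : Qalpha [set y : spins | y 0 = true] = 0%E.
  rewrite (_ : [set y | _] = ~` [set y : spins | forall x, x \in [fset 0]%fset -> y x = false]).
    rewrite probability_setC; last by rewrite -spinE.
    rewrite QalphaP ?inE// (capacity_singleton walkP eps_gt0 epsE).
    by rewrite mulr0 oppr0 expR0 subee.
  apply/seteqP; split => y /= => [y0 /(_ 0)|]; first by rewrite y0 inE eqxx => /(_ isT).
  by move=> h; apply/negPn/negP => /negbTE y0; apply: h => x; rewrite inE => /eqP->.
have -> : fine (Qalpha E) = incl_excl (fun B' => expR (- (pi / 2 * alpha * capacity P Z T B'))) B C.
  have mE : measurable (E : set spins).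
    rewrite (_ : E = \bigcap_(x in [set` A]) [set y : spins | y x = eta x]).
      by apply: fin_bigcap_measurable => //; exact: finite_fset.
    by apply/seteqP; split.
  transitivity (fine (Qalpha (pattern (fun (y : spins) x => y x) B C))).
    rewrite -EP (@measureDI _ _ _ Qalpha E [set y : spins | y 0 = true])//.
    rewrite [X in (_ + X)%E](_ : _ = 0%E); last first.
      apply: (@subset_measure0 _ _ _ Qalpha _ [set y : spins | y 0 = true]) => //.
      exact: measurableI.
    rewrite adde0; congr (fine (Qalpha _)); apply/seteqP; split => y.
      by move=> [Ey /= /negP/negbTE].
    by move=> [y0 Ey]; split => //=; rewrite y0.
  have [_ ->] := pattern_law Qalpha mspins B C.
  apply: (eq_incl_excl (x0 := 0)) => // B' B'0.
  by rewrite spinE QalphaP.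
have -> : (fun N => vacant0_law (PP (eps N) (u N)) E) = (fun N => incl_excl (fun B' =>
    expR (- (u N * (killed_capacity (eps N) B' - killed_capacity (eps N) [fset 0]%fset)))) B C).
  apply/funext => N; rewrite /vacant0_law /condp.
  have -> : [set c : point_config R | ~ interlacement c 0] = [set c | occ c 0 = false].
    by apply/seteqP; split => c /vac0.
  have -> : [set c | occ c 0 = false] `&` [set c : point_config R | E (occupation c)] =
    pattern occ B C by exact: EP.
  have -> : [set c | occ c 0 = false] = pattern occ [fset 0]%fset [::].
    apply/seteqP; split => c /=; first by move=> c0; split => // x; rewrite inE => /eqP->.
    by move=> [/(_ 0)]; rewrite inE eqxx => /(_ isT).
  have [_ ->] := pattern_law (PP (eps N) (u N)) mocc B C.
  rewrite incl_excl_div; apply: (eq_incl_excl (x0 := 0)) => // B' B'0.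
  by rewrite !vacP -expRN -expRD; congr expR; ring.
apply: (incl_excl_cvg (x0 := 0)) => // B' B'0.
apply: (@continuous_cvg _ _ _ _ _ _ expR); first exact: continuous_expR.
by apply: cvgN; apply: (killed_capacity_cvg walkP).
Qed.
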